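(* Let $0<\kappa<1$. For $\phi$ near $0$ define $$u(\phi)=\int_0^{\phi} F\!\left(\tfrac14,\tfrac34;\tfrac12;\kappa^2\sin^2\theta\right)\,\mathrm{d}\theta ,$$ let $u\mapsto\phi(u)$ be the local inverse near $0$ with $\phi(0)=0$, let $\psi=\psi(u)$ be defined near $u=0$ with $\psi(0)=0$ and $\sin\psi=\kappa\sin\phi$, and let $d$ be the elliptic function extending $\cos\psi$. Let $2\omega$ and $2i\omega'$ ($\omega,\omega'>0$) be the fundamental periods of the (rectangular) period lattice of the Weierstrass function $\wp(\,\cdot\,;g_2,g_3)$ with $g_2=\tfrac43-\kappa^2$, $g_3=\tfrac{8}{27}-\tfrac13\kappa^2$. Then $d$ has a simple zero $z^+$ on the open segment from $\omega$ to $\omega+i\omega'$ and a simple zero $z^-=\overline{z^+}$ on the open segment from $\omega$ to $\omega-i\omega'$.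
   Context: $F(a,b;c;z)$ denotes the Gauss hypergeometric function ${}_2F_1(a,b;c;z)$. The function $\cos\psi$, defined near $u=0$, extends to an elliptic function $d$ on $\mathbb{C}$. $\wp(\cdot;g_2,g_3)$ is the Weierstrass function satisfying $(\wp')^2=4\wp^3-g_2\wp-g_3$ with a double pole at $0$. *)

(* Defs.v *)
From Stdlib Require Import Reals Arith ZArith.
From Coquelicot Require Import Coquelicot.
Open Scope R_scope.

Fixpoint poch (a : R) (n : nat) : R :=
  match n with O => 1 | S k => poch a k * (a + INR k) end.

Definition hyp2f1 (a b c x : R) : R :=
  Series (fun n => poch a n * poch b n / (poch c n * INR (Factorial.fact n)) * x ^ n).

Definition u_of (kappa phi : R) : R :=
  RInt (fun theta => hyp2f1 (1/4) (3/4) (1/2) (kappa ^ 2 * sin theta ^ 2)) 0 phi.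

Definition Cis_derive (f : C -> C) (z l : C) : Prop :=
  @is_derive C_AbsRing C_NormedModule f z l.

Fixpoint Cpow (z : C) (n : nat) : C :=
  match n with O => RtoC 1 | S k => Cmult (Cpow z k) z end.

Definition holo_near (f : C -> C) (z : C) : Prop :=
  exists r, 0 < r /\ forall w, Cmod (Cminus w z) < r -> exists l, Cis_derive f w l.

(* f has a pole of order n at s (value of f at s itself is irrelevant) *)
Definition pole_of_order (f : C -> C) (s : C) (n : nat) : Prop :=
  (0 < n)%nat /\
  exists r (g : C -> C), 0 < r /\
    (forall w, Cmod (Cminus w s) < r -> exists l, Cis_derive g w l) /\
    g s <> RtoC 0 /\
    forall w, 0 < Cmod (Cminus w s) < r -> f w = Cdiv (g w) (Cpow (Cminus w s) n).

Definition meromorphic (f : C -> C) : Prop :=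
  forall z, holo_near f z \/ exists n, pole_of_order f z n.

(* p is a period of the meromorphic function f (junk values at poles ignored) *)
Definition is_period (f : C -> C) (p : C) : Prop :=
  forall z, holo_near f z -> holo_near f (Cplus z p) /\ f (Cplus z p) = f z.

Definition elliptic (f : C -> C) : Prop :=
  meromorphic f /\
  exists p1 p2 : C, is_period f p1 /\ is_period f p2 /\
    fst p1 * snd p2 - snd p1 * fst p2 <> 0.

Definition is_weierstrass (P : C -> C) (g2 g3 : R) : Prop :=
  meromorphic P /\ pole_of_order P (RtoC 0) 2 /\
  forall z, holo_near P z -> exists l, Cis_derive P z l /\
    Cmult l l = Cminus (Cminus (Cmult (RtoC 4) (Cpow (P z) 3))
                               (Cmult (RtoC g2) (P z))) (RtoC g3).

Definition simple_zero (f : C -> C) (z : C) : Prop :=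
  holo_near f z /\ f z = RtoC 0 /\ exists l, Cis_derive f z l /\ l <> RtoC 0.

(* Main.v *)
(** Since [F(1/4,3/4;1/2;sin^2 psi) = cos(psi/2)/cos psi], the function [d = cos psi] satisfies
[(d')^2 = 2 (1 - d) (d^2 - 1 + kappa^2)] near [u = 0], and [-1/3 + kappa^2 / (2 (1 - d))] solves the
differential equation of [P] with the same leading term [1/u^2] at [0]. Two such solutions agree, so
[(P + 1/3) (1 - d) = kappa^2 / 2] near [0] on the real line, hence everywhere by the identity theorem,
and zeros of [d] are the points where [P = kappa^2/2 - 1/3]. This value lies strictly between the two
largest roots [e2 < e1] of the cubic. The same uniqueness argument at the other poles shows that they
are periods, and that [P] is even and commutes with conjugation; so [P] is real on the line
[Re z = omega], where the equation forces it to start at [e1] at [omega]. If it did not cross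
[kappa^2/2 - 1/3] before [omega + i omega'], it would again be [e1] there, and its minimum in between
would be a critical value, hence [e1] as well, making [P] constant.

The identity theorem for functions that are merely complex differentiable rests on Goursat's theorem
for rectangles and on Cauchy's formula on a square: dividing out zeros [x_1, ..., x_n] of [F] close to
the centre shows [|F(w)| <= M q^n] with [q < 1]. *)

Require Import Defs.
From Stdlib Require Import Reals Lra Lia Classical ClassicalEpsilon.
From Coquelicot Require Import Coquelicot.
Open Scope R_scope.

(** * Complex differentiability *)

(** Complex differentiability on discs is the only regularity at hand, without power series or
    continuity of derivatives. The pole analysis does need a bound on [g'] near a pole; it comes
    from a Lipschitz estimate for Cauchy transforms. Values at poles are arbitrary, so identities
    between meromorphic functions are proved on punctured discs and carried to the centre only at
    regular points. At a pole the differential equation is singular and the usual uniqueness theorem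
    does not apply. It is replaced by a real energy estimate along a ray, which is why the identity
    theorem starts from vanishing on a short horizontal segment. The estimate allows any increasing
    real parameter: for the amplitude this is phi itself, so the inverse function phi(u) never has
    to be built. The equation alone forces every pole to have order 2 and leading coefficient 1.
    Hence all poles look alike, each is a period, and the given lattice leaves the strip
    [0 < |Re z| < 2 omega] free of poles; all later arguments on the real axis and on [Re z = omega]
    take place there. *)

Notation Diff f z := (exists l, Cis_derive f z l).

Lemma Cpow_eq z n : Defs.Cpow z n = Complex.Cpow z n.
Proof.
  induction n as [|n IH]; [reflexivity|].
  simpl; rewrite IH; ring.
Qed.

Lemma Cis_derive_eps (f : C -> C) (z l : C) :
  Cis_derive f z l <->
  forall e, 0 < e -> exists d, 0 < d /\ forall w, Cmod (w - z) < d ->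
    Cmod (f w - f z - l * (w - z)) <= e * Cmod (w - z).
Proof.
  unfold Cis_derive; split.
  - intros [_ H] e He.
    specialize (H z (fun P h => h) (mkposreal e He)).
    destruct H as [d Hd].
    exists d; split; [apply cond_pos|].
    intros w Hw. specialize (Hd w Hw).
    change (Cmod (f w - f z - (w - z) * l) <= e * Cmod (w - z)) in Hd.
    replace (l * (w - z))%C with ((w - z) * l)%C by ring. exact Hd.
  - intros H. split; [apply is_linear_scal_l|].
    intros x Hx e. pose proof (@is_filter_lim_locally_unique C_AbsRing
      (AbsRing_NormedModule C_AbsRing) z x Hx) as Ex. subst x.
    destruct (H e (cond_pos e)) as [d [Hd Hw]].
    exists (mkposreal d Hd). intros w Hwd.
    change (Cmod (f w - f z - (w - z) * l) <= e * Cmod (w - z)).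
    replace ((w - z) * l)%C with (l * (w - z))%C by ring. apply Hw. exact Hwd.
Qed.

(** The rules for identity, product and composition are stated for the module structure that [C] has
    as an absolute ring. The remainder estimate is convertible between the two structures; only the
    linearity component has to be rebuilt. *)
Lemma Cis_derive_AbsRing f z l :
  Cis_derive f z l <-> @is_derive C_AbsRing (AbsRing_NormedModule C_AbsRing) f z l.
Proof.
  unfold Cis_derive, is_derive, filterdiff.
  split; intros [_ H]; (split; [apply is_linear_scal_l|exact H]).
Qed.

Lemma Cis_derive_const c z : Cis_derive (fun _ => c) z (RtoC 0).
Proof. apply @is_derive_const. Qed.

Lemma Cis_derive_id z : Cis_derive (fun w => w) z (RtoC 1).
Proof. apply Cis_derive_AbsRing, @is_derive_id. Qed.

Lemma Cis_derive_plus f g z l m :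
  Cis_derive f z l -> Cis_derive g z m ->
  Cis_derive (fun w => f w + g w)%C z (l + m)%C.
Proof. apply @is_derive_plus. Qed.

Lemma Cis_derive_minus f g z l m :
  Cis_derive f z l -> Cis_derive g z m ->
  Cis_derive (fun w => f w - g w)%C z (l - m)%C.
Proof. apply @is_derive_minus. Qed.

Lemma Cis_derive_mult f g z l m :
  Cis_derive f z l -> Cis_derive g z m ->
  Cis_derive (fun w => f w * g w)%C z (l * g z + f z * m)%C.
Proof.
  rewrite !Cis_derive_AbsRing. intros Hf Hg.
  apply (@is_derive_mult C_AbsRing f g z l m Hf Hg).
  intros n k; apply Cmult_comm.
Qed.

Lemma Cis_derive_comp f g z l m :
  Cis_derive f (g z) l -> Cis_derive g z m ->
  Cis_derive (fun w => f (g w)) z (m * l)%C.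
Proof. rewrite (Cis_derive_AbsRing g). apply @is_derive_comp. Qed.

Lemma Cis_derive_unique f z l m :
  Cis_derive f z l -> Cis_derive f z m -> l = m.
Proof.
  intros H1 H2.
  rewrite <- (is_C_derive_unique f z l H1). apply is_C_derive_unique, H2.
Qed.

Lemma Cis_derive_ext_near f g z l r :
  0 < r -> (forall w, Cmod (w - z) < r -> f w = g w) ->
  Cis_derive f z l -> Cis_derive g z l.
Proof.
  intros Hr E H. apply Cis_derive_eps. intros e He.
  destruct (proj1 (Cis_derive_eps f z l) H e He) as [d [Hd Hw]].
  exists (Rmin d r); split; [apply Rmin_glb_lt; assumption|].
  intros w Hwd. rewrite <- !E.
  - apply Hw. eapply Rlt_le_trans; [exact Hwd|apply Rmin_l].
  - replace (z - z)%C with (RtoC 0) by ring. rewrite Cmod_0; exact Hr.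
  - eapply Rlt_le_trans; [exact Hwd|apply Rmin_r].
Qed.

Definition Ccont (f : C -> C) (z : C) : Prop :=
  forall e, 0 < e -> exists d, 0 < d /\ forall w, Cmod (w - z) < d ->
    Cmod (f w - f z) < e.

Lemma Cmod_triangle_sub (a b : C) : Cmod (a - b) <= Cmod a + Cmod b.
Proof. unfold Cminus. rewrite <- (Cmod_opp b). apply Cmod_triangle. Qed.

Lemma Diff_cont f z : Diff f z -> Ccont f z.
Proof.
  intros [l H] e He.
  destruct (proj1 (Cis_derive_eps f z l) H 1 Rlt_0_1) as [d [Hd Hw]].
  pose proof (Cmod_ge_0 l) as Hl.
  assert (He' : 0 < e / (2 + Cmod l)) by (apply Rdiv_lt_0_compat; lra).
  exists (Rmin d (e / (2 + Cmod l))); split; [apply Rmin_glb_lt; lra|].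
  intros w Hwd.
  assert (H1 : Cmod (w - z) < d) by (eapply Rlt_le_trans; [exact Hwd|apply Rmin_l]).
  assert (H2 : Cmod (w - z) < e / (2 + Cmod l))
    by (eapply Rlt_le_trans; [exact Hwd|apply Rmin_r]).
  specialize (Hw w H1).
  replace (f w - f z)%C with ((f w - f z - l * (w - z)) + l * (w - z))%C by ring.
  eapply Rle_lt_trans; [apply Cmod_triangle|]. rewrite Cmod_mult.
  pose proof (Cmod_ge_0 (w - z)).
  apply (Rmult_lt_compat_r (2 + Cmod l)) in H2; [|lra].
  unfold Rdiv in H2. rewrite Rmult_assoc, Rinv_l, Rmult_1_r in H2 by lra.
  nra.
Qed.

Lemma Ccont_neq f z : Ccont f z -> f z <> RtoC 0 ->
  exists d, 0 < d /\ forall w, Cmod (w - z) < d -> Cmod (f z) / 2 < Cmod (f w).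
Proof.
  intros H Hz. apply Cmod_gt_0 in Hz.
  destruct (H (Cmod (f z) / 2)) as [d [Hd Hw]]; [lra|].
  exists d; split; [exact Hd|]. intros w Hwd. specialize (Hw w Hwd).
  assert (Cmod (f z) <= Cmod (f w) + Cmod (f w - f z)).
  { replace (f z) with (f w - (f w - f z))%C at 1 by ring. apply Cmod_triangle_sub. }
  lra.
Qed.

Lemma Cis_derive_Cinv z : z <> RtoC 0 ->
  Cis_derive Cinv z (- (/ (z * z)))%C.
Proof.
  intros Hz. apply Cis_derive_eps. intros e He.
  pose proof (proj1 (Cmod_gt_0 z) Hz) as Hm.
  set (m := Cmod z) in *.
  (* The remainder is [(w - z)^2 / (w z^2)]. The radius [m / 2] keeps [|w| > m / 2], and then the
     second radius gives [|w - z| <= e |w| m^2]. *)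
  assert (Hd : 0 < Rmin (m / 2) (e * (m * m * m) / 2)).
  { apply Rmin_glb_lt; [lra|].
    assert (0 < m * m * m) by (repeat apply Rmult_lt_0_compat; lra). nra. }
  exists (Rmin (m / 2) (e * (m * m * m) / 2)); split; [exact Hd|].
  intros w Hw.
  assert (H1 : Cmod (w - z) < m / 2) by (eapply Rlt_le_trans; [exact Hw|apply Rmin_l]).
  assert (H2 : Cmod (w - z) < e * (m * m * m) / 2)
    by (eapply Rlt_le_trans; [exact Hw|apply Rmin_r]).
  assert (Hwm : m / 2 < Cmod w).
  { assert (m <= Cmod w + Cmod (w - z)).
    { unfold m. replace z with (w - (w - z))%C at 1 by ring. apply Cmod_triangle_sub. }
    lra. }
  assert (Hw0 : w <> RtoC 0) by (apply Cmod_gt_0; lra).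
  replace (/ w - / z - - / (z * z) * (w - z))%C
    with ((w - z) * (w - z) * / (w * (z * z)))%C.
  2:{ field. split; assumption. }
  rewrite !Cmod_mult, Cmod_inv.
  2:{ repeat apply Cmult_neq_0; assumption. }
  rewrite !Cmod_mult. fold m.
  pose proof (Cmod_ge_0 (w - z)) as H0.
  set (x := Cmod (w - z)) in *.
  assert (Hp : 0 < Cmod w * (m * m)) by (repeat apply Rmult_lt_0_compat; lra).
  apply (Rmult_le_reg_r (Cmod w * (m * m))); [exact Hp|].
  rewrite Rmult_assoc, Rinv_l, Rmult_1_r.
  2:{ apply Rgt_not_eq. exact Hp. }
  assert (e * (m * m * m) / 2 <= e * (Cmod w * (m * m))).
  { assert (Hmm : 0 < m * m) by nra.
    assert (m / 2 * (m * m) <= Cmod w * (m * m)) by (apply Rmult_le_compat_r; lra).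
    assert (e * (m / 2 * (m * m)) <= e * (Cmod w * (m * m))) by (apply Rmult_le_compat_l; lra).
    lra. }
  assert (x * x <= x * (e * (Cmod w * (m * m)))) by (apply Rmult_le_compat_l; lra).
  lra.
Qed.

Lemma Cis_derive_inv f z l : f z <> RtoC 0 -> Cis_derive f z l ->
  Cis_derive (fun w => / f w)%C z (- l / (f z * f z))%C.
Proof.
  intros Hz H.
  replace (- l / (f z * f z))%C with (l * (- (/ (f z * f z))))%C.
  2:{ field; exact Hz. }
  apply (Cis_derive_comp Cinv); [apply Cis_derive_Cinv; exact Hz|exact H].
Qed.

Lemma Diff_const c z : Diff (fun _ => c) z.
Proof. eexists; apply Cis_derive_const. Qed.
Lemma Diff_id z : Diff (fun w => w) z.
Proof. eexists; apply Cis_derive_id. Qed.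
Lemma Diff_plus f g z : Diff f z -> Diff g z -> Diff (fun w => f w + g w)%C z.
Proof. intros [l H] [m K]; eexists; apply Cis_derive_plus; eassumption. Qed.
Lemma Diff_minus f g z : Diff f z -> Diff g z -> Diff (fun w => f w - g w)%C z.
Proof. intros [l H] [m K]; eexists; apply Cis_derive_minus; eassumption. Qed.
Lemma Diff_mult f g z : Diff f z -> Diff g z -> Diff (fun w => f w * g w)%C z.
Proof. intros [l H] [m K]; eexists; apply Cis_derive_mult; eassumption. Qed.
Lemma Diff_inv f z : f z <> RtoC 0 -> Diff f z -> Diff (fun w => / f w)%C z.
Proof. intros Hz [l H]; eexists; apply Cis_derive_inv; eassumption. Qed.
Lemma Diff_div f g z : g z <> RtoC 0 -> Diff f z -> Diff g z ->
  Diff (fun w => f w / g w)%C z.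
Proof. intros Hz Hf Hg. apply Diff_mult; [exact Hf|apply Diff_inv; assumption]. Qed.
Lemma Diff_comp f g z : Diff f (g z) -> Diff g z -> Diff (fun w => f (g w)) z.
Proof. intros [l H] [m K]; eexists; apply Cis_derive_comp; eassumption. Qed.
Lemma Diff_pow f n z : Diff f z -> Diff (fun w => Complex.Cpow (f w) n) z.
Proof.
  intros H. induction n as [|n IH]; simpl; [apply Diff_const|apply Diff_mult; assumption].
Qed.
Lemma Diff_ext_near f g z r : 0 < r ->
  (forall w, Cmod (w - z) < r -> f w = g w) -> Diff f z -> Diff g z.
Proof. intros Hr E [l H]; exists l; eapply Cis_derive_ext_near; eassumption. Qed.

Ltac diff_tac :=
  lazymatch goal with
  | |- exists l, Cis_derive (fun w => w) _ l => apply Diff_id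
  | |- exists l, Cis_derive (fun _ => ?c) _ l => apply Diff_const
  | |- exists l, Cis_derive (fun w => Cplus (@?f w) (@?g w)) _ l =>
      apply (Diff_plus f g); diff_tac
  | |- exists l, Cis_derive (fun w => Cminus (@?f w) (@?g w)) _ l =>
      apply (Diff_minus f g); diff_tac
  | |- exists l, Cis_derive (fun w => Cdiv (@?f w) (@?g w)) _ l =>
      apply (Diff_div f g); [|diff_tac|diff_tac]
  | |- exists l, Cis_derive (fun w => Cmult (@?f w) (@?g w)) _ l =>
      apply (Diff_mult f g); diff_tac
  | |- exists l, Cis_derive (fun w => Complex.Cpow (@?f w) ?n) _ l =>
      apply (Diff_pow f n); diff_tac
  | |- _ => try assumption
  end.

Lemma Cis_derive_conj f z l : Cis_derive f (Cconj z) l ->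
  Cis_derive (fun w => Cconj (f (Cconj w))) z (Cconj l).
Proof.
  intros H. apply Cis_derive_eps. intros e He.
  destruct (proj1 (Cis_derive_eps _ _ _) H e He) as [d [Hd Hw]].
  exists d; split; [exact Hd|]. intros w Hwd.
  assert (E : (Cconj w - Cconj z)%C = Cconj (w - z)%C)
    by (rewrite Cminus_conj; reflexivity).
  specialize (Hw (Cconj w)). rewrite E, Cmod_conj in Hw. specialize (Hw Hwd).
  eapply Rle_trans; [|exact Hw]. rewrite <- (Cmod_conj (f (Cconj w) - _ - _)).
  rewrite 2!Cminus_conj, Cmult_conj, Cconj_conj. apply Rle_refl.
Qed.

(** * Contour integrals over rectangles *)

(** Componentwise, so that the lemmas on real integrals apply; the price is the factor 2 in
    [cint_bound]. *)
Definition cint (f : R -> C) (a b : R) : C :=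
  (RInt (fun t => fst (f t)) a b, RInt (fun t => snd (f t)) a b).

Definition cex (f : R -> C) (a b : R) : Prop :=
  ex_RInt (fun t => fst (f t)) a b /\ ex_RInt (fun t => snd (f t)) a b.

Lemma cex_minus f g a b : cex f a b -> cex g a b -> cex (fun t => f t - g t)%C a b.
Proof.
  intros [H1 H2] [H3 H4]; split.
  - apply (ex_RInt_minus (V:=R_NormedModule) (fun t => fst (f t)) (fun t => fst (g t))); assumption.
  - apply (ex_RInt_minus (V:=R_NormedModule) (fun t => snd (f t)) (fun t => snd (g t))); assumption.
Qed.

Lemma cint_minus f g a b : cex f a b -> cex g a b ->
  cint (fun t => f t - g t)%C a b = (cint f a b - cint g a b)%C.
Proof.
  intros [H1 H2] [H3 H4]. unfold cint, Cminus, Cplus, Copp; simpl. f_equal.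
  - apply (RInt_minus (V:=R_CompleteNormedModule) (fun t => fst (f t)) (fun t => fst (g t))); assumption.
  - apply (RInt_minus (V:=R_CompleteNormedModule) (fun t => snd (f t)) (fun t => snd (g t))); assumption.
Qed.

Lemma is_RInt_lin (u v : R -> R) (p q a b : R) : ex_RInt u a b -> ex_RInt v a b ->
  is_RInt (fun t => p * u t + q * v t) a b (p * RInt u a b + q * RInt v a b).
Proof.
  intros Hu Hv.
  apply (is_RInt_plus (V:=R_NormedModule) (fun t => p * u t) (fun t => q * v t)).
  - apply (is_RInt_scal (V:=R_NormedModule) u), (RInt_correct (V:=R_CompleteNormedModule)), Hu.
  - apply (is_RInt_scal (V:=R_NormedModule) v), (RInt_correct (V:=R_CompleteNormedModule)), Hv.
Qed.

Lemma cex_scal c f a b : cex f a b -> cex (fun t => c * f t)%C a b.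
Proof.
  destruct c as [p q]. intros [H1 H2]; split; simpl.
  - eexists. eapply is_RInt_ext; [|apply (is_RInt_lin _ _ p (- q) a b H1 H2)].
    intros; simpl; ring.
  - eexists. eapply is_RInt_ext; [|apply (is_RInt_lin _ _ q p a b H1 H2)].
    intros; simpl; ring.
Qed.

Lemma cint_scal c f a b : cex f a b ->
  cint (fun t => c * f t)%C a b = (c * cint f a b)%C.
Proof.
  destruct c as [p q]. intros [H1 H2]; unfold cint, Cmult; simpl. f_equal.
  - apply is_RInt_unique. eapply is_RInt_ext; [|replace (_ - _) with
      (p * RInt (fun t => fst (f t)) a b + (- q) * RInt (fun t => snd (f t)) a b) by ring;
      apply (is_RInt_lin _ _ p (- q) a b H1 H2)].
    intros; simpl; ring.
  - apply is_RInt_unique. eapply is_RInt_ext; [|replace (_ + _) with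
      (q * RInt (fun t => fst (f t)) a b + p * RInt (fun t => snd (f t)) a b) by ring;
      apply (is_RInt_lin _ _ q p a b H1 H2)].
    intros; simpl; ring.
Qed.

Lemma cint_Chasles f a b c : cex f a b -> cex f b c ->
  cint f a c = (cint f a b + cint f b c)%C.
Proof.
  intros [H1 H2] [H3 H4]. unfold cint, Cplus; simpl. f_equal; symmetry.
  - apply (RInt_Chasles (V:=R_CompleteNormedModule) (fun t => fst (f t))); assumption.
  - apply (RInt_Chasles (V:=R_CompleteNormedModule) (fun t => snd (f t))); assumption.
Qed.

Lemma cint_const c a b : cint (fun _ => c) a b = (RtoC (b - a) * c)%C.
Proof.
  unfold cint. rewrite !RInt_const. destruct c as [p q].
  unfold Cmult, RtoC, scal; simpl. unfold mult; simpl. f_equal; ring.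
Qed.

Lemma cint_ext f g a b : a <= b -> (forall t, a <= t <= b -> f t = g t) ->
  cint f a b = cint g a b.
Proof.
  intros Hab H. unfold cint. f_equal; apply RInt_ext; intros x;
  rewrite Rmin_left, Rmax_right by assumption; intros Hx; rewrite H; trivial; lra.
Qed.

Lemma Cmod_le_abs z : Cmod z <= Rabs (fst z) + Rabs (snd z).
Proof.
  destruct z as [x y]; simpl.
  replace ((x, y) : C) with (RtoC x + RtoC y * Ci)%C.
  2:{ unfold RtoC, Ci, Cplus, Cmult; simpl; f_equal; ring. }
  eapply Rle_trans; [apply Cmod_triangle|].
  rewrite Cmod_mult, Cmod_Ci, !Cmod_R. lra.
Qed.

Lemma fst_le_Cmod z : Rabs (fst z) <= Cmod z.
Proof. apply re_le_Cmod. Qed.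

Lemma snd_le_Cmod z : Rabs (snd z) <= Cmod z.
Proof. eapply Rle_trans; [apply Rmax_r|apply Rmax_Cmod]. Qed.

Lemma cint_bound f a b M : a <= b -> cex f a b ->
  (forall t, a <= t <= b -> Cmod (f t) <= M) -> Cmod (cint f a b) <= 2 * M * (b - a).
Proof.
  intros Hab [H1 H2] H. eapply Rle_trans; [apply Cmod_le_abs|]. unfold cint; simpl.
  assert (K1 : Rabs (RInt (fun t => fst (f t)) a b) <= (b - a) * M).
  { apply abs_RInt_le_const; trivial. intros t Ht.
    eapply Rle_trans; [apply fst_le_Cmod|apply H, Ht]. }
  assert (K2 : Rabs (RInt (fun t => snd (f t)) a b) <= (b - a) * M).
  { apply abs_RInt_le_const; trivial. intros t Ht.
    eapply Rle_trans; [apply snd_le_Cmod|apply H, Ht]. }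
  lra.
Qed.

Lemma Diff_continuous_path F (g : R -> C) t :
  (forall s, Cmod (g s - g t) <= Rabs (s - t)) -> Diff F (g t) ->
  continuous (fun s => fst (F (g s))) t /\ continuous (fun s => snd (F (g s))) t.
Proof.
  intros Hg HF. apply Diff_cont in HF.
  split; apply filterlim_locally; intros e;
  destruct (HF e (cond_pos e)) as [d [Hd Hw]];
  exists (mkposreal d Hd); intros s Hs;
  (assert (K : Cmod (F (g s) - F (g t)) < e)
    by (apply Hw; eapply Rle_lt_trans; [apply Hg|exact Hs]));
  (eapply Rle_lt_trans; [|exact K]).
  - apply (fst_le_Cmod (F (g s) - F (g t))%C).
  - apply (snd_le_Cmod (F (g s) - F (g t))%C).
Qed.

Lemma Cmod_hor x x' y : Cmod ((x, y) - (x', y)) <= Rabs (x - x').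
Proof.
  eapply Rle_trans; [apply Cmod_le_abs|]. simpl.
  replace (y + - y) with 0 by ring. rewrite Rabs_R0. unfold Rminus. lra.
Qed.

Lemma Cmod_ver x y y' : Cmod ((x, y) - (x, y')) <= Rabs (y - y').
Proof.
  eapply Rle_trans; [apply Cmod_le_abs|]. simpl.
  replace (x + - x) with 0 by ring. rewrite Rabs_R0. unfold Rminus. lra.
Qed.

Lemma cex_hor F y a b : a <= b -> (forall x, a <= x <= b -> Diff F (x, y)) ->
  cex (fun x => F (x, y)) a b.
Proof.
  intros Hab H. split; apply (ex_RInt_continuous (V:=R_CompleteNormedModule)); intros z;
  rewrite Rmin_left, Rmax_right by assumption; intros Hz;
  apply (Diff_continuous_path F (fun x => (x, y))); try (exact (H z Hz));
  intros s; apply Cmod_hor.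
Qed.

Lemma cex_ver F x a b : a <= b -> (forall y, a <= y <= b -> Diff F (x, y)) ->
  cex (fun y => F (x, y)) a b.
Proof.
  intros Hab H. split; apply (ex_RInt_continuous (V:=R_CompleteNormedModule)); intros z;
  rewrite Rmin_left, Rmax_right by assumption; intros Hz;
  apply (Diff_continuous_path F (fun y => (x, y))); try (exact (H z Hz));
  intros s; apply Cmod_ver.
Qed.

(** The positively oriented boundary integral, with opposite sides paired: bottom minus top, then
    [i] times right minus left. The pairing makes the integral of an affine function visibly
    zero. *)
Definition contour (F : C -> C) (a b a' b' : R) : C :=
  (cint (fun x => F (x, a') - F (x, b'))%C a b
   + Ci * cint (fun y => F (b, y) - F (a, y))%C a' b')%C.

Definition on_boundary (a b a' b' : R) (z : C) : Prop :=
  (a <= fst z <= b /\ (snd z = a' \/ snd z = b')) \/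
  (a' <= snd z <= b' /\ (fst z = a \/ fst z = b)).

Section Contour.
Variables a b a' b' : R.
Hypothesis Hab : a <= b.
Hypothesis Hab' : a' <= b'.

Let bd := on_boundary a b a' b'.

Lemma cex_sides F : (forall z, bd z -> Diff F z) ->
  cex (fun x => F (x, a')) a b /\ cex (fun x => F (x, b')) a b /\
  cex (fun y => F (a, y)) a' b' /\ cex (fun y => F (b, y)) a' b'.
Proof.
  intros H. refine (conj (cex_hor F a' a b Hab _) (conj (cex_hor F b' a b Hab _)
    (conj (cex_ver F a a' b' Hab' _) (cex_ver F b a' b' Hab' _))));
  intros; apply H; unfold bd, on_boundary; simpl; auto.
Qed.

Lemma contour_minus F G : (forall z, bd z -> Diff F z) -> (forall z, bd z -> Diff G z) ->
  contour (fun z => F z - G z)%C a b a' b' = (contour F a b a' b' - contour G a b a' b')%C.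
Proof.
  intros HF HG. unfold contour.
  destruct (cex_sides F HF) as (F1 & F2 & F3 & F4).
  destruct (cex_sides G HG) as (G1 & G2 & G3 & G4).
  rewrite !(cint_minus (fun x => _ - _)%C) by (apply cex_minus; assumption).
  rewrite !cint_minus by assumption. ring.
Qed.

Lemma contour_scal c F : (forall z, bd z -> Diff F z) ->
  contour (fun z => c * F z)%C a b a' b' = (c * contour F a b a' b')%C.
Proof.
  intros HF. unfold contour.
  destruct (cex_sides F HF) as (F1 & F2 & F3 & F4).
  rewrite !(cint_minus (fun x => _ * _)%C) by (apply cex_scal; assumption).
  rewrite !cint_scal by assumption.
  rewrite !cint_minus by assumption. ring.
Qed.

Lemma contour_ext F G : (forall z, bd z -> F z = G z) ->
  contour F a b a' b' = contour G a b a' b'.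
Proof.
  intros H. unfold contour. f_equal; [|f_equal]; apply cint_ext; trivial;
  intros t Ht; rewrite !H; trivial; unfold bd, on_boundary; simpl; auto.
Qed.

(** The factor 4 is 2 for the difference of two opposite sides times 2 from [cint_bound]. Sharp
    constants are irrelevant below. *)
Lemma contour_bound F M : (forall z, bd z -> Diff F z) ->
  (forall z, bd z -> Cmod (F z) <= M) ->
  Cmod (contour F a b a' b') <= 4 * M * ((b - a) + (b' - a')).
Proof.
  intros HF HM. destruct (cex_sides F HF) as (F1 & F2 & F3 & F4).
  unfold contour. eapply Rle_trans; [apply Cmod_triangle|].
  rewrite Cmod_mult, Cmod_Ci, Rmult_1_l.
  assert (K : forall z w, bd z -> bd w -> Cmod (F z - F w) <= 2 * M).
  { intros z w Hz Hw. eapply Rle_trans; [apply Cmod_triangle_sub|].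
    pose proof (HM z Hz). pose proof (HM w Hw). lra. }
  assert (K1 : Cmod (cint (fun x => F (x, a') - F (x, b'))%C a b) <= 2 * (2 * M) * (b - a)).
  { apply cint_bound; trivial; [apply cex_minus; assumption|].
    intros t Ht; apply K; unfold bd, on_boundary; simpl; auto. }
  assert (K2 : Cmod (cint (fun y => F (b, y) - F (a, y))%C a' b') <= 2 * (2 * M) * (b' - a')).
  { apply cint_bound; trivial; [apply cex_minus; assumption|].
    intros t Ht; apply K; unfold bd, on_boundary; simpl; auto. }
  lra.
Qed.

(** Differences between opposite sides are constants, and the two constant integrals cancel. This
    removes the first-order Taylor part in [goursat]. *)
Lemma contour_affine p q : contour (fun z => p + q * z)%C a b a' b' = RtoC 0.
Proof.
  unfold contour.
  rewrite (cint_ext _ (fun _ => q * (Ci * RtoC (a' - b')))%C a b Hab).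
  2:{ intros t _. destruct p, q. unfold Cminus, Cplus, Cmult, Copp, RtoC, Ci; simpl.
      f_equal; ring. }
  rewrite (cint_ext _ (fun _ => q * RtoC (b - a))%C a' b' Hab').
  2:{ intros t _. destruct p, q. unfold Cminus, Cplus, Cmult, Copp, RtoC, Ci; simpl.
      f_equal; ring. }
  rewrite !cint_const.
  rewrite !RtoC_minus. ring.
Qed.

Lemma contour_split_x m F : a <= m <= b -> (forall z, bd z -> Diff F z) ->
  (forall y, a' <= y <= b' -> Diff F (m, y)) ->
  contour F a b a' b' = (contour F a m a' b' + contour F m b a' b')%C.
Proof.
  intros Hm HF HFm. destruct (cex_sides F HF) as (F1 & F2 & F3 & F4). unfold contour.
  assert (HB : forall x, a <= x <= b -> Diff F (x, a') /\ Diff F (x, b')).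
  { intros x Hx; split; apply HF; unfold bd, on_boundary; simpl; auto. }
  assert (E : forall s t, a <= s -> s <= t -> t <= b -> cex (fun x => F (x, a') - F (x, b'))%C s t).
  { intros s t ? ? ?. apply cex_minus; apply cex_hor; trivial; intros; apply HB; lra. }
  rewrite (cint_Chasles _ a m b) by (apply E; lra).
  pose proof (cex_ver F m a' b' Hab' HFm) as Fm.
  rewrite !(cint_minus (fun y => F (_, y))) by assumption. ring.
Qed.

Lemma contour_split_y m F : a' <= m <= b' -> (forall z, bd z -> Diff F z) ->
  (forall x, a <= x <= b -> Diff F (x, m)) ->
  contour F a b a' b' = (contour F a b a' m + contour F a b m b')%C.
Proof.
  intros Hm HF HFm. destruct (cex_sides F HF) as (F1 & F2 & F3 & F4). unfold contour.
  assert (HB : forall y, a' <= y <= b' -> Diff F (a, y) /\ Diff F (b, y)).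
  { intros x Hx; split; apply HF; unfold bd, on_boundary; simpl; auto. }
  assert (E : forall s t, a' <= s -> s <= t -> t <= b' -> cex (fun y => F (b, y) - F (a, y))%C s t).
  { intros s t ? ? ?. apply cex_minus; apply cex_ver; trivial; intros; apply HB; lra. }
  rewrite (cint_Chasles _ a' m b') by (apply E; lra).
  pose proof (cex_hor F m a b Hab HFm) as Fm.
  rewrite !(cint_minus (fun x => F (x, _))) by assumption. ring.
Qed.
End Contour.

(** * Goursat and Cauchy on rectangles *)

Definition in_rect (a b a' b' : R) (z : C) : Prop :=
  a <= fst z <= b /\ a' <= snd z <= b'.

Lemma on_boundary_in_rect a b a' b' z : a <= b -> a' <= b' ->
  on_boundary a b a' b' z -> in_rect a b a' b' z.
Proof. unfold on_boundary, in_rect. lra. Qed.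

(** Produces the sequence of nested rectangles: [good] is the invariant at level [n], [step] the
    relation between consecutive levels. *)
Lemma dependent_choice (A : Type) (a0 : A) (good : nat -> A -> Prop)
  (step : nat -> A -> A -> Prop) :
  good O a0 -> (forall n a, good n a -> exists b, good (S n) b /\ step n a b) ->
  exists u : nat -> A, u O = a0 /\ forall n, good n (u n) /\ step n (u n) (u (S n)).
Proof.
  intros H0 HS.
  pose (u := fix u n := match n with O => a0
    | S k => epsilon (inhabits a0) (fun b => good (S k) b /\ step k (u k) b) end).
  assert (G : forall n, good n (u n)).
  { induction n as [|n IH]; [exact H0|].
    exact (proj1 (epsilon_spec (inhabits a0) _ (HS n (u n) IH))). }
  exists u; split; [reflexivity|]. intros n; split; [apply G|].
  exact (proj2 (epsilon_spec (inhabits a0) _ (HS n (u n) (G n)))).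
Qed.

Lemma half_pow_S n : (/ 2) ^ n = 2 * (/ 2) ^ S n.
Proof. simpl. field. Qed.

Lemma half_pow_pos n : 0 < (/ 2) ^ n.
Proof. apply pow_lt; lra. Qed.

Lemma half_pow_small e : 0 < e -> exists n, (/ 2) ^ n < e.
Proof.
  intros He. destruct (pow_lt_1_zero (/ 2)) with (y := e) as [N HN]; trivial.
  - rewrite Rabs_pos_eq; lra.
  - exists N. specialize (HN N (le_n N)). rewrite Rabs_pos_eq in HN; trivial.
    left; apply half_pow_pos.
Qed.

Lemma nested_point (x : nat -> R) A : 0 <= A ->
  (forall n, x n <= x (S n) /\ x (S n) + A * (/ 2) ^ S n <= x n + A * (/ 2) ^ n) ->
  exists l, forall n, x n <= l <= x n + A * (/ 2) ^ n.
Proof.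
  intros HA H.
  assert (M : forall n k, x n <= x (n + k)%nat /\
     x (n + k)%nat + A * (/ 2) ^ (n + k) <= x n + A * (/ 2) ^ n).
  { intros n k. induction k as [|k IH].
    - rewrite Nat.add_0_r; lra.
    - rewrite Nat.add_succ_r. destruct (H (n + k)%nat). lra. }
  assert (B : forall n m, x m <= x n + A * (/ 2) ^ n).
  { intros n m. pose proof (half_pow_pos n). pose proof (half_pow_pos m).
    destruct (Nat.le_ge_cases n m) as [L|L].
    - destruct (M n (m - n)%nat) as [_ K]. replace (n + (m - n))%nat with m in K by lia. nra.
    - destruct (M m (n - m)%nat) as [K _]. replace (m + (n - m))%nat with n in K by lia. nra. }
  destruct (completeness (fun y => exists n, y = x n)) as [l [Hl1 Hl2]].
  - exists (x O + A * (/ 2) ^ O). intros y [n ->]. apply B.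
  - exists (x O), O. reflexivity.
  - exists l. intros n; split; [apply Hl1; exists n; reflexivity|].
    apply Hl2. intros y [m ->]. apply B.
Qed.

(* Quartering: a rectangle whose contour integral is large contains a quarter whose integral is at least a quarter as large. *)
Lemma goursat F a b a' b' : a < b -> a' < b' ->
  (forall z, in_rect a b a' b' z -> Diff F z) -> contour F a b a' b' = RtoC 0.
Proof.
  intros Hab Hab' HF.
  set (A := b - a). set (B := b' - a').
  (* A rectangle of level [n] is recorded by its lower left corner; its sides are the original ones
     divided by [2^n]. *)
  set (I := fun n (p : R * R) =>
     contour F (fst p) (fst p + A * (/ 2) ^ n) (snd p) (snd p + B * (/ 2) ^ n)).
  set (K := Cmod (contour F a b a' b')).
  destruct (Req_dec K 0) as [E|E]; [apply Cmod_eq_0; exact E|exfalso].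
  assert (HK : 0 < K) by (pose proof (Cmod_ge_0 (contour F a b a' b')); unfold K in *; lra).
  set (good := fun n (p : R * R) =>
     (a <= fst p /\ fst p + A * (/ 2) ^ n <= b) /\
     (a' <= snd p /\ snd p + B * (/ 2) ^ n <= b') /\
     K * (/ 4) ^ n <= Cmod (I n p)).
  set (step := fun n (p q : R * R) =>
     (fst p <= fst q /\ fst q + A * (/ 2) ^ S n <= fst p + A * (/ 2) ^ n) /\
     (snd p <= snd q /\ snd q + B * (/ 2) ^ S n <= snd p + B * (/ 2) ^ n)).
  assert (HA : 0 < A) by (unfold A; lra). assert (HB : 0 < B) by (unfold B; lra).
  destruct (dependent_choice (R * R) (a, a') good step) as [u [_ Hu]].
  - unfold good, I, A, B; simpl. rewrite !Rmult_1_r.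
    replace (a + (b - a)) with b by ring. replace (a' + (b' - a')) with b' by ring.
    fold K. repeat split; lra.
  - intros n [x y] (Hx & Hy & HI). simpl in Hx, Hy. unfold I in HI; simpl in HI.
    pose proof (half_pow_pos (S n)) as Hn. pose proof (half_pow_S n) as En.
    set (h := (/ 2) ^ S n) in *. rewrite En in Hx, Hy, HI.
    assert (HAh : 0 < A * h) by (apply Rmult_lt_0_compat; lra).
    assert (HBh : 0 < B * h) by (apply Rmult_lt_0_compat; lra).
    replace (A * (2 * h)) with (A * h + A * h) in Hx, HI by ring.
    replace (B * (2 * h)) with (B * h + B * h) in Hy, HI by ring.
    set (p := A * h) in *. set (q := B * h) in *.
    rewrite (contour_split_x x (x + (p + p)) y (y + (q + q)) ltac:(lra) ltac:(lra) (x + p)) in HI.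
    2: lra.
    2:{ intros z Hz; apply HF. apply on_boundary_in_rect in Hz; try lra.
        unfold in_rect in *; lra. }
    2:{ intros z Hz; apply HF. unfold in_rect; simpl; lra. }
    rewrite (contour_split_y x (x + p) y (y + (q + q)) ltac:(lra) ltac:(lra) (y + q)) in HI.
    2: lra.
    2:{ intros z Hz; apply HF. apply on_boundary_in_rect in Hz; try lra.
        unfold in_rect in *; lra. }
    2:{ intros z Hz; apply HF. unfold in_rect; simpl; lra. }
    rewrite (contour_split_y (x + p) (x + (p + p)) y (y + (q + q)) ltac:(lra) ltac:(lra) (y + q)) in HI.
    2: lra.
    2:{ intros z Hz; apply HF. apply on_boundary_in_rect in Hz; try lra.
        unfold in_rect in *; lra. }
    2:{ intros z Hz; apply HF. unfold in_rect; simpl; lra. }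
    replace (x + (p + p)) with (x + p + p) in HI by ring.
    replace (y + (q + q)) with (y + q + q) in HI by ring.
    pose proof (Cmod_triangle
      (contour F x (x + p) y (y + q) + contour F x (x + p) (y + q) (y + q + q))
      (contour F (x + p) (x + p + p) y (y + q) +
          contour F (x + p) (x + p + p) (y + q) (y + q + q))) as T0.
    pose proof (Cmod_triangle (contour F x (x + p) y (y + q))
       (contour F x (x + p) (y + q) (y + q + q))) as T1.
    pose proof (Cmod_triangle (contour F (x + p) (x + p + p) y (y + q))
       (contour F (x + p) (x + p + p) (y + q) (y + q + q))) as T2.
    assert (E4 : K * (/ 4) ^ n = 4 * (K * (/ 4) ^ S n)) by (simpl; field).
    rewrite E4 in HI. set (k := K * (/ 4) ^ S n) in *.
    assert (D : k <= Cmod (contour F x (x + p) y (y + q)) \/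
      k <= Cmod (contour F x (x + p) (y + q) (y + q + q)) \/
      k <= Cmod (contour F (x + p) (x + p + p) y (y + q)) \/
      k <= Cmod (contour F (x + p) (x + p + p) (y + q) (y + q + q))).
    { apply NNPP. intros N.
      apply not_or_and in N; destruct N as [N1 N].
      apply not_or_and in N; destruct N as [N2 N].
      apply not_or_and in N; destruct N as [N3 N4]. lra. }
    unfold good, step, I.
    destruct D as [D|[D|[D|D]]].
    + exists (x, y); simpl fst; simpl snd. fold h. rewrite En. fold p q k.
      repeat split; try exact D; unfold p, q in *; lra.
    + exists (x, y + q); simpl fst; simpl snd. fold h. rewrite En. fold p q k.
      repeat split; try exact D; unfold p, q in *; lra.
    + exists (x + p, y); simpl fst; simpl snd. fold h. rewrite En. fold p q k.
      repeat split; try exact D; unfold p, q in *; lra.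
    + exists (x + p, y + q); simpl fst; simpl snd. fold h. rewrite En. fold p q k.
      repeat split; try exact D; unfold p, q in *; lra.
  - destruct (nested_point (fun n => fst (u n)) A) as [x Hx]; [lra|intros n; apply (Hu n)|].
    destruct (nested_point (fun n => snd (u n)) B) as [y Hy]; [lra|intros n; apply (Hu n)|].
    assert (Hxy : in_rect a b a' b' (x, y)).
    { destruct (Hu O) as [(H1 & H2 & _) _]. specialize (Hx O). specialize (Hy O).
      unfold in_rect; simpl in *; lra. }
    destruct (HF _ Hxy) as [l Hl].
    set (S2 := (A + B) * (A + B)).
    assert (HS2 : 0 < S2) by (unfold S2; nra).
    (* With this tolerance [contour_bound] yields at most [4 * K / (8 * S2) * ((A + B) * h)^2 = K /
       2 * h^2], half of the lower bound [K * h^2] kept by the quartering. *)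
    destruct (proj1 (Cis_derive_eps F (x, y) l) Hl (K / (8 * S2))) as [d [Hd Hw]].
    { apply Rdiv_lt_0_compat; lra. }
    destruct (half_pow_small (d / (A + B))) as [n Hn].
    { apply Rdiv_lt_0_compat; lra. }
    assert (Hn' : (A + B) * (/ 2) ^ n < d).
    { apply (Rmult_lt_compat_l (A + B)) in Hn; [|lra].
      replace ((A + B) * (d / (A + B))) with d in Hn by (field; lra). exact Hn. }
    destruct (Hu n) as [(H1 & H2 & H3) _].
    specialize (Hx n). specialize (Hy n). simpl in Hx, Hy.
    pose proof (half_pow_pos n) as Hp.
    assert (HAp : 0 < A * (/ 2) ^ n) by (apply Rmult_lt_0_compat; lra).
    assert (HBp : 0 < B * (/ 2) ^ n) by (apply Rmult_lt_0_compat; lra).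
    set (X := fst (u n)) in *. set (Y := snd (u n)) in *.
    unfold I in H3. fold X Y in H3.
    set (h := (/ 2) ^ n) in *.
    set (L := fun z : C => (F (x, y) - l * (x, y) + l * z)%C).
    assert (HbF : forall z, on_boundary X (X + A * h) Y (Y + B * h) z -> Diff F z).
    { intros z Hz. apply HF. apply on_boundary_in_rect in Hz; try lra.
      unfold in_rect in *; lra. }
    assert (HbL : forall z, on_boundary X (X + A * h) Y (Y + B * h) z -> Diff L z).
    { intros z _. unfold L. diff_tac. }
    assert (E1 : contour F X (X + A * h) Y (Y + B * h) =
       contour (fun z => F z - L z)%C X (X + A * h) Y (Y + B * h)).
    { rewrite contour_minus; trivial; try lra.
      unfold L. rewrite contour_affine by lra. ring. }
    rewrite E1 in H3.
    assert (H4 : Cmod (contour (fun z => F z - L z)%C X (X + A * h) Y (Y + B * h)) <=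
       4 * (K / (8 * S2) * ((A + B) * h)) * ((X + A * h - X) + (Y + B * h - Y))).
    { apply contour_bound; try lra.
      - intros z Hz. apply Diff_minus; auto.
      - intros z Hz. apply on_boundary_in_rect in Hz; try lra.
        destruct Hz as [Z1 Z2].
        assert (Hzd : Cmod (z - (x, y)) <= (A + B) * h).
        { eapply Rle_trans; [apply Cmod_le_abs|]. simpl.
          assert (Rabs (fst z + - x) <= A * h) by (apply Rabs_le; lra).
          assert (Rabs (snd z + - y) <= B * h) by (apply Rabs_le; lra). lra. }
        replace (F z - L z)%C with (F z - F (x, y) - l * (z - (x, y)))%C by (unfold L; ring).
        eapply Rle_trans; [apply Hw; lra|].
        apply Rmult_le_compat_l; [|exact Hzd].
        left; apply Rdiv_lt_0_compat; lra. }
    assert (E4 : 4 * (K / (8 * S2) * ((A + B) * h)) * ((X + A * h - X) + (Y + B * h - Y))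
       = K / 2 * (h * h)) by (unfold S2; field; lra).
    assert (E5 : (/ 4) ^ n = h * h).
    { unfold h. rewrite <- Rpow_mult_distr. f_equal. field. }
    rewrite E4 in H4. rewrite E5 in H3.
    assert (0 < K * (h * h)) by (repeat apply Rmult_lt_0_compat; lra).
    lra.
Qed.

Lemma C_eq_sub (z w : C) : (z - w)%C = RtoC 0 -> z = w.
Proof. intros H. replace z with ((z - w) + w)%C by ring. rewrite H. ring. Qed.

Lemma C_sub_neq (z w : C) : z <> w -> (z - w)%C <> RtoC 0.
Proof. intros H E. apply H, C_eq_sub, E. Qed.

(** Two vertical and two horizontal cuts around [w] split off four rectangles that avoid [w], and
    [goursat] kills each of them. *)
Lemma contour_shrink F a b a' b' w h : 0 < h ->
  a < fst w - h -> fst w + h < b -> a' < snd w - h -> snd w + h < b' ->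
  (forall z, in_rect a b a' b' z -> z <> w -> Diff F z) ->
  contour F a b a' b' =
  contour F (fst w - h) (fst w + h) (snd w - h) (snd w + h).
Proof.
  destruct w as [x y]; simpl. intros Hh H1 H2 H3 H4 HF.
  assert (K : forall s t, a <= s <= b -> a' <= t <= b' -> (s <> x \/ t <> y) -> Diff F (s, t)).
  { intros s t Hs Ht D. apply HF; [unfold in_rect; simpl; lra|].
    intros E. injection E; intros; subst. destruct D; congruence. }
  assert (KB : forall z, on_boundary a b a' b' z -> Diff F z).
  { intros [s t] Hz. unfold on_boundary in Hz; simpl in Hz. apply K; lra. }
  rewrite (contour_split_x a b a' b' ltac:(lra) ltac:(lra) (x - h) F ltac:(lra) KB).
  2: intros t Ht; apply K; lra.
  rewrite goursat; try lra.
  2:{ intros [s t] Hz. unfold in_rect in Hz; simpl in Hz. apply K; lra. }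
  rewrite (contour_split_x (x - h) b a' b' ltac:(lra) ltac:(lra) (x + h) F ltac:(lra)).
  2:{ intros [s t] Hz. unfold on_boundary in Hz; simpl in Hz. apply K; lra. }
  2: intros t Ht; apply K; lra.
  rewrite (goursat F (x + h)); try lra.
  2:{ intros [s t] Hz. unfold in_rect in Hz; simpl in Hz. apply K; lra. }
  rewrite (contour_split_y (x - h) (x + h) a' b' ltac:(lra) ltac:(lra) (y - h) F ltac:(lra)).
  2:{ intros [s t] Hz. unfold on_boundary in Hz; simpl in Hz. apply K; lra. }
  2: intros t Ht; apply K; lra.
  rewrite (goursat F (x - h) (x + h) a'); try lra.
  2:{ intros [s t] Hz. unfold in_rect in Hz; simpl in Hz. apply K; lra. }
  rewrite (contour_split_y (x - h) (x + h) (y - h) b' ltac:(lra) ltac:(lra) (y + h) F ltac:(lra)).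
  2:{ intros [s t] Hz. unfold on_boundary in Hz; simpl in Hz. apply K; lra. }
  2: intros t Ht; apply K; lra.
  rewrite (goursat F (x - h) (x + h) (y + h)); try lra.
  2:{ intros [s t] Hz. unfold in_rect in Hz; simpl in Hz. apply K; lra. }
  ring.
Qed.

Definition inside (a b a' b' : R) (w : C) : Prop :=
  a < fst w < b /\ a' < snd w < b'.

Lemma boundary_neq_inside a b a' b' z w :
  on_boundary a b a' b' z -> inside a b a' b' w -> z <> w.
Proof. intros Hz Hw E; subst. unfold on_boundary, inside in *. lra. Qed.

(** Shrinking to a square of half-side [h] around [w] leaves a bounded integrand over a perimeter
    that tends to 0. *)
Lemma contour_removable F a b a' b' w M d : inside a b a' b' w ->
  (forall z, in_rect a b a' b' z -> z <> w -> Diff F z) ->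
  0 < d -> (forall z, z <> w -> Cmod (z - w) < d -> Cmod (F z) <= M) ->
  contour F a b a' b' = RtoC 0.
Proof.
  intros [Hx Hy] HF Hd HM. apply Cmod_eq_0.
  destruct (Req_dec (Cmod (contour F a b a' b')) 0) as [E|E]; [exact E|exfalso].
  pose proof (Cmod_ge_0 (contour F a b a' b')) as Hp.
  set (K := Cmod (contour F a b a' b')) in *.
  assert (HM0 : 0 <= M).
  { eapply Rle_trans; [apply Cmod_ge_0|]. apply (HM (w + RtoC (d / 2))%C).
    - intros E1. assert (E2 : RtoC (d / 2) = RtoC 0).
      { replace (RtoC (d / 2)) with (w + RtoC (d / 2) - w)%C by ring. rewrite E1; ring. }
      apply RtoC_inj in E2; lra.
    - replace (w + RtoC (d / 2) - w)%C with (RtoC (d / 2)) by ring.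
      rewrite Cmod_R, Rabs_pos_eq; lra. }
  (* The last entry is chosen against the bound [4 * M * 4 h = 16 M h] for the small square; the
     others keep that square inside the rectangle and within distance [d] of [w]. *)
  set (h := Rmin (Rmin (fst w - a) (b - fst w)) (Rmin (Rmin (snd w - a') (b' - snd w))
     (Rmin (d / 2) (K / (16 * (M + 1))))) / 2).
  assert (Hk : 0 < K / (16 * (M + 1))) by (apply Rdiv_lt_0_compat; lra).
  assert (Hh : 0 < h /\ a < fst w - h /\ fst w + h < b /\ a' < snd w - h /\
     snd w + h < b' /\ 2 * h < d /\ h < K / (16 * (M + 1))).
  { unfold h. set (t := K / (16 * (M + 1))) in *. clearbody t.
    unfold Rmin; repeat destruct Rle_dec; lra. }
  destruct Hh as (H0 & H1 & H2 & H3 & H4 & H5 & H6).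
  assert (B : K <= 4 * M * (fst w + h - (fst w - h) + (snd w + h - (snd w - h)))).
  { unfold K. rewrite (contour_shrink F a b a' b' w h) by assumption.
    assert (N : forall z, on_boundary (fst w - h) (fst w + h) (snd w - h) (snd w + h) z ->
      z <> w).
    { intros z Hz E1. subst z. unfold on_boundary in Hz. lra. }
    apply contour_bound; try lra.
    - intros z Hz. apply HF; [|apply N, Hz].
      unfold on_boundary in Hz. unfold in_rect; lra.
    - intros z Hz. apply HM; [apply N, Hz|].
      eapply Rle_lt_trans; [apply Cmod_le_abs|].
      assert (Rabs (fst z - fst w) <= h) by (apply Rabs_le; unfold on_boundary in Hz; lra).
      assert (Rabs (snd z - snd w) <= h) by (apply Rabs_le; unfold on_boundary in Hz; lra).
      simpl. unfold Rminus in *. lra. }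
  apply (Rmult_lt_compat_r (16 * (M + 1))) in H6; [|lra].
  replace (K / (16 * (M + 1)) * (16 * (M + 1))) with K in H6 by (field; lra).
  nra.
Qed.

(** For [w] inside the rectangle this is the constant [2 pi i]. The proof works instead with the
    lower bound [winding_lower] and with the Lipschitz estimate for Cauchy transforms. *)
Definition winding (a b a' b' : R) (w : C) : C := contour (fun z => / (z - w))%C a b a' b'.

Lemma Diff_shift_inv z w : z <> w -> Diff (fun z => / (z - w))%C z.
Proof.
  intros H. apply Diff_inv; [apply C_sub_neq, H|diff_tac].
Qed.

(** The quotient [(F z - F w) / (z - w)] stays bounded near [w], by [1 + |F'(w)|], so its contour
    integral vanishes by [contour_removable]. *)
Lemma cauchy_rect F a b a' b' w : inside a b a' b' w ->
  (forall z, in_rect a b a' b' z -> Diff F z) ->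
  contour (fun z => F z / (z - w))%C a b a' b' = (F w * winding a b a' b' w)%C.
Proof.
  intros Hw HF. unfold winding.
  assert (Hab : a <= b /\ a' <= b') by (unfold inside in Hw; lra).
  destruct Hab as [Hab Hab'].
  assert (D1 : forall z, on_boundary a b a' b' z -> Diff (fun z => / (z - w))%C z).
  { intros z Hz. apply Diff_shift_inv. exact (boundary_neq_inside _ _ _ _ _ _ Hz Hw). }
  rewrite <- contour_scal by assumption.
  apply C_eq_sub. rewrite <- contour_minus; trivial.
  - destruct (HF w) as [l Hl]; [unfold in_rect, inside in *; lra|].
    destruct (proj1 (Cis_derive_eps F w l) Hl 1 Rlt_0_1) as [d [Hd Hz]].
    apply (contour_removable _ a b a' b' w (1 + Cmod l) d Hw); trivial.
    + intros z Hzr Hzw.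
      pose proof (Diff_shift_inv z w Hzw) as Di.
      exact (Diff_minus _ _ _ (Diff_mult F _ _ (HF z Hzr) Di)
               (Diff_mult _ _ _ (Diff_const (F w) z) Di)).
    + intros z Hzw Hzd. pose proof (C_sub_neq _ _ Hzw) as Hn.
      replace (F z / (z - w) - F w * / (z - w))%C with
        ((F z - F w - l * (z - w)) / (z - w) + l)%C by (field; exact Hn).
      eapply Rle_trans; [apply Cmod_triangle|].
      apply Rplus_le_compat_r. rewrite Cmod_div by exact Hn.
      apply Cmod_gt_0 in Hn.
      apply Rle_div_l; [exact Hn|]. apply Hz, Hzd.
  - intros z Hz. apply Diff_mult; auto. apply HF, on_boundary_in_rect; trivial.
  - intros z Hz. apply Diff_mult; auto. apply Diff_const.
Qed.

Lemma boundary_bounded F a b a' b' : a <= b -> a' <= b' ->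
  (forall z, on_boundary a b a' b' z -> Diff F z) ->
  exists M, 0 < M /\ forall z, on_boundary a b a' b' z -> Cmod (F z) <= M.
Proof.
  intros Hab Hab' HF.
  assert (KH : forall y, (forall x, a <= x <= b -> Diff F (x, y)) ->
    exists M, forall x, a <= x <= b -> Cmod (F (x, y)) <= M).
  { intros y Hy.
    destruct (bounded_continuity (V:=R_NormedModule) (fun x => fst (F (x, y))) a b) as [M1 H1].
    { intros x Hx. apply (Diff_continuous_path F (fun x => (x, y))); [intros; apply Cmod_hor|auto]. }
    destruct (bounded_continuity (V:=R_NormedModule) (fun x => snd (F (x, y))) a b) as [M2 H2].
    { intros x Hx. apply (Diff_continuous_path F (fun x => (x, y))); [intros; apply Cmod_hor|auto]. }
    exists (M1 + M2). intros x Hx. eapply Rle_trans; [apply Cmod_le_abs|].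
    specialize (H1 x Hx). specialize (H2 x Hx).
    unfold norm in H1, H2; simpl in H1, H2. unfold abs in H1, H2; simpl in H1, H2. lra. }
  assert (KV : forall x, (forall y, a' <= y <= b' -> Diff F (x, y)) ->
    exists M, forall y, a' <= y <= b' -> Cmod (F (x, y)) <= M).
  { intros x Hx.
    destruct (bounded_continuity (V:=R_NormedModule) (fun y => fst (F (x, y))) a' b') as [M1 H1].
    { intros y Hy. apply (Diff_continuous_path F (fun y => (x, y))); [intros; apply Cmod_ver|auto]. }
    destruct (bounded_continuity (V:=R_NormedModule) (fun y => snd (F (x, y))) a' b') as [M2 H2].
    { intros y Hy. apply (Diff_continuous_path F (fun y => (x, y))); [intros; apply Cmod_ver|auto]. }
    exists (M1 + M2). intros y Hy. eapply Rle_trans; [apply Cmod_le_abs|].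
    specialize (H1 y Hy). specialize (H2 y Hy).
    unfold norm in H1, H2; simpl in H1, H2. unfold abs in H1, H2; simpl in H1, H2. lra. }
  destruct (KH a') as [M1 H1].
  { intros x Hx; apply HF; unfold on_boundary; simpl; auto. }
  destruct (KH b') as [M2 H2].
  { intros x Hx; apply HF; unfold on_boundary; simpl; auto. }
  destruct (KV a) as [M3 H3].
  { intros x Hx; apply HF; unfold on_boundary; simpl; auto. }
  destruct (KV b) as [M4 H4].
  { intros x Hx; apply HF; unfold on_boundary; simpl; auto. }
  exists (1 + Rabs M1 + Rabs M2 + Rabs M3 + Rabs M4).
  pose proof (Rabs_pos M1). pose proof (Rabs_pos M2).
  pose proof (Rabs_pos M3). pose proof (Rabs_pos M4).
  pose proof (Rle_abs M1). pose proof (Rle_abs M2).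
  pose proof (Rle_abs M3). pose proof (Rle_abs M4).
  split; [lra|].
  intros [x y] [[Hx [E|E]]|[Hy [E|E]]]; simpl in *; subst.
  - specialize (H1 x Hx). lra.
  - specialize (H2 x Hx). lra.
  - specialize (H3 y Hy). lra.
  - specialize (H4 y Hy). lra.
Qed.

(** In the imaginary part all four sides contribute nonnegatively. On the right side
    [Re (1 / (z - w)) = u / (u^2 + v^2)] with [r / 2 <= u <= 3 r / 2] and [|v| <= 3 r / 2], hence at
    least [1 / (9 r)]; its length is [2 r]. *)
Lemma winding_lower c r w : 0 < r -> Rabs (fst w - fst c) <= r / 2 ->
  Rabs (snd w - snd c) <= r / 2 ->
  2 / 9 <= Cmod (winding (fst c - r) (fst c + r) (snd c - r) (snd c + r) w).
Proof.
  destruct c as [p q], w as [x y]; simpl. intros Hr Hx Hy.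
  apply Rabs_le_between in Hx. apply Rabs_le_between in Hy.
  eapply Rle_trans; [|apply snd_le_Cmod]. eapply Rle_trans; [|apply Rle_abs].
  assert (D : forall z, on_boundary (p - r) (p + r) (q - r) (q + r) z ->
     Diff (fun z => / (z - (x, y)))%C z).
  { intros z Hz. apply Diff_shift_inv. intros E; subst z.
    unfold on_boundary in Hz; simpl in Hz. lra. }
  destruct (cex_sides (p - r) (p + r) (q - r) (q + r) ltac:(lra) ltac:(lra) _ D)
    as (F1 & F2 & F3 & F4).
  destruct (cex_minus _ _ _ _ F1 F2) as [_ G1].
  destruct (cex_minus _ _ _ _ F4 F3) as [G2 _].
  unfold winding, contour. unfold cint. simpl fst in *. simpl snd in *.
  set (I1 := RInt _ _ _) in |- *.
  match goal with |- context [0 * ?u] => set (I2 := u) end.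
  match goal with |- context [1 * ?u] => set (I3 := u) end.
  assert (H1 : 0 <= I1).
  { apply RInt_ge_0; [lra|exact G1|]. intros t Ht. simpl.
    set (u := t + - x). set (v := q - r + - y). set (v' := q + r + - y).
    assert (Hv : v < 0) by (unfold v; lra). assert (Hv' : 0 < v') by (unfold v'; lra).
    assert (0 < / (u * (u * 1) + v * (v * 1))) by (apply Rinv_0_lt_compat; nra).
    assert (0 < / (u * (u * 1) + v' * (v' * 1))) by (apply Rinv_0_lt_compat; nra).
    unfold Rdiv. nra. }
  assert (H3 : 2 / 9 <= I3).
  { replace (2 / 9) with (RInt (fun _ => / (9 * r)) (q - r) (q + r)).
    2:{ rewrite RInt_const. unfold scal; simpl. unfold mult; simpl. field. lra. }
    apply RInt_le; [lra|apply ex_RInt_const|exact G2|]. intros t Ht. simpl.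
    set (v := t + - y). set (u := p + r + - x). set (u' := p - r + - x).
    assert (Hu' : u' < 0) by (unfold u'; lra).
    assert (Hu : r / 2 <= u <= 3 / 2 * r) by (unfold u; lra).
    assert (Hv : - (3 / 2 * r) <= v <= 3 / 2 * r) by (unfold v; lra).
    assert (K1 : 0 < / (u' * (u' * 1) + v * (v * 1))) by (apply Rinv_0_lt_compat; nra).
    assert (K2 : / (9 * r) <= u / (u * (u * 1) + v * (v * 1))).
    { apply Rle_div_r; [nra|]. apply (Rmult_le_reg_l (9 * r)); [lra|].
      rewrite <- Rmult_assoc, Rinv_r by lra. nra. }
    unfold Rdiv in *. nra. }
  lra.
Qed.

(** * Identity theorem on discs *)

Section Square.
Variables (c : C) (r : R).
Hypothesis Hr : 0 < r.

Let a := fst c - r.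
Let b := fst c + r.
Let a' := snd c - r.
Let b' := snd c + r.

Definition near_center (w : C) : Prop :=
  Rabs (fst w - fst c) <= r / 2 /\ Rabs (snd w - snd c) <= r / 2.

Lemma near_center_inside w : near_center w -> inside a b a' b' w.
Proof.
  intros [H1 H2]. apply Rabs_le_between in H1. apply Rabs_le_between in H2.
  unfold inside, a, b, a', b'. lra.
Qed.

Lemma boundary_dist s z w : Rabs (fst w - fst c) <= s -> Rabs (snd w - snd c) <= s ->
  on_boundary a b a' b' z -> r - s <= Cmod (z - w).
Proof.
  intros H1 H2 Hz. apply Rabs_le_between in H1. apply Rabs_le_between in H2.
  destruct Hz as [[_ [E|E]]|[_ [E|E]]].
  - eapply Rle_trans; [|apply snd_le_Cmod]. simpl. rewrite E.
    unfold Rabs, a'; destruct Rcase_abs; lra.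
  - eapply Rle_trans; [|apply snd_le_Cmod]. simpl. rewrite E.
    unfold Rabs, b'; destruct Rcase_abs; lra.
  - eapply Rle_trans; [|apply fst_le_Cmod]. simpl. rewrite E.
    unfold Rabs, a; destruct Rcase_abs; lra.
  - eapply Rle_trans; [|apply fst_le_Cmod]. simpl. rewrite E.
    unfold Rabs, b; destruct Rcase_abs; lra.
Qed.

Lemma near_center_dist z w : near_center w -> on_boundary a b a' b' z -> r / 2 <= Cmod (z - w).
Proof.
  intros [H1 H2] Hz. replace (r / 2) with (r - r / 2) by lra.
  apply boundary_dist; assumption.
Qed.

Lemma square_sides : a <= b /\ a' <= b' /\ (b - a) + (b' - a') = 4 * r.
Proof. unfold a, b, a', b'. lra. Qed.

Lemma near_center_neq z w : near_center w -> on_boundary a b a' b' z -> (z - w)%C <> RtoC 0.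
Proof.
  intros Hw Hz. apply Cmod_gt_0. pose proof (near_center_dist z w Hw Hz). lra.
Qed.

Lemma cauchy_transform_Diff G w z : Diff G z -> near_center w -> on_boundary a b a' b' z ->
  Diff (fun z => G z / (z - w))%C z.
Proof.
  intros HG Hw Hz.
  exact (Diff_mult G _ z HG (Diff_inv _ z (near_center_neq z w Hw Hz)
    (Diff_minus _ _ z (Diff_id z) (Diff_const w z)))).
Qed.

Lemma cauchy_transform_bound G M w :
  (forall z, on_boundary a b a' b' z -> Diff G z) ->
  (forall z, on_boundary a b a' b' z -> Cmod (G z) <= M) -> near_center w ->
  Cmod (contour (fun z => G z / (z - w))%C a b a' b') <= 32 * M.
Proof.
  intros HG HM Hw. destruct square_sides as (S1 & S2 & S3).
  replace (32 * M) with (4 * (M * / (r / 2)) * ((b - a) + (b' - a')))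
    by (rewrite S3; field; lra).
  apply contour_bound; trivial.
  - intros z Hz. apply cauchy_transform_Diff; auto.
  - intros z Hz. rewrite Cmod_div by (apply near_center_neq; assumption).
    apply Rmult_le_compat; auto; [apply Cmod_ge_0| |].
    + left. apply Rinv_0_lt_compat, Cmod_gt_0, near_center_neq; assumption.
    + apply Rinv_le_contravar; [lra|]. apply near_center_dist; assumption.
Qed.

(** Partial fractions for [1 / (z - v) - 1 / (z - w)]. It serves twice: for Lipschitz bounds, and in
    [cauchy_nodes] to gain a linear factor at a zero. *)
Lemma cauchy_transform_sub G v w :
  (forall z, on_boundary a b a' b' z -> Diff G z) -> near_center v -> near_center w ->
  (contour (fun z => G z / (z - v))%C a b a' b' - contour (fun z => G z / (z - w))%C a b a' b'
  = (v - w) * contour (fun z => G z / (z - w) / (z - v))%C a b a' b')%C.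
Proof.
  intros HG Hv Hw. destruct square_sides as (S1 & S2 & S3).
  rewrite <- contour_minus; trivial; try (intros; apply cauchy_transform_Diff; auto).
  rewrite <- contour_scal; trivial.
  - apply contour_ext; trivial. intros z Hz. field.
    split; apply near_center_neq; assumption.
  - intros z Hz. apply (cauchy_transform_Diff (fun z => G z / (z - w))%C); trivial.
    apply cauchy_transform_Diff; auto.
Qed.

Lemma cauchy_transform_lipschitz G M v w :
  (forall z, on_boundary a b a' b' z -> Diff G z) ->
  (forall z, on_boundary a b a' b' z -> Cmod (G z) <= M) -> near_center v -> near_center w ->
  Cmod (contour (fun z => G z / (z - v))%C a b a' b' -
        contour (fun z => G z / (z - w))%C a b a' b') <= 64 * M / r * Cmod (v - w).
Proof.
  intros HG HM Hv Hw. rewrite cauchy_transform_sub, Cmod_mult, Rmult_comm by assumption.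
  apply Rmult_le_compat_r; [apply Cmod_ge_0|].
  replace (64 * M / r) with (32 * (M * / (r / 2))) by (field; lra).
  apply (cauchy_transform_bound (fun z => G z / (z - w))%C); trivial.
  - intros; apply cauchy_transform_Diff; auto.
  - intros z Hz. rewrite Cmod_div by (apply near_center_neq; assumption).
    apply Rmult_le_compat; auto; [apply Cmod_ge_0| |].
    + left. apply Rinv_0_lt_compat, Cmod_gt_0, near_center_neq; assumption.
    + apply Rinv_le_contravar; [lra|]. apply near_center_dist; assumption.
Qed.

Lemma winding_eq w : winding a b a' b' w = contour (fun z => RtoC 1 / (z - w))%C a b a' b'.
Proof.
  destruct square_sides as (S1 & S2 & S3).
  unfold winding. apply contour_ext; trivial. intros. unfold Cdiv. ring.
Qed.

Variable F : C -> C.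
Hypothesis HF : forall z, in_rect a b a' b' z -> Diff F z.

(** Near the centre [F] is the Cauchy transform of its boundary values divided by [winding]; both
    are Lipschitz, and the divisor is bounded away from 0. *)
Lemma square_lipschitz : exists L, forall v w, near_center v -> near_center w ->
  Cmod (F v - F w) <= L * Cmod (v - w).
Proof.
  destruct square_sides as (S1 & S2 & S3).
  assert (HB : forall z, on_boundary a b a' b' z -> Diff F z)
    by (intros; apply HF, on_boundary_in_rect; trivial).
  destruct (boundary_bounded F a b a' b') as [M [HM0 HM]]; trivial.
  (* Here [9 / 2] inverts the lower bound for the winding integral, [64 * M / r] and [64 * 1 / r]
     are the Lipschitz constants of the transforms of [F] and of 1, and [144 * M = 9 / 2 * (32 * M)]
     bounds [F] near the centre. *)
  exists (9 / 2 * (64 * M / r + 144 * M * (64 * 1 / r))). intros v w Hv Hw.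
  pose proof (cauchy_rect F a b a' b' v (near_center_inside v Hv) HF) as Ev.
  pose proof (cauchy_rect F a b a' b' w (near_center_inside w Hw) HF) as Ew.
  pose proof (winding_lower c r v Hr (proj1 Hv) (proj2 Hv)) as Jv.
  pose proof (winding_lower c r w Hr (proj1 Hw) (proj2 Hw)) as Jw.
  fold a b a' b' in Jv, Jw.
  pose proof (cauchy_transform_lipschitz F M v w HB HM Hv Hw) as LF.
  assert (LJ : Cmod (winding a b a' b' v - winding a b a' b' w) <= 64 * 1 / r * Cmod (v - w)).
  { rewrite !winding_eq.
    apply (cauchy_transform_lipschitz (fun _ => RtoC 1)); trivial; intros.
    - apply Diff_const.
    - rewrite Cmod_1; lra. }
  pose proof (cauchy_transform_bound F M w HB HM Hw) as Bw.
  rewrite Ew, Cmod_mult in Bw. rewrite Ev, Ew in LF.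
  set (J := winding a b a' b' v) in *. set (J' := winding a b a' b' w) in *.
  assert (E : ((F v - F w) * J = (F v * J - F w * J') - F w * (J - J'))%C) by ring.
  pose proof (Cmod_triangle_sub (F v * J - F w * J') (F w * (J - J'))) as T.
  rewrite <- E, !Cmod_mult in T.
  pose proof (Cmod_ge_0 (F v - F w)). pose proof (Cmod_ge_0 (F w)).
  assert (Bw' : Cmod (F w) <= 144 * M) by nra.
  assert (Cmod (F w) * Cmod (J - J') <= 144 * M * (64 * 1 / r * Cmod (v - w))).
  { apply Rmult_le_compat; trivial. apply Cmod_ge_0. }
  assert (2 / 9 * Cmod (F v - F w) <= Cmod (F v - F w) * Cmod J) by nra.
  lra.
Qed.

Variable x : nat -> C.
Hypothesis Hx : forall n, Rabs (fst (x n) - fst c) <= r / 8 /\ snd (x n) = snd c.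
Hypothesis Hinj : forall n m, x n = x m -> n = m.
Hypothesis Hzero : forall n, F (x n) = RtoC 0.

Fixpoint node_prod (n : nat) (z : C) : C :=
  match n with O => RtoC 1 | S k => (node_prod k z * (z - x k))%C end.

Lemma node_near n : near_center (x n).
Proof.
  destruct (Hx n) as [H1 H2]. unfold near_center. rewrite H2, Rminus_diag, Rabs_R0. lra.
Qed.

Lemma node_prod_neq n z : (forall k, (k < n)%nat -> z <> x k) -> node_prod n z <> RtoC 0.
Proof.
  induction n as [|n IH]; simpl; intros H.
  - intros E. apply RtoC_inj in E. lra.
  - apply Cmult_neq_0; [apply IH; intros; apply H; lia|apply C_sub_neq, H; lia].
Qed.

Lemma node_prod_Diff n z : Diff (node_prod n) z.
Proof.
  induction n as [|n IH]; [exact (Diff_const (RtoC 1) z)|].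
  exact (Diff_mult _ _ z IH (Diff_minus _ _ z (Diff_id z) (Diff_const (x n) z))).
Qed.

(** The nodes lie within [r / 8] of the centre, so the boundary is at distance at least [7 r / 8]
    from each. With the upper bound [r / 4 + r / 8 = 3 r / 8] of [node_prod_upper] this gives the
    ratio [3 / 7]. *)
Lemma node_prod_boundary n z : on_boundary a b a' b' z ->
  (7 / 8 * r) ^ n <= Cmod (node_prod n z).
Proof.
  intros Hz. induction n as [|n IH]; simpl; [rewrite Cmod_1; lra|].
  rewrite Cmod_mult, Rmult_comm. apply Rmult_le_compat; trivial; try lra.
  - apply pow_le; lra.
  - destruct (Hx n) as [H1 H2]. replace (7 / 8 * r) with (r - r / 8) by lra.
    apply boundary_dist; trivial. rewrite H2, Rminus_diag, Rabs_R0; lra.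
Qed.

Lemma node_prod_upper n w : Cmod (w - c) <= r / 4 -> Cmod (node_prod n w) <= (3 / 8 * r) ^ n.
Proof.
  intros Hw. induction n as [|n IH]; simpl; [rewrite Cmod_1; lra|].
  rewrite Cmod_mult, (Rmult_comm (3 / 8 * r)).
  apply Rmult_le_compat; trivial; try apply Cmod_ge_0.
  replace (w - x n)%C with ((w - c) - (x n - c))%C by ring.
  eapply Rle_trans; [apply Cmod_triangle_sub|].
  assert (Cmod (x n - c) <= r / 8).
  { eapply Rle_trans; [apply Cmod_le_abs|]. destruct (Hx n) as [H1 H2].
    simpl. rewrite H2. replace (snd c + - snd c) with 0 by ring.
    rewrite Rabs_R0. unfold Rminus in H1. lra. }
  lra.
Qed.

Lemma quotient_Diff n z : on_boundary a b a' b' z -> Diff (fun z => F z / node_prod n z)%C z.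
Proof.
  intros Hz. destruct square_sides as (S1 & S2 & S3).
  refine (Diff_mult _ _ z (HF z _) (Diff_inv _ z _ (node_prod_Diff n z))).
  - apply on_boundary_in_rect; trivial.
  - apply Cmod_gt_0. eapply Rlt_le_trans; [|apply node_prod_boundary, Hz].
    apply pow_lt; lra.
Qed.

(* Cauchy's formula after dividing out the zeros [x 0], ..., [x (n-1)]; at each step the integral vanishes at the next node, so that subtracting its value there produces the next linear factor. *)
Lemma cauchy_nodes n : forall w, near_center w ->
  (node_prod n w * contour (fun z => F z / node_prod n z / (z - w))%C a b a' b'
   = F w * winding a b a' b' w)%C.
Proof.
  destruct square_sides as (S1 & S2 & S3).
  induction n as [|n IH]; intros w Hw; simpl.
  - rewrite <- cauchy_rect; trivial; [|apply near_center_inside, Hw].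
    rewrite Cmult_1_l. apply contour_ext; trivial. intros z Hz. unfold Cdiv.
    f_equal. rewrite <- (Cmult_1_r (F z)) at 2. f_equal.
    field.
  - assert (Z : contour (fun z => F z / node_prod n z / (z - x n))%C a b a' b' = RtoC 0).
    { pose proof (IH (x n) (node_near n)) as E. rewrite Hzero, Cmult_0_l in E.
      apply NNPP. intros N. apply (Cmult_neq_0 (node_prod n (x n))) in N; [exact (N E)|].
      apply node_prod_neq. intros k Hk Ek. apply Hinj in Ek. lia. }
    rewrite <- IH by exact Hw.
    pose proof (cauchy_transform_sub (fun z => F z / node_prod n z)%C w (x n)
      (quotient_Diff n) Hw (node_near n)) as E. cbv beta in E.
    rewrite Z in E.
    rewrite <- Cmult_assoc. f_equal.
    transitivity (contour (fun z => F z / node_prod n z / (z - w))%C a b a' b' - RtoC 0)%C;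
      [rewrite E|ring].
    f_equal. apply contour_ext; trivial. intros z Hz.
    assert (node_prod n z <> RtoC 0).
    { apply Cmod_gt_0. eapply Rlt_le_trans; [|apply node_prod_boundary, Hz].
      apply pow_lt; lra. }
    field. repeat split; trivial; apply near_center_neq; trivial. apply node_near.
Qed.

Lemma vanish_near_center w : Cmod (w - c) <= r / 4 -> F w = RtoC 0.
Proof.
  intros Hwc. destruct square_sides as (S1 & S2 & S3).
  assert (Hw : near_center w).
  { pose proof (fst_le_Cmod (w - c)%C) as H1. pose proof (snd_le_Cmod (w - c)%C) as H2.
    simpl in H1, H2. unfold near_center, Rminus. lra. }
  assert (HB : forall z, on_boundary a b a' b' z -> Diff F z)
    by (intros; apply HF, on_boundary_in_rect; trivial).
  destruct (boundary_bounded F a b a' b') as [M [HM0 HM]]; trivial.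
  pose proof (winding_lower c r w Hr (proj1 Hw) (proj2 Hw)) as Jw. fold a b a' b' in Jw.
  (* [cauchy_nodes] bounds [F w] times the winding integral by [(3 r / 8)^n] times a Cauchy
     transform of size at most [32 * M / (7 r / 8)^n]; the two powers of [r] cancel. *)
  assert (B : forall n, Cmod (F w) * (2 / 9) <= 32 * M * (3 / 7) ^ n).
  { intros n. assert (P7 : 0 < (7 / 8 * r) ^ n) by (apply pow_lt; lra).
    assert (T : Cmod (contour (fun z => F z / node_prod n z / (z - w))%C a b a' b')
       <= 32 * (M * / (7 / 8 * r) ^ n)).
    { apply cauchy_transform_bound; trivial; [apply quotient_Diff|].
      intros z Hz. pose proof (node_prod_boundary n z Hz) as Q.
      rewrite Cmod_div by (apply Cmod_gt_0; lra).
      apply Rmult_le_compat; auto; try apply Cmod_ge_0.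
      - left; apply Rinv_0_lt_compat; lra.
      - apply Rinv_le_contravar; lra. }
    pose proof (node_prod_upper n w Hwc) as U.
    pose proof (f_equal Cmod (cauchy_nodes n w Hw)) as E. rewrite !Cmod_mult in E.
    assert (H1 : Cmod (F w) * (2 / 9) <= Cmod (F w) * Cmod (winding a b a' b' w))
      by (apply Rmult_le_compat_l; [apply Cmod_ge_0|exact Jw]).
    rewrite <- E in H1. eapply Rle_trans; [exact H1|].
    eapply Rle_trans; [apply Rmult_le_compat; [apply Cmod_ge_0|apply Cmod_ge_0|exact U|exact T]|].
    replace (3 / 7) with ((3 / 8 * r) * / (7 / 8 * r)) by (field; lra).
    rewrite (Rpow_mult_distr (3 / 8 * r)), pow_inv. lra. }
  apply Cmod_eq_0. destruct (Req_dec (Cmod (F w)) 0) as [E|E]; [exact E|exfalso].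
  pose proof (Cmod_ge_0 (F w)).
  destruct (pow_lt_1_zero (3 / 7)) with (y := Cmod (F w) * (2 / 9) / (32 * M)) as [N HN].
  - rewrite Rabs_pos_eq; lra.
  - apply Rdiv_lt_0_compat; lra.
  - specialize (HN N (le_n N)). specialize (B N).
    rewrite Rabs_pos_eq in HN by (apply pow_le; lra).
    apply (Rmult_lt_compat_l (32 * M)) in HN; [|lra].
    replace (32 * M * (Cmod (F w) * (2 / 9) / (32 * M))) with (Cmod (F w) * (2 / 9)) in HN
      by (field; lra). lra.
Qed.
End Square.

Lemma in_square_disc c r R0 z : 2 * r < R0 ->
  in_rect (fst c - r) (fst c + r) (snd c - r) (snd c + r) z -> Cmod (z - c) < R0.
Proof.
  intros H [H1 H2]. eapply Rle_lt_trans; [apply Cmod_le_abs|]. simpl.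
  assert (Rabs (fst z + - fst c) <= r) by (apply Rabs_le; lra).
  assert (Rabs (snd z + - snd c) <= r) by (apply Rabs_le; lra). lra.
Qed.

(** Nothing is asked at [z] itself, which may be a pole. One horizontal direction suffices to supply
    infinitely many zeros, and it is the one in which solutions are compared. *)
Definition right_zero (h : C -> C) (z : C) : Prop :=
  exists d, 0 < d /\ forall x, 0 < x < d -> h (z + RtoC x)%C = RtoC 0.

Lemma identity_disc F c R0 : 0 < R0 -> (forall z, Cmod (z - c) < R0 -> Diff F z) ->
  right_zero F c -> forall w, Cmod (w - c) <= R0 / 16 -> F w = RtoC 0.
Proof.
  intros HR HF [d [Hd Hz]] w Hw.
  set (r := R0 / 4).
  set (h := Rmin (d / 2) (r / 8)).
  assert (Hh : 0 < h /\ h < d /\ h <= r / 8).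
  { unfold h, r, Rmin. destruct Rle_dec; lra. }
  assert (HN : forall n, 0 < h / (INR n + 1) <= h).
  { intros n. pose proof (pos_INR n). split.
    - apply Rdiv_lt_0_compat; lra.
    - apply Rle_div_l; [lra|]. nra. }
  (* The nodes [c + h / (n + 1)] are distinct zeros on the horizontal segment, all within [r / 8] of
     [c]. *)
  apply (vanish_near_center c r ltac:(unfold r; lra) F) with
    (x := fun n => (c + RtoC (h / (INR n + 1)))%C).
  - intros z Hzr. apply HF. apply (in_square_disc c r); trivial. unfold r; lra.
  - intros n. specialize (HN n). simpl. split; [|ring].
    replace (fst c + h / (INR n + 1) - fst c) with (h / (INR n + 1)) by ring.
    rewrite Rabs_pos_eq; lra.
  - intros n m E. apply (f_equal fst) in E. simpl in E.
    assert (E1 : h / (INR n + 1) = h / (INR m + 1)) by lra.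
    pose proof (pos_INR n). pose proof (pos_INR m).
    apply INR_eq. apply (f_equal (fun t => h / t)) in E1.
    replace (h / (h / (INR n + 1))) with (INR n + 1) in E1 by (field; lra).
    replace (h / (h / (INR m + 1))) with (INR m + 1) in E1 by (field; lra). lra.
  - intros n. apply Hz. specialize (HN n). lra.
  - unfold r. lra.
Qed.

Lemma locally_lipschitz F c R0 : 0 < R0 -> (forall z, Cmod (z - c) < R0 -> Diff F z) ->
  exists L, 0 < L /\ forall v w, Cmod (v - c) <= R0 / 8 -> Cmod (w - c) <= R0 / 8 ->
    Cmod (F v - F w) <= L * Cmod (v - w).
Proof.
  intros HR HF.
  assert (K : forall w, Cmod (w - c) <= R0 / 8 -> near_center c (R0 / 4) w).
  { intros w Hw. pose proof (fst_le_Cmod (w - c)%C) as H1. pose proof (snd_le_Cmod (w - c)%C) as H2.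
    simpl in H1, H2. unfold near_center, Rminus. lra. }
  destruct (square_lipschitz c (R0 / 4) ltac:(lra) F) as [L HL].
  - intros z Hzr. apply HF. apply (in_square_disc c (R0 / 4)); trivial. lra.
  - exists (Rabs L + 1). pose proof (Rabs_pos L). split; [lra|]. intros v w Hv Hw.
    eapply Rle_trans; [apply HL; apply K; assumption|].
    apply Rmult_le_compat_r; [apply Cmod_ge_0|]. pose proof (Rle_abs L). lra.
Qed.

(** A local Lipschitz constant bounds every difference quotient, hence the derivative. At a pole
    this makes [(w - s) * g'(w)] tend to 0. *)
Lemma derivative_bounded F c R0 : 0 < R0 -> (forall z, Cmod (z - c) < R0 -> Diff F z) ->
  exists L, 0 < L /\ forall w l, Cmod (w - c) < R0 / 8 -> Cis_derive F w l -> Cmod l <= L.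
Proof.
  intros HR HF. destruct (locally_lipschitz F c R0 HR HF) as [L [HL0 HL]].
  exists (L + 1). split; [lra|]. intros w l Hw Hl.
  destruct (proj1 (Cis_derive_eps F w l) Hl 1 Rlt_0_1) as [d [Hd Hz]].
  set (h := Rmin (d / 2) ((R0 / 8 - Cmod (w - c)) / 2)).
  assert (Hh : 0 < h /\ h < d /\ h <= R0 / 8 - Cmod (w - c)).
  { unfold h, Rmin. destruct Rle_dec; lra. }
  assert (E : Cmod (w + RtoC h - w) = h).
  { replace (w + RtoC h - w)%C with (RtoC h) by ring. rewrite Cmod_R, Rabs_pos_eq; lra. }
  specialize (Hz (w + RtoC h)%C). rewrite E in Hz. specialize (Hz ltac:(lra)).
  assert (HL' : Cmod (F (w + RtoC h)%C - F w) <= L * h).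
  { rewrite <- E at 2. apply HL; [|lra].
    replace (w + RtoC h - c)%C with ((w - c) + RtoC h)%C by ring.
    eapply Rle_trans; [apply Cmod_triangle|]. rewrite Cmod_R, Rabs_pos_eq; lra. }
  replace (w + RtoC h - w)%C with (RtoC h) in Hz by ring.
  pose proof (Cmod_triangle_sub (F (w + RtoC h)%C - F w) (F (w + RtoC h)%C - F w - l * RtoC h)) as T.
  replace (F (w + RtoC h) - F w - (F (w + RtoC h) - F w - l * RtoC h))%C with (l * RtoC h)%C in T by ring.
  rewrite Cmod_mult, Cmod_R, (Rabs_pos_eq h) in T by lra.
  apply (Rmult_le_reg_r h); lra.
Qed.

(** * Meromorphic functions *)

(** Weaker than [pole_of_order]: [g] may vanish at [z] and [n] may be 0. In this form sums and
    products need no cancellation of common zeros. *)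
Definition polar_at (f : C -> C) (z : C) : Prop :=
  exists r (g : C -> C) n, 0 < r /\ (forall w, Cmod (w - z) < r -> Diff g w) /\
    forall w, 0 < Cmod (w - z) < r -> (f w * Complex.Cpow (w - z) n)%C = g w.

Lemma Cmod_sub_pos w z : 0 < Cmod (w - z) -> (w - z)%C <> RtoC 0.
Proof. apply Cmod_gt_0. Qed.

Lemma Cmod_self (z : C) : Cmod (z - z) = 0.
Proof. replace (z - z)%C with (RtoC 0) by ring. apply Cmod_0. Qed.

Lemma meromorphic_polar f z : meromorphic f -> polar_at f z.
Proof.
  intros H. destruct (H z) as [[r [Hr Hw]]|[n [_ (r & g & Hr & Hg & _ & E)]]].
  - exists r, f, O. split; [exact Hr|split; [exact Hw|]]. intros; simpl; ring.
  - exists r, g, n. split; [exact Hr|split; [exact Hg|]]. intros w Hw.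
    rewrite E, Cpow_eq by exact Hw. field.
    apply Cpow_nz, Cmod_sub_pos, Hw.
Qed.

Lemma polar_const c z : polar_at (fun _ => c) z.
Proof.
  exists 1, (fun _ => c), O. split; [lra|split].
  - intros; apply Diff_const.
  - intros; simpl; ring.
Qed.

Lemma polar_common f g z : polar_at f z -> polar_at g z ->
  exists r u v n m, 0 < r /\
    (forall w, Cmod (w - z) < r -> Diff u w) /\ (forall w, Cmod (w - z) < r -> Diff v w) /\
    forall w, 0 < Cmod (w - z) < r -> (f w * Complex.Cpow (w - z) n)%C = u w /\
      (g w * Complex.Cpow (w - z) m)%C = v w.
Proof.
  intros (r & u & n & Hr & Hu & Eu) (s & v & m & Hs & Hv & Ev).
  exists (Rmin r s), u, v, n, m.
  pose proof (Rmin_l r s). pose proof (Rmin_r r s).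
  split; [apply Rmin_glb_lt; assumption|].
  split; [|split]; intros w Hw.
  - apply Hu; lra.
  - apply Hv; lra.
  - split; [apply Eu|apply Ev]; lra.
Qed.

Lemma polar_mult f g z : polar_at f z -> polar_at g z -> polar_at (fun w => f w * g w)%C z.
Proof.
  intros Hf Hg. destruct (polar_common f g z Hf Hg) as (r & u & v & n & m & Hr & Hu & Hv & E).
  exists r, (fun w => u w * v w)%C, (n + m)%nat. split; [exact Hr|split].
  - intros w Hw. apply Diff_mult; auto.
  - intros w Hw. destruct (E w Hw) as [<- <-]. rewrite Cpow_add_r. ring.
Qed.

Lemma polar_plus f g z : polar_at f z -> polar_at g z -> polar_at (fun w => f w + g w)%C z.
Proof.
  intros Hf Hg. destruct (polar_common f g z Hf Hg) as (r & u & v & n & m & Hr & Hu & Hv & E).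
  exists r, (fun w => u w * Complex.Cpow (w - z) m + v w * Complex.Cpow (w - z) n)%C, (n + m)%nat.
  split; [exact Hr|split].
  - intros w Hw. pose proof (Hu w Hw). pose proof (Hv w Hw). diff_tac.
  - intros w Hw. destruct (E w Hw) as [<- <-]. rewrite Cpow_add_r. ring.
Qed.

Lemma polar_minus f g z : polar_at f z -> polar_at g z -> polar_at (fun w => f w - g w)%C z.
Proof.
  intros Hf Hg.
  destruct (polar_plus f (fun w => RtoC (-1) * g w)%C z Hf (polar_mult _ _ z (polar_const _ z) Hg))
    as (r & u & n & Hr & Hu & E).
  exists r, u, n. split; [exact Hr|split; [exact Hu|]]. intros w Hw. rewrite <- E by exact Hw.
  change (RtoC (-1)) with (RtoC (- (1))). rewrite RtoC_opp. ring.
Qed.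

(** The condition on [k] makes the substitution an isometry, so radii are unchanged. It is applied
    to the reflection in 0, to translations by a pole and to the rotation by [i]. *)
Lemma polar_affine f k c z : Cmod k = 1 -> polar_at f (k * z + c)%C ->
  polar_at (fun w => f (k * w + c)%C) z.
Proof.
  intros Hk (r & g & n & Hr & Hg & E).
  assert (Hk0 : k <> RtoC 0) by (apply Cmod_gt_0; lra).
  assert (Ek : forall w, (k * w + c - (k * z + c) = k * (w - z))%C) by (intros; ring).
  assert (En : forall w, Cmod (k * w + c - (k * z + c)) = Cmod (w - z)).
  { intros w. rewrite Ek, Cmod_mult, Hk. ring. }
  exists r, (fun w => g (k * w + c) / Complex.Cpow k n)%C, n. split; [exact Hr|split].
  - intros w Hw. rewrite <- En in Hw. pose proof (Hg _ Hw) as D.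
    apply (Diff_div (fun w => g (k * w + c)%C) (fun _ => Complex.Cpow k n)).
    + apply Cpow_nz, Hk0.
    + apply (Diff_comp g (fun w => (k * w + c)%C)); [exact D|diff_tac].
    + apply Diff_const.
  - intros w Hw. rewrite <- En in Hw. rewrite <- E by exact Hw.
    rewrite Ek, Cpow_mult_l. field. apply Cpow_nz, Hk0.
Qed.

Lemma polar_conj f z : polar_at f (Cconj z) -> polar_at (fun w => Cconj (f (Cconj w))) z.
Proof.
  intros (r & g & n & Hr & Hg & E).
  assert (En : forall w, Cmod (Cconj w - Cconj z) = Cmod (w - z)).
  { intros w. rewrite <- Cminus_conj. apply Cmod_conj. }
  exists r, (fun w => Cconj (g (Cconj w))), n. split; [exact Hr|split].
  - intros w Hw. rewrite <- En in Hw. destruct (Hg _ Hw) as [l Hl].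
    exists (Cconj l). apply Cis_derive_conj, Hl.
  - intros w Hw. rewrite <- En in Hw. rewrite <- E by exact Hw.
    rewrite Cmult_conj, Cpow_conj, Cminus_conj, !Cconj_conj. reflexivity.
Qed.

(** * Identity theorem for meromorphic functions *)

Definition punctured_zero (h : C -> C) (z : C) : Prop :=
  exists r, 0 < r /\ forall w, 0 < Cmod (w - z) < r -> h w = RtoC 0.

Lemma shift_avoids (a z : C) : exists d, 0 < d /\ forall x, 0 < x < d -> (a + RtoC x)%C <> z.
Proof.
  destruct (Req_dec (Cmod (z - a)) 0) as [E|E].
  - exists 1. split; [lra|]. intros x Hx Ez.
    rewrite <- Ez in E. replace (a + RtoC x - a)%C with (RtoC x) in E by ring.
    rewrite Cmod_R, Rabs_pos_eq in E; lra.
  - exists (Cmod (z - a)). pose proof (Cmod_ge_0 (z - a)). split; [lra|]. intros x Hx Ez.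
    rewrite <- Ez in Hx. replace (a + RtoC x - a)%C with (RtoC x) in Hx by ring.
    rewrite Cmod_R, Rabs_pos_eq in Hx; lra.
Qed.

(** The radius depends on [z] alone and serves every [a] in the disc. This uniformity is what lets
    the continuation along a segment pass its supremum, even when that point is a pole. *)
Lemma polar_right_zero h z : polar_at h z -> exists R0, 0 < R0 /\
  forall a, Cmod (a - z) < R0 -> right_zero h a ->
  forall w, 0 < Cmod (w - z) < R0 -> h w = RtoC 0.
Proof.
  intros (r & g & n & Hr & Hg & E).
  (* [identity_disc] at [a] with radius [r / 2] reaches distance [r / 32 = 2 * (r / 64)], which
     covers every [w] of the disc about [z]. *)
  exists (r / 64). split; [lra|]. intros a Ha [d [Hd Hz]] w Hw.
  destruct (shift_avoids a z) as [d' [Hd' Hn]].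
  assert (G : g w = RtoC 0).
  { apply (identity_disc g a (r / 2)); [lra| | |].
    - intros u Hu. apply Hg. replace (u - z)%C with ((u - a) + (a - z))%C by ring.
      eapply Rle_lt_trans; [apply Cmod_triangle|]. lra.
    - exists (Rmin (Rmin d d') (r / 2)). split; [repeat apply Rmin_glb_lt; lra|].
      intros x Hx.
      assert (Hx1 : x < d /\ x < d' /\ x < r / 2).
      { unfold Rmin in Hx. repeat destruct Rle_dec; lra. }
      rewrite <- E; [rewrite Hz by lra; ring|]. split.
      + apply Cmod_gt_0, C_sub_neq, Hn. lra.
      + replace (a + RtoC x - z)%C with ((a - z) + RtoC x)%C by ring.
        eapply Rle_lt_trans; [apply Cmod_triangle|]. rewrite Cmod_R, Rabs_pos_eq; lra.
    - replace (w - a)%C with ((w - z) - (a - z))%C by ring.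
      eapply Rle_trans; [apply Cmod_triangle_sub|]. lra. }
  rewrite <- E in G by lra.
  apply NNPP. intros N.
  apply (Cmult_neq_0 _ (Complex.Cpow (w - z) n)) in N; [exact (N G)|].
  apply Cpow_nz, Cmod_sub_pos, Hw.
Qed.

Lemma punctured_right_zero h z R0 a : (forall w, 0 < Cmod (w - z) < R0 -> h w = RtoC 0) ->
  Cmod (a - z) < R0 -> right_zero h a.
Proof.
  intros H Ha. destruct (shift_avoids a z) as [d [Hd Hn]].
  exists (Rmin d (R0 - Cmod (a - z))). split; [apply Rmin_glb_lt; lra|].
  intros x Hx. assert (Hx1 : x < d /\ x < R0 - Cmod (a - z)).
  { unfold Rmin in Hx. destruct Rle_dec; lra. }
  apply H. split.
  - apply Cmod_gt_0, C_sub_neq, Hn. lra.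
  - replace (a + RtoC x - z)%C with ((a - z) + RtoC x)%C by ring.
    eapply Rle_lt_trans; [apply Cmod_triangle|]. rewrite Cmod_R, Rabs_pos_eq; lra.
Qed.

(** Connectedness of the segment from [z0] to [z1]: the parameters up to which the property holds
    have a supremum, and the property extends past it unless it is 1. *)
Lemma right_zero_spreads h z0 z1 : (forall z, polar_at h z) -> right_zero h z0 -> right_zero h z1.
Proof.
  intros Hp H0.
  set (p := fun t : R => (z0 + RtoC t * (z1 - z0))%C).
  set (D := Cmod (z1 - z0) + 1).
  assert (HD : 0 < D) by (unfold D; pose proof (Cmod_ge_0 (z1 - z0)); lra).
  assert (Hpd : forall s t, Cmod (p s - p t) <= Rabs (s - t) * D).
  { intros s t. unfold p.
    replace (z0 + RtoC s * (z1 - z0) - (z0 + RtoC t * (z1 - z0)))%C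
      with (RtoC (s - t) * (z1 - z0))%C by (rewrite RtoC_minus; ring).
    rewrite Cmod_mult, Cmod_R. apply Rmult_le_compat_l; [apply Rabs_pos|]. unfold D; lra. }
  set (E := fun t => 0 <= t <= 1 /\ forall s, 0 <= s <= t -> right_zero h (p s)).
  assert (E0 : E 0).
  { split; [lra|]. intros s Hs. replace s with 0 by lra.
    unfold p. replace (z0 + RtoC 0 * (z1 - z0))%C with z0 by ring. exact H0. }
  destruct (completeness E) as [l [Hl1 Hl2]].
  { exists 1. intros t [Ht _]; lra. }
  { exists 0; exact E0. }
  assert (Hl : 0 <= l <= 1).
  { split; [apply Hl1, E0|apply Hl2; intros t [Ht _]; lra]. }
  destruct (polar_right_zero h (p l) (Hp _)) as [R0 [HR HZ]].
  set (e := R0 / D).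
  assert (He : 0 < e) by (apply Rdiv_lt_0_compat; lra).
  assert (Hin : forall s, Rabs (s - l) < e -> Cmod (p s - p l) < R0).
  { intros s Hs. eapply Rle_lt_trans; [apply Hpd|].
    replace R0 with (e * D) by (unfold e; field; lra). apply Rmult_lt_compat_r; assumption. }
  assert (Ht : exists t, E t /\ l - e < t).
  { apply NNPP. intros N. assert (l <= l - e); [|lra].
    apply Hl2. intros t Et. apply Rnot_lt_le. intros L. apply N. exists t; auto. }
  destruct Ht as [t [[Ht01 Et] Hte]].
  assert (Htl : t <= l) by (apply Hl1; split; assumption).
  assert (HP : forall w, 0 < Cmod (w - p l) < R0 -> h w = RtoC 0).
  { apply (HZ (p t)); [apply Hin; rewrite Rabs_left1; lra|apply Et; lra]. }
  (* This element of [E] exceeds [l] unless it equals 1, so [E 1] holds. *)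
  assert (Em : E (Rmin 1 (l + e / 2))).
  { split; [unfold Rmin; destruct Rle_dec; lra|]. intros s Hs.
    destruct (Rle_dec s t) as [L|L]; [apply Et; lra|].
    apply (punctured_right_zero h (p l) R0); trivial. apply Hin.
    assert (s <= l + e / 2) by (pose proof (Rmin_r 1 (l + e / 2)); lra).
    apply Rabs_lt_between. lra. }
  assert (E1 : E 1).
  { pose proof (Hl1 _ Em) as K. unfold Rmin in *. destruct Rle_dec; [exact Em|lra]. }
  destruct E1 as [_ E1]. specialize (E1 1 ltac:(lra)).
  unfold p in E1. replace (z0 + RtoC 1 * (z1 - z0))%C with z1 in E1 by ring. exact E1.
Qed.

Lemma identity_polar h z0 z : (forall z, polar_at h z) -> right_zero h z0 -> punctured_zero h z.
Proof.
  intros Hp H0. destruct (polar_right_zero h z (Hp z)) as [R0 [HR HZ]].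
  exists R0. split; [exact HR|]. apply (HZ z).
  - rewrite Cmod_self. exact HR.
  - apply (right_zero_spreads h z0 z Hp H0).
Qed.

Lemma punctured_limit u v z r : 0 < r -> Ccont u z -> Ccont v z ->
  (forall w, 0 < Cmod (w - z) < r -> u w = v w) -> u z = v z.
Proof.
  intros Hr Hu Hv H. apply C_eq_sub, Cmod_eq_0.
  destruct (Req_dec (Cmod (u z - v z)) 0) as [E|E]; [exact E|exfalso].
  pose proof (Cmod_ge_0 (u z - v z)).
  destruct (Hu (Cmod (u z - v z) / 2)) as [d [Hd Kd]]; [lra|].
  destruct (Hv (Cmod (u z - v z) / 2)) as [d' [Hd' Kd']]; [lra|].
  set (x := Rmin r (Rmin d d') / 2).
  assert (Hx : 0 < x /\ x < r /\ x < d /\ x < d').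
  { unfold x, Rmin. repeat destruct Rle_dec; lra. }
  assert (Ew : Cmod (z + RtoC x - z) = x).
  { replace (z + RtoC x - z)%C with (RtoC x) by ring. rewrite Cmod_R, Rabs_pos_eq; lra. }
  specialize (Kd (z + RtoC x)%C). specialize (Kd' (z + RtoC x)%C).
  specialize (H (z + RtoC x)%C). rewrite Ew in *.
  specialize (Kd ltac:(lra)). specialize (Kd' ltac:(lra)). rewrite H in Kd by lra.
  pose proof (Cmod_triangle_sub (v (z + RtoC x)%C - v z) (v (z + RtoC x)%C - u z)) as T.
  replace (v (z + RtoC x) - v z - (v (z + RtoC x) - u z))%C with (u z - v z)%C in T by ring.
  lra.
Qed.

Lemma holo_near_Diff f z : holo_near f z -> Diff f z.
Proof. intros [r [Hr H]]. apply H. rewrite Cmod_self; exact Hr. Qed.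

(** At a pole the numerator [G] would equal [g] times a positive power of [w - z] off the centre, so
    [G z = 0] by continuity, which is excluded. Hence [f] is regular at [z] and its value there is
    the continuous one. *)
Lemma meromorphic_removable f g z r : meromorphic f -> holo_near g z -> 0 < r ->
  (forall w, 0 < Cmod (w - z) < r -> f w = g w) -> holo_near f z /\ f z = g z.
Proof.
  intros Hf Hg Hr E. pose proof (holo_near_Diff g z Hg) as Dg.
  destruct (Hf z) as [Hh|[n [Hn (s & G & Hs & HG & HG0 & EG)]]].
  - split; [exact Hh|]. apply (punctured_limit f g z r); trivial; apply Diff_cont; trivial.
    apply holo_near_Diff, Hh.
  - exfalso. apply HG0.
    assert (K : G z = (g z * Complex.Cpow (z - z) n)%C).
    { apply (punctured_limit G (fun w => g w * Complex.Cpow (w - z) n)%C z (Rmin r s)).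
      - apply Rmin_glb_lt; assumption.
      - apply Diff_cont, HG. rewrite Cmod_self; exact Hs.
      - apply Diff_cont. diff_tac.
      - intros w Hw. pose proof (Rmin_l r s). pose proof (Rmin_r r s).
        rewrite <- E by lra. rewrite EG, Cpow_eq by lra. field.
        apply Cpow_nz, Cmod_sub_pos, Hw. }
    rewrite K. destruct n as [|n]; [lia|]. simpl. ring.
Qed.

(** * Poles of the Weierstrass equation *)

Lemma Ccont_continuous f z : Ccont f z <->
  @continuous (AbsRing_UniformSpace C_AbsRing) (AbsRing_UniformSpace C_AbsRing) f z.
Proof.
  split.
  - intros H. apply filterlim_locally. intros e.
    destruct (H e (cond_pos e)) as [d [Hd Hw]]. exists (mkposreal d Hd). exact Hw.
  - intros H e He. apply filterlim_locally with (eps := mkposreal e He) in H.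
    destruct H as [d Hd]. exists d. split; [apply cond_pos|exact Hd].
Qed.

Lemma Ccont_mult f g z : Ccont f z -> Ccont g z -> Ccont (fun w => f w * g w)%C z.
Proof.
  rewrite !Ccont_continuous. intros Hf Hg. exact (continuous_mult (U := AbsRing_UniformSpace C_AbsRing) (K := C_AbsRing) f g z Hf Hg).
Qed.

Lemma Ccont_plus f g z : Ccont f z -> Ccont g z -> Ccont (fun w => f w + g w)%C z.
Proof.
  rewrite !Ccont_continuous. intros Hf Hg.
  exact (continuous_plus (U := AbsRing_UniformSpace C_AbsRing) (K := C_AbsRing) (V := AbsRing_NormedModule C_AbsRing) f g z Hf Hg).
Qed.

Lemma Cis_derive_C_derive f z : Diff f z -> Cis_derive f z (C_derive f z).
Proof.
  intros [l H]. rewrite (is_C_derive_unique f z l H). exact H.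
Qed.

Lemma Cis_derive_pow s n w : Cis_derive (fun w => Complex.Cpow (w - s) (S n)) w
  (RtoC (INR (S n)) * Complex.Cpow (w - s) n)%C.
Proof.
  pose proof (Cis_derive_minus _ _ w _ _ (Cis_derive_id w) (Cis_derive_const s w)) as H1.
  induction n as [|n IH].
  - simpl. pose proof (Cis_derive_mult _ _ w _ _ H1 (Cis_derive_const (RtoC 1) w)) as H.
    cbv beta in H. match type of H with Cis_derive _ _ ?a => match goal with
      |- Cis_derive _ _ ?b => replace b with a by ring end end. exact H.
  - pose proof (Cis_derive_mult _ _ w _ _ H1 IH) as H. cbv beta in H.
    change (fun w => Complex.Cpow (w - s) (S (S n)))
      with (fun w => ((w - s) * Complex.Cpow (w - s) (S n))%C).
    match type of H with Cis_derive _ _ ?a => match goal with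
      |- Cis_derive _ _ ?b => replace b with a end end; [exact H|].
    rewrite (S_INR (S n)), RtoC_plus. rewrite !Cpow_S. ring.
Qed.

Definition wcubic (g2 g3 : R) (y : C) : C := (RtoC 4 * (y * y * y) - RtoC g2 * y - RtoC g3)%C.

Lemma weierstrass_ode P g2 g3 z : is_weierstrass P g2 g3 -> holo_near P z ->
  Cis_derive P z (C_derive P z) /\
  (C_derive P z * C_derive P z)%C = wcubic g2 g3 (P z).
Proof.
  intros (_ & _ & H) Hz. destruct (H z Hz) as [l [Hl E]].
  rewrite (is_C_derive_unique P z l Hl). split; [exact Hl|].
  rewrite E. unfold wcubic. simpl. ring.
Qed.

Lemma near_disc_mid w s r : 0 < Cmod (w - s) < r -> exists d, 0 < d /\
  forall u, Cmod (u - w) < d -> 0 < Cmod (u - s) < r.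
Proof.
  intros H. exists (Rmin (Cmod (w - s)) (r - Cmod (w - s))).
  split; [apply Rmin_glb_lt; lra|]. intros u Hu.
  assert (Hu' : Cmod (u - w) < Cmod (w - s) /\ Cmod (u - w) < r - Cmod (w - s)).
  { unfold Rmin in Hu. destruct Rle_dec; lra. }
  split.
  - pose proof (Cmod_triangle_sub (u - s) (u - w)) as T.
    replace (u - s - (u - w))%C with (w - s)%C in T by ring. lra.
  - replace (u - s)%C with ((u - w) + (w - s))%C by ring.
    eapply Rle_lt_trans; [apply Cmod_triangle|]. lra.
Qed.

Section Pole.
Variables (P : C -> C) (g2 g3 : R) (s : C) (m : nat) (r : R) (g : C -> C).
Hypothesis HP : is_weierstrass P g2 g3.
Hypothesis Hr : 0 < r.
Hypothesis Hg : forall w, Cmod (w - s) < r -> Diff g w.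
Hypothesis Hg0 : g s <> RtoC 0.
Hypothesis HE : forall w, 0 < Cmod (w - s) < r -> (P w * Complex.Cpow (w - s) (S m))%C = g w.

(** Equal to [P' * (w - s)^(m+2)] off [s], by differentiating [P * (w - s)^(m+1) = g]. The order is
    written [m + 1] to keep it positive. *)
Let A (w : C) : C := ((w - s) * C_derive g w - RtoC (INR (S m)) * g w)%C.

Lemma pole_holo w : 0 < Cmod (w - s) < r -> holo_near P w.
Proof.
  intros Hw. destruct (near_disc_mid w s r Hw) as [d [Hd Hu]].
  exists d. split; [exact Hd|]. intros u Huw. specialize (Hu u Huw).
  destruct (near_disc_mid u s r Hu) as [d' [Hd' Hv]].
  apply (Diff_ext_near (fun v => g v / Complex.Cpow (v - s) (S m))%C P u d' Hd').
  - intros v Hvu. specialize (Hv v Hvu). rewrite <- HE by exact Hv. field.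
    apply Cpow_nz, Cmod_sub_pos, Hv.
  - apply (Diff_div g (fun v => Complex.Cpow (v - s) (S m))).
    + apply Cpow_nz, Cmod_sub_pos, Hu.
    + apply Hg; lra.
    + eexists. apply Cis_derive_pow.
Qed.

Lemma pole_derivative w : 0 < Cmod (w - s) < r ->
  (C_derive P w * Complex.Cpow (w - s) (S (S m)))%C = A w.
Proof.
  intros Hw. destruct (near_disc_mid w s r Hw) as [d [Hd Hu]].
  pose proof (proj1 (weierstrass_ode P g2 g3 w HP (pole_holo w Hw))) as D.
  pose proof (Cis_derive_mult _ _ w _ _ D (Cis_derive_pow s m w)) as D2. cbv beta in D2.
  apply (Cis_derive_ext_near _ g w _ d Hd) in D2.
  2:{ intros u Huw. apply HE, Hu, Huw. }
  unfold A. rewrite (is_C_derive_unique g w _ D2), <- HE by exact Hw.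
  rewrite !Cpow_S. ring.
Qed.

Lemma pole_A_cont : Ccont A s.
Proof.
  destruct (derivative_bounded g s r Hr Hg) as [L [HL HB]].
  unfold A.
  assert (K : Ccont (fun w => (w - s) * C_derive g w)%C s).
  { intros e He. exists (Rmin (r / 8) (e / L)).
    split; [apply Rmin_glb_lt; [lra|apply Rdiv_lt_0_compat; lra]|]. intros w Hw.
    assert (Hw' : Cmod (w - s) < r / 8 /\ Cmod (w - s) < e / L)
      by (unfold Rmin in Hw; destruct Rle_dec; lra).
    replace ((w - s) * C_derive g w - (s - s) * C_derive g s)%C
      with ((w - s) * C_derive g w)%C by ring.
    rewrite Cmod_mult.
    assert (B : Cmod (C_derive g w) <= L).
    { apply (HB w); [lra|]. apply Cis_derive_C_derive, Hg. lra. }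
    pose proof (Cmod_ge_0 (w - s)).
    apply Rle_lt_trans with (Cmod (w - s) * L); [apply Rmult_le_compat_l; lra|].
    apply Rlt_div_r; [exact HL|]. lra. }
  unfold Cminus at 1. apply (Ccont_plus _ (fun w => - (RtoC (INR (S m)) * g w))%C); [exact K|].
  apply Diff_cont.
  apply (Diff_ext_near (fun w => (- RtoC (INR (S m))) * g w)%C _ s 1 Rlt_0_1).
  - intros; ring.
  - apply Diff_mult; [apply Diff_const|]. apply Hg. rewrite Cmod_self. exact Hr.
Qed.

(** The differential equation multiplied by [(w - s)^(3m+5)]. A common power of [w - s] is left on
    both sides, so that the cases of [pole_order_two] can divide without negative exponents. *)
Lemma pole_relation w : 0 < Cmod (w - s) < r ->
  (A w * A w * Complex.Cpow (w - s) m * (w - s) =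
   (w - s) * (w - s) * (RtoC 4 * (g w * g w * g w)
   - RtoC g2 * g w * Complex.Cpow (w - s) (S m) * Complex.Cpow (w - s) (S m)
   - RtoC g3 * Complex.Cpow (w - s) (S m) * Complex.Cpow (w - s) (S m) * Complex.Cpow (w - s) (S m)))%C.
Proof.
  intros Hw. rewrite <- pole_derivative, <- HE by exact Hw.
  pose proof (proj2 (weierstrass_ode P g2 g3 w HP (pole_holo w Hw))) as D.
  unfold wcubic in D. rewrite !Cpow_S.
  set (t := Complex.Cpow (w - s) m). set (v := (w - s)%C).
  transitivity ((C_derive P w * C_derive P w) * (v * v * v * v * v * t * t * t))%C; [ring|].
  rewrite D. ring.
Qed.

Let rhs (w : C) : C := (RtoC 4 * (g w * g w * g w)
   - RtoC g2 * g w * Complex.Cpow (w - s) (S m) * Complex.Cpow (w - s) (S m)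
   - RtoC g3 * Complex.Cpow (w - s) (S m) * Complex.Cpow (w - s) (S m) * Complex.Cpow (w - s) (S m))%C.

Lemma pole_rhs_Diff : Diff rhs s.
Proof.
  assert (Diff g s) by (apply Hg; rewrite Cmod_self; exact Hr).
  unfold rhs. diff_tac.
Qed.

Lemma pole_rhs_value : rhs s = (RtoC 4 * (g s * g s * g s))%C.
Proof. unfold rhs. rewrite !Cpow_S. replace (s - s)%C with (RtoC 0) by ring. ring. Qed.

Lemma pole_A_value : A s = (- (RtoC (INR (S m)) * g s))%C.
Proof. unfold A. replace (s - s)%C with (RtoC 0) by ring. ring. Qed.

(** Balance of leading terms at [s], where [A] is [-(m+1) g] and the bracket is [4 g^3]. For [m = 0]
    the relation gives [g^2 = 0], for [m >= 2] it gives [4 g^3 = 0], and for [m = 1] it reads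
    [4 g^2 = 4 g^3]. *)
Lemma pole_order_two : m = 1%nat /\ g s = RtoC 1.
Proof.
  pose proof (Diff_cont _ _ pole_rhs_Diff) as Rc.
  pose proof pole_A_cont as Ac.
  assert (N4 : RtoC 4 <> RtoC 0) by (intros E; apply RtoC_inj in E; lra).
  assert (X : forall k, Ccont (fun w => Complex.Cpow (w - s) k) s).
  { intros k. apply Diff_cont. diff_tac. }
  assert (C3 : m = 0%nat \/ m = 1%nat \/ exists k, m = S (S k)).
  { destruct m as [|[|k]]; eauto. }
  destruct C3 as [Em|[Em|[k Em]]].
  - exfalso.
    assert (E : (A s * A s)%C = ((s - s) * rhs s)%C).
    { apply (punctured_limit (fun w => A w * A w)%C (fun w => (w - s) * rhs w)%C s r Hr).
      - apply Ccont_mult; exact Ac.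
      - apply Diff_cont. apply (Diff_mult (fun w => w - s)%C rhs); [diff_tac|exact pole_rhs_Diff].
      - intros w Hw. pose proof (pole_relation w Hw) as R0. fold (rhs w) in R0.
        rewrite Em in R0. pose proof (Cmod_sub_pos w s (proj1 Hw)) as Hn.
        replace (A w * A w)%C with (A w * A w * Complex.Cpow (w - s) 0 * (w - s) / (w - s))%C
          by (simpl; field; exact Hn).
        rewrite R0. field. exact Hn. }
    rewrite pole_A_value, Em in E.
    replace ((s - s) * rhs s)%C with (RtoC 0) in E by ring.
    apply (Cmult_neq_0 (g s) (g s) Hg0 Hg0). rewrite <- E. simpl. ring.
  - split; [exact Em|].
    assert (E : (A s * A s)%C = rhs s).
    { apply (punctured_limit (fun w => A w * A w)%C rhs s r Hr); trivial.
      - apply Ccont_mult; exact Ac.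
      - intros w Hw. pose proof (pole_relation w Hw) as R0. fold (rhs w) in R0.
        rewrite Em in R0. pose proof (Cmod_sub_pos w s (proj1 Hw)) as Hn.
        replace (A w * A w)%C
          with (A w * A w * Complex.Cpow (w - s) 1 * (w - s) / ((w - s) * (w - s)))%C
          by (simpl; field; exact Hn).
        rewrite R0. field. exact Hn. }
    rewrite pole_A_value, pole_rhs_value, Em in E.
    assert (E2 : (RtoC 4 * (g s * g s) * (g s - RtoC 1))%C = RtoC 0).
    { transitivity (RtoC 4 * (g s * g s * g s) - RtoC 4 * (g s * g s))%C; [ring|].
      rewrite <- E. simpl INR. rewrite RtoC_plus. ring. }
    apply C_eq_sub. apply NNPP. intros N.
    apply (Cmult_neq_0 (RtoC 4 * (g s * g s))%C) in N; [exact (N E2)|].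
    repeat apply Cmult_neq_0; assumption.
  - exfalso.
    assert (E : (A s * A s * Complex.Cpow (s - s) (S k))%C = rhs s).
    { apply (punctured_limit (fun w => A w * A w * Complex.Cpow (w - s) (S k))%C rhs s r Hr); trivial.
      - apply (Ccont_mult (fun w => A w * A w)%C); [apply Ccont_mult; exact Ac|apply X].
      - intros w Hw. pose proof (pole_relation w Hw) as R0. fold (rhs w) in R0.
        rewrite Em in R0. pose proof (Cmod_sub_pos w s (proj1 Hw)) as Hn.
        replace (A w * A w * Complex.Cpow (w - s) (S k))%C
          with (A w * A w * Complex.Cpow (w - s) (S (S k)) * (w - s) / ((w - s) * (w - s)))%C
          by (rewrite !Cpow_S; field; exact Hn).
        rewrite R0. field. exact Hn. }
    rewrite pole_rhs_value in E. rewrite Cpow_S in E.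
    replace (A s * A s * ((s - s) * Complex.Cpow (s - s) k))%C with (RtoC 0) in E by ring.
    symmetry in E. revert E. repeat apply Cmult_neq_0; assumption.
Qed.
End Pole.

Lemma pole_asymptotics P g2 g3 s n : is_weierstrass P g2 g3 -> pole_of_order P s n ->
  exists r, 0 < r /\ (forall w, 0 < Cmod (w - s) < r -> holo_near P w) /\
  forall e, 0 < e -> exists d, 0 < d /\ forall w, 0 < Cmod (w - s) < d ->
    Cmod ((w - s) * (w - s) * P w - RtoC 1) < e /\
    Cmod ((w - s) * (w - s) * (w - s) * C_derive P w + RtoC 2) < e.
Proof.
  intros HP (Hn & r & g & Hr & Hg & Hg0 & E).
  destruct n as [|m]; [lia|].
  assert (HE : forall w, 0 < Cmod (w - s) < r -> (P w * Complex.Cpow (w - s) (S m))%C = g w).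
  { intros w Hw. rewrite E, Cpow_eq by exact Hw. field.
    apply Cpow_nz, Cmod_sub_pos, Hw. }
  destruct (pole_order_two P g2 g3 s m r g HP Hr Hg Hg0 HE) as [Em Eg]. subst m.
  exists r. split; [exact Hr|]. split.
  { intros w Hw. exact (pole_holo P s 1 r g Hg HE w Hw). }
  intros e He.
  pose proof (Diff_cont g s (Hg s ltac:(rewrite Cmod_self; exact Hr))) as Gc.
  pose proof (pole_A_cont s 1 r g Hr Hg) as Ac.
  destruct (Gc e He) as [d [Hd Kd]]. destruct (Ac e He) as [d' [Hd' Kd']].
  exists (Rmin r (Rmin d d')). split; [repeat apply Rmin_glb_lt; assumption|].
  intros w Hw. assert (Hw' : Cmod (w - s) < r /\ Cmod (w - s) < d /\ Cmod (w - s) < d').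
  { unfold Rmin in Hw. repeat destruct Rle_dec; lra. }
  destruct Hw' as (H1 & H2 & H3). split.
  - specialize (Kd w H2). rewrite Eg in Kd. rewrite <- HE in Kd by lra.
    rewrite !Cpow_S in Kd. simpl in Kd.
    replace ((w - s) * (w - s) * P w - RtoC 1)%C
      with (P w * ((w - s) * ((w - s) * RtoC 1)) - RtoC 1)%C by ring. exact Kd.
  - specialize (Kd' w H3). cbv beta in Kd'.
    rewrite <- (pole_derivative P g2 g3 s 1 r g HP Hg HE w ltac:(lra)) in Kd'.
    rewrite Eg in Kd'. rewrite !Cpow_S in Kd'. simpl in Kd'.
    eapply Rle_lt_trans; [|exact Kd']. right. f_equal. rewrite RtoC_plus. ring.
Qed.

(** * Uniqueness of the branch at a pole *)

Definition Rder (p : R -> C) (t : R) (l : C) : Prop :=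
  is_derive (fun x => fst (p x)) t (fst l) /\ is_derive (fun x => snd (p x)) t (snd l).

Lemma decreasing_of_derive f df a b : a <= b ->
  (forall x, a <= x <= b -> is_derive f x (df x) /\ df x <= 0) -> f b <= f a.
Proof.
  intros Hab H.
  destruct (MVT_gen f a b df) as [c [Hc E]].
  - rewrite Rmin_left, Rmax_right by exact Hab. intros x Hx. apply H; lra.
  - rewrite Rmin_left, Rmax_right by exact Hab. intros x Hx.
    apply continuity_pt_filterlim, (ex_derive_continuous (K := R_AbsRing) (V := R_NormedModule) f).
    eexists. apply (H x Hx).
  - rewrite Rmin_left, Rmax_right in Hc by exact Hab.
    destruct (H c Hc) as [_ K]. nra.
Qed.

Lemma is_derive_weighted_square (u a b : R -> R) t u' a' b' :
  is_derive u t u' -> is_derive a t a' -> is_derive b t b' ->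
  is_derive (fun t => u t * u t * u t * u t * (a t * a t + b t * b t)) t
    (2 * (u t * u t * u t) * (2 * u' * (a t * a t + b t * b t) + u t * (a t * a' + b t * b'))).
Proof.
  intros Hu Ha Hb.
  assert (ex_derive u t) by (eexists; exact Hu).
  assert (ex_derive a t) by (eexists; exact Ha).
  assert (ex_derive b t) by (eexists; exact Hb).
  auto_derive; [repeat split; assumption|].
  change (Derive (fun x => u x) t) with (Derive u t).
  change (Derive (fun x => a x) t) with (Derive a t).
  change (Derive (fun x => b x) t) with (Derive b t).
  rewrite (is_derive_unique u t u' Hu), (is_derive_unique a t a' Ha), (is_derive_unique b t b' Hb).
  ring.
Qed.

(** A solution seen along a real parameter [t]: [u t] plays the distance to the pole, [p1] the
    derivative with respect to [u], and the factor [u'] is the chain rule. The limits of [u^2 p] and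
    [u^3 p1] fix the leading term and the sign of the square root. *)
Definition pole_branch (g2 g3 : R) (u u' : R -> R) (p p1 : R -> C) (d : R) : Prop :=
  (forall t, 0 < t < d ->
     Rder p t (RtoC (u' t) * p1 t)%C /\ (p1 t * p1 t)%C = wcubic g2 g3 (p t)) /\
  forall e, 0 < e -> exists d', 0 < d' /\ forall t, 0 < t < d' ->
    Cmod (RtoC (u t * u t) * p t - RtoC 1) < e /\
    Cmod (RtoC (u t * u t * u t) * p1 t + RtoC 2) < e.

(** Subtracting the two equations, [(p1 - q1)(p1 + q1) = (p - q)(4 (p^2 + p q + q^2) - g2)]. After
    scaling by powers of [u] the numerator tends to 12 and [p1 + q1] to -4, so the ratio tends to
    -3. The tolerance [1 / 64] keeps it within 1 of that. *)
Lemma pole_branch_ratio (g2 u : R) (p q p1 q1 : C) :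
  0 < u -> u < 1 -> u * (2 * (Rabs g2 + 1)) < 1 ->
  Cmod (RtoC (u * u) * p - RtoC 1) < / 64 -> Cmod (RtoC (u * u) * q - RtoC 1) < / 64 ->
  Cmod (RtoC (u * u * u) * p1 + RtoC 2) < / 64 -> Cmod (RtoC (u * u * u) * q1 + RtoC 2) < / 64 ->
  (p1 + q1)%C <> RtoC 0 /\
  fst (RtoC u * (RtoC 4 * (p * p + p * q + q * q) - RtoC g2) / (p1 + q1))%C <= -2.
Proof.
  intros Hu Hu1 Hg Hp Hq Hp1 Hq1.
  set (T := (RtoC (u * u * u) * (p1 + q1))%C).
  set (X := (RtoC (u * u) * p)%C) in *. set (Y := (RtoC (u * u) * q)%C) in *.
  set (B := (RtoC 4 * (X * X + X * Y + Y * Y) - RtoC (g2 * (u * u * u * u)))%C).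
  assert (HT : Cmod (T + RtoC 4) <= / 32).
  { replace (T + RtoC 4)%C with ((RtoC (u * u * u) * p1 + RtoC 2) + (RtoC (u * u * u) * q1 + RtoC 2))%C.
    2:{ unfold T. replace (RtoC 4) with (RtoC 2 + RtoC 2)%C by (rewrite <- RtoC_plus; f_equal; ring). ring. }
    eapply Rle_trans; [apply Cmod_triangle|]. lra. }
  assert (HT3 : 3 <= Cmod T).
  { pose proof (Cmod_triangle_sub (T + RtoC 4) T) as Q.
    replace (T + RtoC 4 - T)%C with (RtoC 4) in Q by ring. rewrite Cmod_R, Rabs_pos_eq in Q; lra. }
  assert (HX : Cmod X <= 1 + / 64).
  { replace X with ((X - RtoC 1) + RtoC 1)%C by ring.
    eapply Rle_trans; [apply Cmod_triangle|]. rewrite Cmod_1. lra. }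
  assert (HY : Cmod Y <= 1 + / 64).
  { replace Y with ((Y - RtoC 1) + RtoC 1)%C by ring.
    eapply Rle_trans; [apply Cmod_triangle|]. rewrite Cmod_1. lra. }
  assert (H1 : Cmod ((X - RtoC 1) * (X + Y + RtoC 1) + (Y - RtoC 1) * (Y + RtoC 2)) <= / 8).
  { eapply Rle_trans; [apply Cmod_triangle|]. rewrite !Cmod_mult.
    assert (Cmod (X + Y + RtoC 1) <= 4).
    { eapply Rle_trans; [apply Cmod_triangle|]. rewrite Cmod_1.
      pose proof (Cmod_triangle X Y). lra. }
    assert (Cmod (Y + RtoC 2) <= 4).
    { eapply Rle_trans; [apply Cmod_triangle|]. rewrite Cmod_R, Rabs_pos_eq; lra. }
    pose proof (Cmod_ge_0 (X - RtoC 1)). pose proof (Cmod_ge_0 (Y - RtoC 1)).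
    pose proof (Cmod_ge_0 (X + Y + RtoC 1)). pose proof (Cmod_ge_0 (Y + RtoC 2)).
    assert (Cmod (X - RtoC 1) * Cmod (X + Y + RtoC 1) <= / 64 * 4)
      by (apply Rmult_le_compat; lra).
    assert (Cmod (Y - RtoC 1) * Cmod (Y + RtoC 2) <= / 64 * 4)
      by (apply Rmult_le_compat; lra).
    lra. }
  assert (H2 : Rabs (g2 * (u * u * u * u)) <= / 2).
  { rewrite Rabs_mult, (Rabs_pos_eq (u * u * u * u)) by (repeat apply Rmult_le_pos; lra).
    pose proof (Rabs_pos g2).
    assert (u * u * u <= 1) by nra.
    assert (u * u * u * u <= u) by nra. nra. }
  assert (HB : Cmod (B - RtoC 12) <= 1).
  { replace (B - RtoC 12)%C with
      (RtoC 4 * ((X - RtoC 1) * (X + Y + RtoC 1) + (Y - RtoC 1) * (Y + RtoC 2))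
       - RtoC (g2 * (u * u * u * u)))%C.
    2:{ unfold B. replace (RtoC 12) with (RtoC 4 * (RtoC 1 + RtoC 2))%C
          by (rewrite <- RtoC_plus, <- RtoC_mult; f_equal; ring).
        replace (RtoC 2) with (RtoC 1 + RtoC 1)%C by (rewrite <- RtoC_plus; f_equal; ring). ring. }
    eapply Rle_trans; [apply Cmod_triangle_sub|]. rewrite Cmod_mult, !Cmod_R.
    rewrite (Rabs_pos_eq 4) by lra. lra. }
  assert (N : (p1 + q1)%C <> RtoC 0).
  { intros E. unfold T in HT3. rewrite E in HT3.
    replace (RtoC (u * u * u) * RtoC 0)%C with (RtoC 0) in HT3 by ring.
    rewrite Cmod_0 in HT3. lra. }
  split; [exact N|].
  assert (NT : T <> RtoC 0) by (apply Cmod_gt_0; lra).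
  assert (Nu : RtoC u <> RtoC 0) by (intros E; apply RtoC_inj in E; lra).
  set (Z := (RtoC u * (RtoC 4 * (p * p + p * q + q * q) - RtoC g2) / (p1 + q1))%C).
  assert (EZ : Z = (B / T)%C).
  { unfold Z, B, T, X, Y. rewrite !RtoC_mult. field. split; assumption. }
  assert (HZ : Cmod (Z + RtoC 3) <= 1).
  { rewrite EZ. replace (B / T + RtoC 3)%C with (((B - RtoC 12) + RtoC 3 * (T + RtoC 4)) / T)%C.
    2:{ replace (RtoC 12) with (RtoC 3 * RtoC 4)%C
          by (rewrite <- RtoC_mult; f_equal; ring). field. exact NT. }
    rewrite Cmod_div by exact NT. apply Rle_div_l; [lra|].
    eapply Rle_trans; [apply Cmod_triangle|]. rewrite Cmod_mult, Cmod_R, Rabs_pos_eq; lra. }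
  clearbody Z. pose proof (fst_le_Cmod (Z + RtoC 3)%C) as K. simpl in K.
  assert (K' : Rabs (fst Z + 3) <= 1) by lra.
  apply Rabs_le_between in K'. lra.
Qed.

(* The weight [u^4 |p - q|^2] tends to 0 at the pole, yet it is nonincreasing: near the pole
   [(p - q)' ~ - 3 (u'/u) (p - q)]. *)
Lemma pole_branch_unique g2 g3 u u' p q p1 q1 d : 0 < d ->
  (forall t, 0 < t < d -> is_derive u t (u' t) /\ 0 < u' t /\ 0 < u t) ->
  (forall e, 0 < e -> exists d', 0 < d' /\ forall t, 0 < t < d' -> u t < e) ->
  pole_branch g2 g3 u u' p p1 d -> pole_branch g2 g3 u u' q q1 d ->
  exists d', 0 < d' /\ forall t, 0 < t < d' -> p t = q t.
Proof.
  intros Hd Hu Hu0 [Dp Lp] [Dq Lq].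
  destruct (Hu0 (Rmin 1 (/ (2 * (Rabs g2 + 1))))) as [d1 [Hd1 K1]].
  { pose proof (Rabs_pos g2). apply Rmin_glb_lt; [lra|apply Rinv_0_lt_compat; lra]. }
  destruct (Lp (/ 64)) as [d2 [Hd2 K2]]; [lra|].
  destruct (Lq (/ 64)) as [d3 [Hd3 K3]]; [lra|].
  set (D := Rmin (Rmin d d1) (Rmin d2 d3)).
  assert (HD : 0 < D) by (unfold D; repeat apply Rmin_glb_lt; assumption).
  assert (HDt : forall t, t < D -> t < d /\ t < d1 /\ t < d2 /\ t < d3).
  { intros t Ht. unfold D, Rmin in Ht. repeat destruct Rle_dec; lra. }
  exists D. split; [exact HD|].
  set (a := fun t => fst (p t) - fst (q t)). set (b := fun t => snd (p t) - snd (q t)).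
  set (N := fun t => u t * u t * u t * u t * (a t * a t + b t * b t)).
  assert (Hdec : forall x, 0 < x < D -> exists l, is_derive N x l /\ l <= 0).
  { intros x Hx. destruct (HDt x (proj2 Hx)) as (X0 & X1 & X2 & X3).
    destruct (Hu x ltac:(lra)) as (Hu1 & Hu2 & Hu3).
    destruct (Dp x ltac:(lra)) as [[Pf Ps] Pe].
    destruct (Dq x ltac:(lra)) as [[Qf Qs] Qe].
    specialize (K1 x ltac:(lra)).
    destruct (K2 x ltac:(lra)) as [A1 A2]. destruct (K3 x ltac:(lra)) as [B1 B2].
    assert (U1 : u x < 1) by (eapply Rlt_le_trans; [exact K1|apply Rmin_l]).
    assert (U2 : u x * (2 * (Rabs g2 + 1)) < 1).
    { pose proof (Rabs_pos g2).
      assert (U3 : u x < / (2 * (Rabs g2 + 1))) by (eapply Rlt_le_trans; [exact K1|apply Rmin_r]).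
      apply (Rmult_lt_compat_r (2 * (Rabs g2 + 1))) in U3; [|lra].
      rewrite Rinv_l in U3 by lra. exact U3. }
    destruct (pole_branch_ratio g2 (u x) (p x) (q x) (p1 x) (q1 x)) as [NT HZ]; trivial.
    set (Z := (RtoC (u x) * (RtoC 4 * (p x * p x + p x * q x + q x * q x) - RtoC g2)
               / (p1 x + q1 x))%C) in *.
    assert (ES : (RtoC (u x) * (p1 x - q1 x) = (p x - q x) * Z)%C).
    { assert (E1 : ((p1 x - q1 x) * (p1 x + q1 x) =
         (p x - q x) * (RtoC 4 * (p x * p x + p x * q x + q x * q x) - RtoC g2))%C).
      { transitivity (p1 x * p1 x - q1 x * q1 x)%C; [ring|]. rewrite Pe, Qe.
        unfold wcubic. ring. }
      unfold Z. transitivity (RtoC (u x) * ((p1 x - q1 x) * (p1 x + q1 x)) / (p1 x + q1 x))%C.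
      - field. exact NT.
      - rewrite E1. field. exact NT. }
    assert (Da : is_derive a x (fst (RtoC (u' x) * p1 x)%C - fst (RtoC (u' x) * q1 x)%C))
      by (apply (is_derive_minus (V := R_NormedModule)); assumption).
    assert (Db : is_derive b x (snd (RtoC (u' x) * p1 x)%C - snd (RtoC (u' x) * q1 x)%C))
      by (apply (is_derive_minus (V := R_NormedModule)); assumption).
    eexists. split; [apply (is_derive_weighted_square u a b x _ _ _ Hu1 Da Db)|].
    clearbody Z. destruct Z as [zx zy]. simpl in HZ.
    pose proof (f_equal fst ES) as F1. pose proof (f_equal snd ES) as F2.
    simpl in F1, F2. simpl. fold (a x) (b x) in *.
    unfold a, b in *. 
    set (ax := fst (p x) - fst (q x)) in *. set (bx := snd (p x) - snd (q x)) in *.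
    set (uu := u x) in *. set (uu' := u' x) in *.
    assert (G1 : uu * (fst (p1 x) - fst (q1 x)) = ax * zx - bx * zy) by (unfold ax, bx; lra).
    assert (G2 : uu * (snd (p1 x) - snd (q1 x)) = ax * zy + bx * zx) by (unfold ax, bx; lra).
    (* The derivative is [2 u^3 u' |p - q|^2 (2 + Re Z)], nonpositive because [Re Z <= -2]. The
       exponent 4 of the weight is the source of the 2. *)
    match goal with |- ?g <= 0 => replace g with
      (2 * (uu * uu * uu) * uu' * ((ax * ax + bx * bx) * (2 + zx))) end.
    2:{ transitivity (2 * (uu * uu * uu) * uu' * (2 * (ax * ax + bx * bx)
          + (ax * (uu * (fst (p1 x) - fst (q1 x))) + bx * (uu * (snd (p1 x) - snd (q1 x)))))).
        - rewrite G1, G2. ring.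
        - ring. }
    assert (0 <= 2 * (uu * uu * uu) * uu') by (repeat apply Rmult_le_pos; lra).
    assert (0 <= (ax * ax + bx * bx) * - (2 + zx)) by (apply Rmult_le_pos; nra).
    nra. }
  intros t Ht.
  assert (HN : N t <= 0).
  { apply Rnot_lt_le. intros Hp.
    (* At a small [s] the weight is at most [(2 e)^2]; this [e] makes [4 e^2 < N t], against
       [N t <= N s]. *)
    set (e := Rmin 1 (N t) / 4).
    assert (He : 0 < e /\ e < 1 /\ 4 * (e * e) < N t).
    { unfold e, Rmin. destruct Rle_dec; [lra|]. nra. }
    destruct He as (He & He1 & HeN).
    destruct (Lp e He) as [d4 [Hd4 K4]]. destruct (Lq e He) as [d5 [Hd5 K5]].
    set (s := Rmin t (Rmin d4 d5) / 2).
    assert (Hs : 0 < s /\ s < t /\ s < d4 /\ s < d5).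
    { unfold s, Rmin. repeat destruct Rle_dec; lra. }
    destruct Hs as (Hs0 & Hst & Hs4 & Hs5).
    assert (HNs : N t <= N s).
    { apply (decreasing_of_derive N (fun x => Derive N x)); [lra|]. intros x Hx.
      destruct (Hdec x) as [l [Hl1 Hl2]]; [lra|].
      rewrite (is_derive_unique N x l Hl1). split; assumption. }
    destruct (K4 s ltac:(lra)) as [A1 _]. destruct (K5 s ltac:(lra)) as [B1 _].
    assert (M : Cmod (RtoC (u s * u s) * (p s - q s)) <= 2 * e).
    { replace (RtoC (u s * u s) * (p s - q s))%C with
        ((RtoC (u s * u s) * p s - RtoC 1) - (RtoC (u s * u s) * q s - RtoC 1))%C by ring.
      eapply Rle_trans; [apply Cmod_triangle_sub|]. lra. }
    assert (EN : N s = Cmod (RtoC (u s * u s) * (p s - q s)) ^ 2).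
    { rewrite Cmod2_alt. unfold Re, Im, N, a, b. simpl. ring. }
    pose proof (Cmod_ge_0 (RtoC (u s * u s) * (p s - q s))). rewrite EN in HNs. simpl in HNs.
    nra. }
  destruct (HDt t (proj2 Ht)) as (X0 & _).
  destruct (Hu t ltac:(lra)) as (_ & _ & Hut).
  unfold N in HN. assert (0 < u t * u t * u t * u t) by (repeat apply Rmult_lt_0_compat; lra).
  assert (HS : a t * a t + b t * b t <= 0).
  { apply Rnot_lt_le. intros Hp. pose proof (Rmult_lt_0_compat _ _ H Hp). lra. }
  assert (Z1 : a t = 0) by nra. assert (Z2 : b t = 0) by nra.
  unfold a in Z1. unfold b in Z2. apply injective_projections; lra.
Qed.

(** * The hypergeometric function *)

Lemma CV_radius_bounded_coef a x : (forall n, Rabs (a n) <= 1) -> Rabs x < 1 ->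
  Rbar_lt (Rabs x) (CV_radius a).
Proof.
  intros Ha Hx. apply Rbar_lt_le_trans with (Finite 1); [exact Hx|].
  apply (proj1 (CV_radius_bounded a)). exists 1. intros n. rewrite pow1, Rmult_1_r. apply Ha.
Qed.

Lemma ex_pseries_bounded_coef a x : (forall n, Rabs (a n) <= 1) -> Rabs x < 1 -> ex_pseries a x.
Proof.
  intros Ha Hx. apply CV_radius_inside, CV_radius_bounded_coef; assumption.
Qed.

(** The Taylor coefficients of [(1 - x)^(-1/2)] at 0. *)
Definition binom_coef (n : nat) : R := poch (1 / 2) n / INR (Factorial.fact n).

Lemma binom_coef_S n : INR (S n) * binom_coef (S n) = (1 / 2 + INR n) * binom_coef n.
Proof.
  unfold binom_coef. change (Factorial.fact (S n)) with (S n * Factorial.fact n)%nat.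
  rewrite mult_INR. simpl poch. field. split; [apply INR_fact_neq_0|apply not_0_INR; lia].
Qed.

Lemma binom_coef_bound n : 0 < binom_coef n <= 1.
Proof.
  induction n as [|n IH]; [unfold binom_coef; simpl; lra|].
  pose proof (binom_coef_S n) as E. rewrite S_INR in E. pose proof (pos_INR n). split; nra.
Qed.

Lemma binom_coef_abs n : Rabs (binom_coef n) <= 1.
Proof. pose proof (binom_coef_bound n). rewrite Rabs_pos_eq; lra. Qed.

Lemma binom_series_ode x : Rabs x < 1 ->
  (1 - x) * PSeries (PS_derive binom_coef) x = / 2 * PSeries binom_coef x.
Proof.
  intros Hx. pose proof (CV_radius_bounded_coef _ x binom_coef_abs Hx) as HR.
  assert (Hd : ex_pseries (PS_derive binom_coef) x).
  { apply CV_radius_inside. rewrite CV_radius_derive. exact HR. }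
  assert (E : PSeries (PS_derive binom_coef) x =
     PSeries (PS_plus (PS_scal (/ 2) binom_coef) (PS_incr_1 (PS_derive binom_coef))) x).
  { apply PSeries_ext. intros n. unfold PS_derive at 1. rewrite binom_coef_S.
    unfold PS_plus, PS_scal, PS_incr_1, PS_derive.
    destruct n as [|n].
    - change ((1 / 2 + INR 0) * binom_coef 0 = / 2 * binom_coef 0 + 0). simpl INR. lra.
    - change ((1 / 2 + INR (S n)) * binom_coef (S n) =
        / 2 * binom_coef (S n) + INR (S n) * binom_coef (S n)). lra. }
  rewrite PSeries_plus, PSeries_scal, PSeries_incr_1 in E.
  - lra.
  - apply (ex_pseries_scal (K := R_AbsRing) (V := R_NormedModule));
      [apply Rmult_comm|apply ex_pseries_bounded_coef; [apply binom_coef_abs|exact Hx]].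
  - apply (ex_pseries_incr_1 (K := R_AbsRing) (V := R_NormedModule)), Hd.
Qed.

(** By [binom_series_ode] the product of the series with [sqrt (1 - x)] has derivative 0, and it is
    1 at 0. *)
Lemma binom_series x : Rabs x < 1 -> PSeries binom_coef x = / sqrt (1 - x).
Proof.
  intros Hx.
  assert (K : forall t, Rabs t < 1 -> is_derive (fun t => PSeries binom_coef t * sqrt (1 - t)) t 0).
  { intros t Ht. pose proof (is_derive_PSeries _ t (CV_radius_bounded_coef _ t binom_coef_abs Ht)) as D.
    pose proof (binom_series_ode t Ht) as O. apply Rabs_lt_between in Ht.
    assert (S0 : 0 < sqrt (1 - t)) by (apply sqrt_lt_R0; lra).
    pose proof (sqrt_sqrt (1 - t) ltac:(lra)) as S2.
    assert (ex_derive (PSeries binom_coef) t) by (eexists; exact D).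
    auto_derive; [repeat split; trivial; lra|].
    change (Derive (fun x0 => PSeries binom_coef x0) t) with (Derive (PSeries binom_coef) t).
    rewrite (is_derive_unique _ _ _ D).
    replace (1 + - t) with (1 - t) by ring.
    apply (Rmult_eq_reg_r (sqrt (1 - t))); [|lra]. field_simplify; [|lra].
    replace (sqrt (1 - t) ^ 2) with (1 - t) by (simpl; lra). lra. }
  assert (E0 : PSeries binom_coef 0 * sqrt (1 - 0) = 1).
  { rewrite PSeries_0, Rminus_0_r, sqrt_1. unfold binom_coef; simpl. lra. }
  assert (E : PSeries binom_coef x * sqrt (1 - x) = 1).
  { transitivity (PSeries binom_coef 0 * sqrt (1 - 0)); [|exact E0]. apply Rabs_lt_between in Hx.
    destruct (Rtotal_order x 0) as [L|[->|L]]; trivial.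
    - apply (eq_is_derive (fun t => PSeries binom_coef t * sqrt (1 - t)) x 0); trivial.
      intros t Ht. apply K. apply Rabs_lt_between; lra.
    - symmetry. apply (eq_is_derive (fun t => PSeries binom_coef t * sqrt (1 - t)) 0 x); trivial.
      intros t Ht. apply K. apply Rabs_lt_between; lra. }
  apply Rabs_lt_between in Hx.
  assert (S0 : 0 < sqrt (1 - x)) by (apply sqrt_lt_R0; lra).
  apply (Rmult_eq_reg_r (sqrt (1 - x))); [|lra]. rewrite E, Rinv_l; lra.
Qed.

Lemma poch_half_pos n : 0 < poch (1 / 2) n.
Proof.
  induction n as [|n IH]; simpl; [lra|]. pose proof (pos_INR n).
  apply Rmult_lt_0_compat; lra.
Qed.

Lemma poch_S a n : poch a (S n) = poch a n * (a + INR n).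
Proof. reflexivity. Qed.

(** Duplication: [(1/2)_(2n) = 4^n (1/4)_n (3/4)_n] and [(2n)! = 4^n n! (1/2)_n]. *)
Lemma hyp_coef_even n :
  poch (1 / 4) n * poch (3 / 4) n / (poch (1 / 2) n * INR (Factorial.fact n)) = binom_coef (2 * n).
Proof.
  assert (H : poch (1 / 4) n * poch (3 / 4) n * INR (Factorial.fact (2 * n)) =
     poch (1 / 2) (2 * n) * (poch (1 / 2) n * INR (Factorial.fact n))).
  { induction n as [|n IH]; [simpl; ring|].
    replace (2 * S n)%nat with (S (S (2 * n))) by lia.
    change (Factorial.fact (S (S (2 * n)))) with (S (S (2 * n)) * (S (2 * n) * Factorial.fact (2 * n)))%nat.
    change (Factorial.fact (S n)) with (S n * Factorial.fact n)%nat.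
    rewrite !poch_S. repeat rewrite ?mult_INR, ?S_INR. change (INR 0) with 0.
    transitivity (poch (1 / 4) n * poch (3 / 4) n * INR (Factorial.fact (2 * n)) *
      ((1 / 4 + INR n) * (3 / 4 + INR n) * (2 * INR n + 1 + 1) * (2 * INR n + 1))); [ring|].
    rewrite IH. field. }
  unfold binom_coef. pose proof (poch_half_pos n).
  pose proof (INR_fact_lt_0 n). pose proof (INR_fact_lt_0 (2 * n)).
  apply (Rmult_eq_reg_r (INR (Factorial.fact (2 * n)) * (poch (1 / 2) n * INR (Factorial.fact n)))).
  2:{ apply Rgt_not_eq. repeat apply Rmult_lt_0_compat; assumption. }
  field_simplify; try lra.
Qed.

(** The even part of [(1 - s)^(-1/2)]. With [s = sin psi] it is [cos(psi/2) / cos psi]. *)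
Definition hyp_closed (s : R) : R := (/ sqrt (1 - s) + / sqrt (1 + s)) / 2.

Lemma hyp2f1_closed s : Rabs s < 1 -> hyp2f1 (1 / 4) (3 / 4) (1 / 2) (s ^ 2) = hyp_closed s.
Proof.
  intros Hs.
  assert (E : hyp2f1 (1 / 4) (3 / 4) (1 / 2) (s ^ 2) = PSeries (fun n => binom_coef (2 * n)) (s ^ 2)).
  { unfold hyp2f1, PSeries. apply Series_ext. intros n. rewrite hyp_coef_even. reflexivity. }
  assert (Hs2 : Rabs (s ^ 2) < 1).
  { rewrite <- RPow_abs. pose proof (Rabs_pos s). simpl. nra. }
  assert (Hs' : Rabs (- s) < 1) by (rewrite Rabs_Ropp; exact Hs).
  pose proof (ex_pseries_bounded_coef (fun n => binom_coef (2 * n)) _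
    (fun n => binom_coef_abs (2 * n)) Hs2) as X1.
  pose proof (ex_pseries_bounded_coef (fun n => binom_coef (2 * n + 1)) _
    (fun n => binom_coef_abs (2 * n + 1)) Hs2) as X2.
  pose proof (PSeries_odd_even binom_coef s X1 X2) as E1.
  pose proof (PSeries_odd_even binom_coef (- s)) as E2.
  replace ((- s) ^ 2) with (s ^ 2) in E2 by ring. specialize (E2 X1 X2).
  rewrite binom_series in E1, E2 by assumption.
  replace (1 - - s) with (1 + s) in E2 by ring.
  rewrite E. unfold hyp_closed. lra.
Qed.

(** * The amplitude function *)

Section Branch.
Variable k : R.
Hypothesis Hk : 0 < k < 1.

(** With [t] in the role of phi, [s] is [sin psi] and [dn] is [cos psi]. *)
Let s (t : R) : R := k * sin t.
Let dn (t : R) : R := sqrt (1 - s t * s t).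

Lemma s_bound t : - k <= s t <= k.
Proof. pose proof (SIN_bound t). unfold s. split; nra. Qed.

Lemma hyp_closed_pos t : 0 < hyp_closed (s t).
Proof.
  pose proof (s_bound t). unfold hyp_closed.
  assert (0 < / sqrt (1 - s t)) by (apply Rinv_0_lt_compat, sqrt_lt_R0; lra).
  assert (0 < / sqrt (1 + s t)) by (apply Rinv_0_lt_compat, sqrt_lt_R0; lra). lra.
Qed.

Lemma hyp_closed_continuous t : continuous (fun t => hyp_closed (s t)) t.
Proof.
  apply (ex_derive_continuous (K := R_AbsRing) (V := R_NormedModule)).
  pose proof (s_bound t) as Hs. unfold s in *. unfold hyp_closed.
  assert (0 < sqrt (1 - k * sin t)) by (apply sqrt_lt_R0; lra).
  assert (0 < sqrt (1 + k * sin t)) by (apply sqrt_lt_R0; lra).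
  auto_derive. repeat split; try lra.
  - apply Rgt_not_eq. replace (1 + - (k * sin t)) with (1 - k * sin t) by ring. lra.
Qed.

Lemma u_of_integrand t : hyp2f1 (1 / 4) (3 / 4) (1 / 2) (k ^ 2 * sin t ^ 2) = hyp_closed (s t).
Proof.
  rewrite <- Rpow_mult_distr. apply hyp2f1_closed.
  pose proof (s_bound t). unfold s in *. apply Rabs_lt_between. lra.
Qed.

Lemma u_of_derive t : is_derive (u_of k) t (hyp_closed (s t)).
Proof.
  apply (is_derive_ext (fun x => RInt (fun t => hyp_closed (s t)) 0 x)).
  { intros x. unfold u_of. apply RInt_ext. intros y _. symmetry. apply u_of_integrand. }
  apply (is_derive_RInt (V := R_NormedModule) (fun t => hyp_closed (s t)) _ 0 t).
  - apply filter_forall. intros x. apply (RInt_correct (V := R_CompleteNormedModule)).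
    apply (ex_RInt_continuous (V := R_CompleteNormedModule)). intros z _. apply hyp_closed_continuous.
  - apply hyp_closed_continuous.
Qed.

Lemma u_of_0 : u_of k 0 = 0.
Proof. unfold u_of. rewrite RInt_point. reflexivity. Qed.

Lemma u_of_pos t : 0 < t -> 0 < u_of k t.
Proof.
  intros Ht. rewrite <- u_of_0.
  destruct (MVT_gen (u_of k) 0 t (fun t => hyp_closed (s t))) as [c [_ E]].
  - intros x _. apply u_of_derive.
  - intros x _. apply continuity_pt_filterlim, (ex_derive_continuous (K := R_AbsRing) (V := R_NormedModule)).
    eexists; apply u_of_derive.
  - pose proof (hyp_closed_pos c). nra.
Qed.

Lemma s_pos t : 0 < t < 1 -> 0 < s t.
Proof.
  intros Ht. unfold s. apply Rmult_lt_0_compat; [lra|]. apply sin_gt_0; [lra|].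
  pose proof PI2_1. lra.
Qed.

Lemma dn_sqr t : dn t * dn t = 1 - s t * s t.
Proof. unfold dn. apply sqrt_sqrt. pose proof (s_bound t). nra. Qed.

Lemma dn_pos t : 0 < dn t.
Proof. unfold dn. apply sqrt_lt_R0. pose proof (s_bound t). nra. Qed.

Lemma dn_lt_1 t : 0 < t < 1 -> dn t < 1.
Proof. intros Ht. pose proof (s_pos t Ht). pose proof (dn_sqr t). pose proof (dn_pos t). nra. Qed.

Lemma dn_cos t : dn t = cos (asin (k * sin t)).
Proof.
  pose proof (s_bound t) as Hs. unfold s in Hs.
  rewrite cos_asin by lra. unfold dn, s, Rsqr. reflexivity.
Qed.

Lemma dn_factor t : dn t = sqrt (1 - s t) * sqrt (1 + s t).
Proof.
  pose proof (s_bound t). unfold dn. rewrite <- sqrt_mult by lra. f_equal. ring.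
Qed.

Lemma dn_derive t : is_derive dn t (- (s t * (k * cos t)) / dn t).
Proof.
  pose proof (dn_pos t) as P. unfold dn, s in *.
  assert (0 < 1 - k * sin t * (k * sin t)).
  { apply Rnot_le_lt. intros L. rewrite sqrt_neg_0 in P by exact L. lra. }
  auto_derive; [lra|].
  replace (1 + - (k * sin t * (k * sin t))) with (1 - k * sin t * (k * sin t)) by ring.
  field. lra.
Qed.

Let pr (t : R) : R := - (1 / 3) + k * k / (2 * (1 - dn t)).
(** The derivative of [pr] with respect to [u]: the [t]-derivative divided by [hyp_closed], which is
    the sum of the two square roots over [2 dn]. *)
Let pr1 (t : R) : R :=
  - (k * k * s t * (k * cos t)) / ((1 - dn t) * (1 - dn t) * (sqrt (1 - s t) + sqrt (1 + s t))).

Lemma pr_derive t : 0 < t < 1 -> is_derive pr t (hyp_closed (s t) * pr1 t).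
Proof.
  intros Ht. pose proof (dn_lt_1 t Ht) as L. pose proof (dn_pos t) as P.
  pose proof (dn_derive t) as D.
  assert (X : ex_derive dn t) by (eexists; exact D).
  unfold pr. auto_derive; [repeat split; trivial; lra|].
  change (Derive (fun x => dn x) t) with (Derive dn t).
  rewrite (is_derive_unique _ _ _ D).
  unfold pr1, hyp_closed. pose proof (dn_factor t) as F.
  pose proof (s_bound t) as Hs.
  assert (A : 0 < sqrt (1 - s t)) by (apply sqrt_lt_R0; lra).
  assert (B : 0 < sqrt (1 + s t)) by (apply sqrt_lt_R0; lra).
  set (a := sqrt (1 - s t)) in *. set (b := sqrt (1 + s t)) in *.
  rewrite F in *. field. repeat split; nra.
Qed.

Lemma pr_ode t : 0 < t < 1 ->
  pr1 t * pr1 t = 4 * (pr t * pr t * pr t) - (4 / 3 - k ^ 2) * pr t - (8 / 27 - k ^ 2 / 3).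
Proof.
  intros Ht. pose proof (dn_lt_1 t Ht) as L. pose proof (dn_pos t) as P.
  pose proof (dn_factor t) as F. pose proof (dn_sqr t) as Q.
  pose proof (s_bound t) as Hs.
  assert (A : 0 < sqrt (1 - s t)) by (apply sqrt_lt_R0; lra).
  assert (B : 0 < sqrt (1 + s t)) by (apply sqrt_lt_R0; lra).
  pose proof (sqrt_sqrt (1 - s t) ltac:(lra)) as A2.
  pose proof (sqrt_sqrt (1 + s t) ltac:(lra)) as B2.
  unfold pr1, pr. set (a := sqrt (1 - s t)) in *. set (b := sqrt (1 + s t)) in *.
  set (d := dn t) in *.
  (* The half-angle formula, since [a + b = 2 cos(psi/2)]. With [E2] it turns the square of [pr1]
     into a rational function of [d] alone. *)
  assert (E1 : (a + b) * (a + b) = 2 * (1 + d)) by nra.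
  assert (E2 : k * cos t * (k * cos t) = k * k - 1 + d * d).
  { rewrite Q. unfold s. pose proof (sin2_cos2 t) as T. unfold Rsqr in T. nra. }
  transitivity (k * k * (k * k) * (s t * s t) * (k * cos t * (k * cos t)) /
     ((1 - d) * (1 - d) * ((1 - d) * (1 - d)) * ((a + b) * (a + b)))).
  { field. split; lra. }
  rewrite E1, E2. replace (s t * s t) with (1 - d * d) by lra.
  field. split; lra.
Qed.

Let D (t : R) : Prop := 0 < t.

Lemma limit_of_continuous f : continuity_pt f 0 -> limit1_in f D (f 0) 0.
Proof.
  intros H e He. destruct (H e He) as [a [Ha Hx]]. exists a. split; [exact Ha|].
  intros x [Hx1 Hx2]. apply Hx. split; [|exact Hx2].
  split; [exact I|]. unfold D in Hx1. lra.
Qed.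

Lemma limit_slope f l : is_derive f 0 l -> f 0 = 0 -> limit1_in (fun t => f t / t) D l 0.
Proof.
  intros H H0 e He. apply is_derive_Reals in H. destruct (H e He) as [a Ha].
  exists a. split; [apply cond_pos|]. intros x [Hx1 Hx2]. unfold D in Hx1.
  simpl in *. unfold Rdist in *. rewrite Rminus_0_r in Hx2.
  specialize (Ha x ltac:(lra) Hx2). rewrite Rplus_0_l, H0, Rminus_0_r in Ha. exact Ha.
Qed.

Lemma s_0 : s 0 = 0. Proof. unfold s. rewrite sin_0. ring. Qed.
Lemma dn_0 : dn 0 = 1.
Proof. unfold dn. rewrite s_0. replace (1 - 0 * 0) with 1 by ring. apply sqrt_1. Qed.
Lemma hyp_closed_0 : hyp_closed (s 0) = 1.
Proof. rewrite s_0. unfold hyp_closed. rewrite Rminus_0_r, Rplus_0_r, sqrt_1. lra. Qed.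

Lemma s_derive t : is_derive s t (k * cos t).
Proof. unfold s. auto_derive; [exact I|ring]. Qed.

Lemma continuity_of_derive f t l : is_derive f t l -> continuity_pt f t.
Proof.
  intros H. apply continuity_pt_filterlim, (ex_derive_continuous (K := R_AbsRing) (V := R_NormedModule)).
  eexists; exact H.
Qed.

Lemma limit1_ext f g l : (forall t, 0 < t < 1 -> f t = g t) -> limit1_in f D l 0 -> limit1_in g D l 0.
Proof.
  intros E H e He. destruct (H e He) as [a [Ha Hx]].
  exists (Rmin a 1). split; [apply Rmin_glb_lt; lra|].
  intros x [Hx1 Hx2]. unfold D in Hx1.
  assert (X : Rdist x 0 < a /\ x < 1).
  { simpl in Hx2. split; [eapply Rlt_le_trans; [exact Hx2|apply Rmin_l]|].
    unfold Rdist in Hx2. rewrite Rminus_0_r, Rabs_pos_eq in Hx2 by lra.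
    eapply Rlt_le_trans; [exact Hx2|apply Rmin_r]. }
  rewrite <- E by lra. apply Hx. split; [exact Hx1|apply X].
Qed.

Lemma limit_ratio : limit1_in (fun t => u_of k t / s t) D (/ k) 0.
Proof.
  pose proof (limit_slope (u_of k) _ (u_of_derive 0) u_of_0) as L1.
  pose proof (limit_slope s _ (s_derive 0) s_0) as L2.
  rewrite hyp_closed_0 in L1. rewrite cos_0, Rmult_1_r in L2.
  pose proof (limit_mul _ _ _ _ _ _ L1 (limit_inv _ _ _ _ L2 ltac:(lra))) as L.
  rewrite Rmult_1_l in L. apply (limit1_ext _ _ _) with (2 := L).
  intros t Ht. pose proof (s_pos t Ht). field. lra.
Qed.

Lemma limit_dn : limit1_in dn D 1 0.
Proof. rewrite <- dn_0. apply limit_of_continuous, (continuity_of_derive _ _ _ (dn_derive 0)). Qed.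

Lemma limit_u : limit1_in (u_of k) D 0 0.
Proof.
  pose proof (limit_of_continuous (u_of k) (continuity_of_derive _ _ _ (u_of_derive 0))) as L.
  rewrite u_of_0 in L. exact L.
Qed.

Lemma limit_c c : limit1_in (fun _ => c) D c 0.
Proof. apply (limit_free (fun _ => c) D 0 0). Qed.

(** Replaces the vanishing denominator [1 - dn] by [s^2], so that both asymptotics at 0 reduce to
    the limit [1 / k] of [u / s]. *)
Lemma one_minus_dn t : 0 < t < 1 -> 1 - dn t = s t * s t / (1 + dn t).
Proof. intros Ht. pose proof (dn_sqr t). pose proof (dn_pos t). field_simplify_eq; lra. Qed.

Lemma limit_pr : limit1_in (fun t => u_of k t * u_of k t * pr t) D 1 0.
Proof.
  pose proof limit_ratio as Lr. pose proof limit_dn as Ld. pose proof limit_u as Lu.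
  pose proof (limit_plus _ _ _ _ _ _
    (limit_mul _ _ _ _ _ _ (limit_c (- (1 / 3))) (limit_mul _ _ _ _ _ _ Lu Lu))
    (limit_mul _ _ _ _ _ _ (limit_mul _ _ _ _ _ _ (limit_c (k * k / 2)) (limit_mul _ _ _ _ _ _ Lr Lr))
       (limit_plus _ _ _ _ _ _ (limit_c 1) Ld))) as L.
  cbv beta in L.
  replace (- (1 / 3) * (0 * 0) + k * k / 2 * (/ k * / k) * (1 + 1)) with 1 in L by (field; lra).
  apply (limit1_ext _ _ _) with (2 := L). intros t Ht.
  unfold pr. rewrite one_minus_dn by exact Ht.
  pose proof (s_pos t Ht). pose proof (dn_pos t). field. split; lra.
Qed.

Lemma limit_pr1 : limit1_in (fun t => u_of k t * u_of k t * u_of k t * pr1 t) D (- 2) 0.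
Proof.
  pose proof limit_ratio as Lr. pose proof limit_dn as Ld.
  assert (Lc : limit1_in (fun t => k * cos t) D k 0).
  { pose proof (limit_of_continuous (fun t => k * cos t)) as L.
    cbv beta in L. rewrite cos_0, Rmult_1_r in L. apply L.
    apply (continuity_of_derive _ _ (k * - sin 0)). auto_derive; [exact I|ring]. }
  assert (Ls : limit1_in (fun t => sqrt (1 - s t) + sqrt (1 + s t)) D 2 0).
  { pose proof (limit_of_continuous (fun t => sqrt (1 - s t) + sqrt (1 + s t))) as L.
    cbv beta in L. rewrite s_0, Rminus_0_r, Rplus_0_r, sqrt_1 in L.
    replace (1 + 1) with 2 in L by ring. apply L.
    apply continuity_pt_filterlim, (ex_derive_continuous (K := R_AbsRing) (V := R_NormedModule)
      (fun t => sqrt (1 - s t) + sqrt (1 + s t))).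
    unfold s. auto_derive. rewrite sin_0. repeat split; lra. }
  pose proof (limit_plus _ _ _ _ _ _ (limit_c 1) Ld) as L1.
  pose proof (limit_mul _ _ _ _ _ _
    (limit_mul _ _ _ _ _ _ (limit_mul _ _ _ _ _ _ (limit_c (- (k * k))) Lc)
      (limit_mul _ _ _ _ _ _ Lr (limit_mul _ _ _ _ _ _ Lr Lr)))
    (limit_mul _ _ _ _ _ _ (limit_mul _ _ _ _ _ _ L1 L1)
       (limit_inv _ _ _ _ Ls ltac:(lra)))) as L.
  cbv beta in L.
  replace (- (k * k) * k * (/ k * (/ k * / k)) * ((1 + 1) * (1 + 1) * / 2)) with (-2) in L
    by (field; lra).
  apply (limit1_ext _ _ _) with (2 := L). intros t Ht.
  unfold pr1. rewrite one_minus_dn by exact Ht.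
  pose proof (s_pos t Ht). pose proof (dn_pos t). pose proof (s_bound t).
  assert (0 < sqrt (1 - s t)) by (apply sqrt_lt_R0; lra).
  assert (0 < sqrt (1 + s t)) by (apply sqrt_lt_R0; lra).
  field. repeat split; lra.
Qed.

Lemma explicit_pole_branch : pole_branch (4 / 3 - k ^ 2) (8 / 27 - k ^ 2 / 3)
  (u_of k) (fun t => hyp_closed (s t)) (fun t => RtoC (pr t)) (fun t => RtoC (pr1 t)) 1.
Proof.
  split.
  - intros t Ht. split.
    + rewrite <- RtoC_mult. split; simpl.
      * exact (pr_derive t Ht).
      * apply (is_derive_const (K := R_AbsRing) (V := R_NormedModule) 0).
    + unfold wcubic. rewrite <- !RtoC_mult, <- !RtoC_minus. f_equal. apply pr_ode, Ht.
  - intros e He. destruct (limit_pr e He) as [a [Ha Ka]]. destruct (limit_pr1 e He) as [b [Hb Kb]].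
    exists (Rmin a b). split; [apply Rmin_glb_lt; assumption|]. intros t Ht.
    assert (X : t < a /\ t < b) by (unfold Rmin in Ht; destruct Rle_dec; lra).
    assert (Dt : Rdist t 0 = t) by (unfold Rdist; rewrite Rminus_0_r, Rabs_pos_eq; lra).
    specialize (Ka t). specialize (Kb t). simpl in Ka, Kb. rewrite Dt in Ka, Kb. unfold D, Rdist in *.
    specialize (Ka ltac:(lra)). specialize (Kb ltac:(lra)).
    rewrite <- !RtoC_mult, <- RtoC_minus, <- RtoC_plus, !Cmod_R. split; [exact Ka|].
    replace (u_of k t * u_of k t * u_of k t * pr1 t + 2)
      with (u_of k t * u_of k t * u_of k t * pr1 t - - 2) by ring. exact Kb.
Qed.
End Branch.

(** * Symmetries of the Weierstrass function *)

Lemma Rder_path F (g : R -> C) v t l : (forall x, g x = (g t + RtoC (x - t) * v)%C) ->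
  Cis_derive F (g t) l -> Rder (fun x => F (g x)) t (l * v)%C.
Proof.
  intros Hg HF.
  assert (K : forall e, 0 < e -> exists d : posreal, forall h, h <> 0 -> Rabs h < d ->
    Cmod ((F (g (t + h)%R) - F (g t)) / RtoC h - l * v) < e).
  { intros e He. pose proof (Cmod_ge_0 v) as Hv.
    destruct (proj1 (Cis_derive_eps F (g t) l) HF (e / (Cmod v + 1))) as [d [Hd Hw]].
    { apply Rdiv_lt_0_compat; lra. }
    assert (Hd' : 0 < d / (Cmod v + 1)) by (apply Rdiv_lt_0_compat; lra).
    exists (mkposreal _ Hd'). simpl. intros h Hh0 Hh.
    assert (Nh : RtoC h <> RtoC 0) by (intros E; apply RtoC_inj in E; auto).
    assert (Eh : (g (t + h)%R - g t = RtoC h * v)%C).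
    { rewrite (Hg (t + h)%R). replace (t + h - t) with h by ring. ring. }
    specialize (Hw (g (t + h)%R)). rewrite Eh, Cmod_mult, Cmod_R in Hw.
    assert (Hp : 0 < Rabs h) by (apply Rabs_pos_lt; exact Hh0).
    assert (Hlt : Rabs h * (Cmod v + 1) < d).
    { apply (Rmult_lt_compat_r (Cmod v + 1)) in Hh; [|lra].
      replace (d / (Cmod v + 1) * (Cmod v + 1)) with d in Hh by (field; lra). exact Hh. }
    specialize (Hw ltac:(nra)).
    replace ((F (g (t + h)%R) - F (g t)) / RtoC h - l * v)%C
      with ((F (g (t + h)%R) - F (g t) - l * (RtoC h * v)) / RtoC h)%C by (field; exact Nh).
    rewrite Cmod_div, Cmod_R by exact Nh. apply Rlt_div_l; [exact Hp|].
    eapply Rle_lt_trans; [exact Hw|].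
    assert (e / (Cmod v + 1) * Cmod v < e).
    { apply Rmult_lt_reg_r with (Cmod v + 1); [lra|].
      replace (e / (Cmod v + 1) * Cmod v * (Cmod v + 1)) with (e * Cmod v) by (field; lra). nra. }
    nra. }
  split; apply is_derive_Reals; intros e He; destruct (K e He) as [d Hd]; exists d;
  intros h Hh0 Hh; specialize (Hd h Hh0 Hh); (eapply Rle_lt_trans; [|exact Hd]).
  - eapply Rle_trans; [|apply fst_le_Cmod]. right. f_equal. simpl. field. exact Hh0.
  - eapply Rle_trans; [|apply snd_le_Cmod]. right. f_equal. simpl. field. exact Hh0.
Qed.

Lemma wcubic_conj g2 g3 y : Cconj (wcubic g2 g3 y) = wcubic g2 g3 (Cconj y).
Proof.
  unfold wcubic. rewrite !Cminus_conj, !Cmult_conj.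
  assert (E : forall x, Cconj (RtoC x) = RtoC x).
  { intros x. unfold Cconj, RtoC; simpl. f_equal; ring. }
  rewrite !E. reflexivity.
Qed.

(** The sign [sg] chooses the right or the left ray. Both give the same kind of branch, as the pole
    is even to leading order and [sg] also enters the derivative. *)
Lemma ray_branch P g2 g3 s n sg : is_weierstrass P g2 g3 -> pole_of_order P s n -> sg * sg = 1 ->
  exists d, 0 < d /\ pole_branch g2 g3 (fun t => t) (fun _ => 1)
    (fun t => P (s + RtoC (sg * t))%C) (fun t => RtoC sg * C_derive P (s + RtoC (sg * t)))%C d.
Proof.
  intros HP Hs Hsg. destruct (pole_asymptotics P g2 g3 s n HP Hs) as (r & Hr & Hh & HA).
  assert (Ha : Rabs sg = 1).
  { pose proof (Rabs_pos sg). pose proof (Rabs_mult sg sg) as E. rewrite Hsg, Rabs_R1 in E. nra. }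
  assert (Hm : forall t, 0 < t -> Cmod (s + RtoC (sg * t) - s) = t).
  { intros t Ht. replace (s + RtoC (sg * t) - s)%C with (RtoC (sg * t)) by ring.
    rewrite Cmod_R, Rabs_mult, Ha, Rabs_pos_eq; lra. }
  exists r. split; [exact Hr|]. split.
  - intros t Ht. specialize (Hh (s + RtoC (sg * t))%C). rewrite Hm in Hh by lra.
    destruct (weierstrass_ode P g2 g3 _ HP (Hh Ht)) as [D E]. split.
    + rewrite Cmult_1_l, Cmult_comm.
      apply (Rder_path P (fun t => (s + RtoC (sg * t))%C) (RtoC sg)); [|exact D].
      intros x. rewrite !RtoC_mult, RtoC_minus. ring.
    + rewrite <- E.
      transitivity (RtoC (sg * sg) * (C_derive P (s + RtoC (sg * t)) * C_derive P (s + RtoC (sg * t))))%C.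
      * rewrite (RtoC_mult sg sg). ring.
      * rewrite Hsg. ring.
  - intros e He. destruct (HA e He) as [d [Hd Kd]]. exists d. split; [exact Hd|].
    intros t Ht. specialize (Kd (s + RtoC (sg * t))%C). rewrite Hm in Kd by lra.
    destruct (Kd Ht) as [K1 K2].
    replace (s + RtoC (sg * t) - s)%C with (RtoC (sg * t)) in K1, K2 by ring.
    rewrite <- !RtoC_mult in K1. rewrite <- !RtoC_mult in K2. split.
    + replace (t * t) with (sg * t * (sg * t)); [exact K1|]. 
      transitivity ((sg * sg) * (t * t)); [ring|rewrite Hsg; ring].
    + rewrite Cmult_assoc, <- RtoC_mult.
      replace (t * t * t * sg) with (sg * t * (sg * t) * (sg * t)); [exact K2|].
      transitivity ((sg * sg) * (t * t * t * sg)); [ring|rewrite Hsg; ring].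
Qed.

Lemma conj_branch g2 g3 u u' p p1 d : pole_branch g2 g3 u u' p p1 d ->
  pole_branch g2 g3 u u' (fun t => Cconj (p t)) (fun t => Cconj (p1 t)) d.
Proof.
  assert (E : forall x, Cconj (RtoC x) = RtoC x).
  { intros x. unfold Cconj, RtoC; simpl. f_equal; ring. }
  intros [H L]. split.
  - intros t Ht. destruct (H t Ht) as [[D1 D2] O]. split.
    + split; simpl; simpl in D1, D2.
      * replace (u' t * fst (p1 t) - 0 * - snd (p1 t))
          with (u' t * fst (p1 t) - 0 * snd (p1 t)) by ring. exact D1.
      * replace (u' t * - snd (p1 t) + 0 * fst (p1 t))
          with (- (u' t * snd (p1 t) + 0 * fst (p1 t))) by ring.
        apply (is_derive_opp (V := R_NormedModule)), D2.
    + rewrite <- Cmult_conj, O. apply wcubic_conj.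
  - intros e He. destruct (L e He) as [d' [Hd' K]]. exists d'. split; [exact Hd'|].
    intros t Ht. destruct (K t Ht) as [K1 K2].
    rewrite <- (E (u t * u t)), <- (E (u t * u t * u t)), <- (E 1), <- (E 2).
    rewrite <- !Cmult_conj, <- Cminus_conj, <- Cplus_conj, !Cmod_conj. split; assumption.
Qed.

Lemma id_parameter d : (forall t : R, 0 < t < d -> is_derive (fun x : R => x) t 1 /\ 0 < 1 /\ 0 < t) /\
  (forall e, 0 < e -> exists d', 0 < d' /\ forall t : R, 0 < t < d' -> t < e).
Proof.
  split.
  - intros t Ht. split; [apply (is_derive_id (K := R_AbsRing))|lra].
  - intros e He. exists e. split; [exact He|intros; lra].
Qed.

Lemma pole_branch_shrink g2 g3 u u' p p1 d d' : d' <= d ->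
  pole_branch g2 g3 u u' p p1 d -> pole_branch g2 g3 u u' p p1 d'.
Proof. intros Hd [H L]. split; [intros t Ht; apply H; lra|exact L]. Qed.

Lemma branches_agree g2 g3 p q p1 q1 d d' : 0 < d -> 0 < d' ->
  pole_branch g2 g3 (fun t => t) (fun _ => 1) p p1 d ->
  pole_branch g2 g3 (fun t => t) (fun _ => 1) q q1 d' ->
  exists d'', 0 < d'' /\ forall t, 0 < t < d'' -> p t = q t.
Proof.
  intros Hd Hd' Hp Hq.
  pose proof (Rmin_l d d'). pose proof (Rmin_r d d').
  destruct (id_parameter (Rmin d d')) as [I1 I2].
  apply (pole_branch_unique g2 g3 (fun t => t) (fun _ => 1) p q p1 q1 (Rmin d d')); trivial.
  - apply Rmin_glb_lt; assumption.
  - apply (pole_branch_shrink _ _ _ _ _ _ d); assumption.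
  - apply (pole_branch_shrink _ _ _ _ _ _ d'); assumption.
Qed.

Lemma C_sub_self (z : C) : (z - z)%C = RtoC 0.
Proof. ring. Qed.

Section Weierstrass.
Variables (P : C -> C) (g2 g3 : R).
Hypothesis HP : is_weierstrass P g2 g3.

Lemma weierstrass_polar z : polar_at P z.
Proof. apply meromorphic_polar, HP. Qed.

Lemma agree_at_regular f z r : 0 < r -> holo_near P z -> Ccont f z ->
  (forall w, 0 < Cmod (w - z) < r -> P w = f w) -> P z = f z.
Proof.
  intros Hr Hz Hf E. apply (punctured_limit P f z r); trivial.
  apply Diff_cont, holo_near_Diff, Hz.
Qed.

(** The right and left rays at 0 carry two branches with the same leading term, so they coincide
    near 0; [identity_polar] spreads this. *)
Lemma weierstrass_even z : punctured_zero (fun w => P w - P (- w))%C z.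
Proof.
  destruct HP as (_ & H0 & _).
  destruct (ray_branch P g2 g3 (RtoC 0) 2 1 HP H0 ltac:(ring)) as [d1 [Hd1 B1]].
  destruct (ray_branch P g2 g3 (RtoC 0) 2 (-1) HP H0 ltac:(ring)) as [d2 [Hd2 B2]].
  destruct (branches_agree _ _ _ _ _ _ _ _ Hd1 Hd2 B1 B2) as [d [Hd E]].
  apply (identity_polar _ (RtoC 0)).
  - intros w. apply polar_minus; [apply weierstrass_polar|].
    destruct (polar_affine P (RtoC (-1)) (RtoC 0) w) as (r & g & n & Hr & Hg & En).
    + rewrite Cmod_R. unfold Rabs. destruct Rcase_abs; lra.
    + apply weierstrass_polar.
    + exists r, g, n. split; [exact Hr|split; [exact Hg|]]. intros v Hv. rewrite <- En by exact Hv.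
      do 2 f_equal. change (-1) with (- (1)). rewrite RtoC_opp. ring.
  - exists d. split; [exact Hd|]. intros x Hx. specialize (E x Hx). cbv beta in E.
    rewrite Rmult_1_l in E. rewrite E.
    replace (- (RtoC 0 + RtoC x))%C with (RtoC 0 + RtoC (-1 * x))%C; [ring|].
    rewrite RtoC_mult. change (-1) with (- (1)). rewrite RtoC_opp. ring.
Qed.

Lemma weierstrass_conj z : punctured_zero (fun w => P w - Cconj (P (Cconj w)))%C z.
Proof.
  destruct HP as (_ & H0 & _).
  destruct (ray_branch P g2 g3 (RtoC 0) 2 1 HP H0 ltac:(ring)) as [d1 [Hd1 B1]].
  destruct (branches_agree _ _ _ _ _ _ _ _ Hd1 Hd1 B1 (conj_branch _ _ _ _ _ _ _ B1)) as [d [Hd E]].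
  apply (identity_polar _ (RtoC 0)).
  - intros w. apply polar_minus; [apply weierstrass_polar|].
    apply polar_conj, weierstrass_polar.
  - exists d. split; [exact Hd|]. intros x Hx. specialize (E x Hx). cbv beta in E.
    rewrite Rmult_1_l in E.
    replace (Cconj (RtoC 0 + RtoC x)) with (RtoC 0 + RtoC x)%C.
    + rewrite <- E. ring.
    + unfold Cconj, Cplus, RtoC; simpl. f_equal; ring.
Qed.

(** The branches on the right rays at 0 and at [s] coincide, so [P w = P (w + s)] off isolated
    points. [meromorphic_removable] then transports both regularity and value to [z + s]. *)
Lemma pole_is_period s n : pole_of_order P s n -> is_period P s.
Proof.
  intros Hs. pose proof HP as (HM & H0 & _).
  destruct (ray_branch P g2 g3 (RtoC 0) 2 1 HP H0 ltac:(ring)) as [d1 [Hd1 B1]].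
  destruct (ray_branch P g2 g3 s n 1 HP Hs ltac:(ring)) as [d2 [Hd2 B2]].
  destruct (branches_agree _ _ _ _ _ _ _ _ Hd1 Hd2 B1 B2) as [d [Hd E]].
  assert (Z : forall z, punctured_zero (fun w => P w - P (w + s))%C z).
  { intros z. apply (identity_polar _ (RtoC 0)).
    - intros w. apply polar_minus; [apply weierstrass_polar|].
      destruct (polar_affine P (RtoC 1) s w) as (r & g & k & Hr & Hg & En).
      + apply Cmod_1.
      + apply weierstrass_polar.
      + exists r, g, k. split; [exact Hr|split; [exact Hg|]]. intros v Hv. rewrite <- En by exact Hv.
        do 2 f_equal. ring.
    - exists d. split; [exact Hd|]. intros x Hx. specialize (E x Hx). cbv beta in E.
      rewrite Rmult_1_l in E. rewrite E.
      replace (RtoC 0 + RtoC x + s)%C with (s + RtoC x)%C by ring. ring. }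
  intros z Hz. destruct (Z z) as [r [Hr Hw]].
  assert (Es : forall w, (w - (z + s) = (w - s) - z)%C) by (intros; ring).
  destruct (meromorphic_removable P (fun w => P (w - s)%C) (z + s)%C r HM) as [K1 K2]; trivial.
  - destruct Hz as [r' [Hr' Hd']]. exists r'. split; [exact Hr'|]. intros w Hwr.
    rewrite Es in Hwr. apply (Diff_comp P (fun w => (w - s)%C)); [apply Hd', Hwr|diff_tac].
  - intros w Hwr. rewrite Es in Hwr. specialize (Hw _ Hwr). cbv beta in Hw.
    apply C_eq_sub in Hw. rewrite Hw. f_equal. ring.
  - split; [exact K1|]. rewrite K2. f_equal. ring.
Qed.

Lemma symmetric_derivative c r : 0 < r -> holo_near P c ->
  (forall w, Cmod (w - c) < r -> P w = P (c + c - w)%C) -> C_derive P c = RtoC 0.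
Proof.
  intros Hr Hc E. pose proof (proj1 (weierstrass_ode P g2 g3 c HP Hc)) as D.
  pose proof (Cis_derive_minus _ _ c _ _ (Cis_derive_const (c + c)%C c) (Cis_derive_id c)) as D2.
  assert (D3 : Cis_derive (fun w => P (c + c - w)%C) c ((RtoC 0 - RtoC 1) * C_derive P c)%C).
  { apply (Cis_derive_comp P (fun w => (c + c - w)%C)); [|exact D2].
    replace (c + c - c)%C with c by ring. exact D. }
  assert (D4 : Cis_derive (fun w => P (c + c - w)%C) c (C_derive P c))
    by (apply (Cis_derive_ext_near P _ c _ r Hr E D)).
  pose proof (Cis_derive_unique _ _ _ _ D3 D4) as K.
  assert (K2 : (RtoC 2 * C_derive P c)%C = RtoC 0).
  { transitivity (C_derive P c - (RtoC 0 - RtoC 1) * C_derive P c)%C.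
    - replace (RtoC 2) with (RtoC 1 + RtoC 1)%C by (rewrite <- RtoC_plus; f_equal; ring). ring.
    - rewrite K. apply C_sub_self. }
  apply NNPP. intros N. apply (Cmult_neq_0 (RtoC 2)) in N; [exact (N K2)|].
  intros E2. apply RtoC_inj in E2. lra.
Qed.
End Weierstrass.

(** * The algebraic relation between [d] and [P] *)

Lemma amplitude_relation k d P : 0 < k < 1 -> meromorphic d ->
  (exists delta, 0 < delta /\ forall phi, Rabs phi < delta ->
       d (RtoC (u_of k phi)) = RtoC (cos (asin (k * sin phi)))) ->
  is_weierstrass P (4 / 3 - k ^ 2) (8 / 27 - k ^ 2 / 3) ->
  forall z, punctured_zero (fun w => (P w + RtoC (1 / 3)) * (RtoC 1 - d w) - RtoC (k ^ 2 / 2))%C z.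
Proof.
  intros Hk Hd [delta [Hdelta Hcos]] HP z. pose proof HP as (HM & H0 & _).
  pose proof (explicit_pole_branch k Hk) as BQ. cbv zeta beta in BQ.
  destruct (pole_asymptotics P _ _ (RtoC 0) 2 HP H0) as (r & Hr & Hh & HA).
  pose proof (continuity_of_derive _ _ _ (u_of_derive k Hk 0)) as C0.
  assert (Hu0 : forall e, 0 < e -> exists d', 0 < d' /\ forall t, 0 < t < d' -> u_of k t < e).
  { intros e He. destruct (C0 e He) as [a [Ha Ka]]. exists a. split; [exact Ha|]. intros t Ht.
    specialize (Ka t). simpl in Ka. unfold Rdist in Ka. rewrite u_of_0, !Rminus_0_r in Ka.
    rewrite (Rabs_pos_eq t) in Ka by lra.
    eapply Rle_lt_trans; [apply Rle_abs|]. apply Ka. split; [split; [exact I|lra]|lra]. }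
  assert (Hm : forall t, 0 < t -> Cmod (RtoC (u_of k t) - RtoC 0) = u_of k t).
  { intros t Ht. rewrite <- RtoC_minus, Rminus_0_r, Cmod_R, Rabs_pos_eq; trivial.
    left. apply u_of_pos; assumption. }
  destruct (Hu0 r Hr) as [d1 [Hd1 Kd1]].
  set (D := Rmin 1 d1).
  assert (HD : 0 < D /\ D <= 1 /\ D <= d1) by (unfold D, Rmin; destruct Rle_dec; lra).
  (* Composed with [u_of k], the function [P] becomes a branch in the parameter phi, with the same
     [u] and [u'] as the explicit one, so the two can be compared. *)
  assert (BP : pole_branch (4 / 3 - k ^ 2) (8 / 27 - k ^ 2 / 3) (u_of k)
    (fun t => hyp_closed (k * sin t)) (fun t => P (RtoC (u_of k t)))
    (fun t => C_derive P (RtoC (u_of k t))) D).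
  { split.
    - intros t Ht.
      assert (Hin : 0 < Cmod (RtoC (u_of k t) - RtoC 0) < r).
      { rewrite Hm by lra. split; [apply u_of_pos; [exact Hk|lra]|apply Kd1; lra]. }
      destruct (weierstrass_ode P _ _ _ HP (Hh _ Hin)) as [DP O].
      split; [|exact O].
      pose proof (u_of_derive k Hk t) as Du.
      destruct (Rder_path P RtoC (RtoC 1) (u_of k t) (C_derive P (RtoC (u_of k t)))) as [R1 R2]; trivial.
      { intros x. rewrite RtoC_minus. ring. }
      rewrite Cmult_1_r in R1, R2. split.
      + pose proof (is_derive_comp (V := R_NormedModule) (fun x => fst (P (RtoC x))) (u_of k) t _ _ R1 Du) as R.
        simpl. unfold scal in R; simpl in R; unfold mult in R; simpl in R.
        rewrite Rmult_0_l, Rminus_0_r. exact R.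
      + pose proof (is_derive_comp (V := R_NormedModule) (fun x => snd (P (RtoC x))) (u_of k) t _ _ R2 Du) as R.
        simpl. unfold scal in R; simpl in R; unfold mult in R; simpl in R.
        rewrite Rmult_0_l, Rplus_0_r. exact R.
    - intros e He. destruct (HA e He) as [a [Ha Ka]]. destruct (Hu0 a Ha) as [d2 [Hd2 Kd2]].
      exists d2. split; [exact Hd2|]. intros t Ht.
      specialize (Ka (RtoC (u_of k t))). rewrite Hm in Ka by lra.
      destruct Ka as [K1 K2]; [split; [apply u_of_pos; [exact Hk|lra]|apply Kd2; lra]|].
      replace (RtoC (u_of k t) - RtoC 0)%C with (RtoC (u_of k t)) in K1, K2 by ring.
      rewrite !RtoC_mult. split; assumption. }
  assert (HU : forall t, 0 < t < D ->
    is_derive (u_of k) t (hyp_closed (k * sin t)) /\ 0 < hyp_closed (k * sin t) /\ 0 < u_of k t).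
  { intros t Ht. split; [apply (u_of_derive k Hk)|].
    split; [apply (hyp_closed_pos k Hk)|apply (u_of_pos k Hk); lra]. }
  destruct (pole_branch_unique _ _ _ _ _ _ _ _ D (proj1 HD) HU Hu0 BP
    (pole_branch_shrink _ _ _ _ _ _ _ _ (proj1 (proj2 HD)) BQ)) as [d3 [Hd3 E]].
  apply (identity_polar _ (RtoC 0)).
  - intros w. apply polar_minus; [|apply polar_const]. apply polar_mult.
    + apply polar_plus; [apply meromorphic_polar, HM|apply polar_const].
    + apply polar_minus; [apply polar_const|apply meromorphic_polar, Hd].
  - set (T := Rmin (Rmin 1 d3) delta / 2).
    assert (HT : 0 < T /\ T < 1 /\ T < d3 /\ T < delta).
    { unfold T, Rmin. repeat destruct Rle_dec; lra. }
    exists (u_of k T). split; [apply u_of_pos; [exact Hk|lra]|]. intros x Hx.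
    (* Every small positive [x] is a value of [u_of k], so agreement in phi becomes agreement on a
       whole segment in [u]. *)
    destruct (IVT_gen (u_of k) 0 T x) as [t [Ht Et]].
    + intros y. apply (continuity_of_derive _ _ _ (u_of_derive k Hk y)).
    + rewrite u_of_0, Rmin_left, Rmax_right by lra. lra.
    + rewrite Rmin_left, Rmax_right in Ht by lra.
      assert (Ht0 : 0 < t).
      { destruct Ht as [[L|L] _]; [exact L|]. rewrite <- L, u_of_0 in Et. lra. }
      replace (RtoC 0 + RtoC x)%C with (RtoC (u_of k t)) by (rewrite Et; ring).
      specialize (E t ltac:(lra)). cbv beta in E. rewrite E.
      rewrite Hcos by (rewrite Rabs_pos_eq; lra).
      rewrite <- (dn_cos k Hk). pose proof (dn_lt_1 k Hk t ltac:(lra)) as L1.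
      rewrite <- !RtoC_plus, <- !RtoC_minus, <- RtoC_mult, <- RtoC_minus. f_equal.
      cbv zeta beta in L1. field. lra.
Qed.

(** * Signs of the cubic and simple zeros of [d] *)

Definition rcubic (k y : R) : R :=
  4 * (y * y * y) - (4 / 3 - k ^ 2) * y - (8 / 27 - k ^ 2 / 3).

Lemma rcubic_factor k y :
  rcubic k y = 4 * (y + 1 / 3) * ((y + 1 / 3) * (y + 1 / 3) - (y + 1 / 3) + k ^ 2 / 4).
Proof. unfold rcubic. field. Qed.

Lemma wcubic_real k y : wcubic (4 / 3 - k ^ 2) (8 / 27 - k ^ 2 / 3) (RtoC y) = RtoC (rcubic k y).
Proof. unfold wcubic, rcubic. rewrite <- !RtoC_mult, <- !RtoC_minus. reflexivity. Qed.

Definition mid (k : R) : R := k ^ 2 / 2 - 1 / 3.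

Lemma square_lt_1 k : 0 < k < 1 -> 0 < k ^ 2 < 1.
Proof.
  intros [H0 H1]. replace (k ^ 2) with (k * k) by ring.
  pose proof (Rmult_lt_compat_l k k 1 H0 H1). split; nra.
Qed.

Lemma rcubic_mid k : 0 < k < 1 -> rcubic k (mid k) < 0.
Proof.
  intros Hk. rewrite rcubic_factor. unfold mid.
  replace (k ^ 2 / 2 - 1 / 3 + 1 / 3) with (k ^ 2 / 2) by field.
  pose proof (square_lt_1 k Hk). set (q := k ^ 2) in *.
  assert (0 < q * q) by nra. assert (q * q < q) by nra. nra.
Qed.

(** A root above [mid k] is the largest one, [-1/3 + (1 + sqrt(1 - k^2)) / 2]. No square root is
    taken: [X (1 - X) = q / 4] with [X > q / 2] forces [X > 1/2], beyond which [Y^2 - Y + q / 4]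
    increases. *)
Lemma rcubic_above k e y : 0 < k < 1 -> mid k < e -> rcubic k e = 0 -> e < y -> 0 < rcubic k y.
Proof.
  intros Hk He E Hy. rewrite rcubic_factor in *. unfold mid in He.
  pose proof (square_lt_1 k Hk) as Hq.
  set (q := k ^ 2) in *. set (X := e + 1 / 3) in *. set (Y := y + 1 / 3) in *.
  assert (HX : q / 2 < X) by (unfold X; lra). assert (HY : X < Y) by (unfold X, Y; lra).
  assert (E1 : X * X - X + q / 4 = 0).
  { apply (Rmult_eq_reg_l (4 * X)); [lra|apply Rgt_not_eq; lra]. }
  assert (1 < 2 * X).
  { assert (X * (1 - X) = q / 4) by lra. nra. }
  assert (0 < Y * Y - Y + q / 4) by nra.
  apply Rmult_lt_0_compat; lra.
Qed.

Lemma rcubic_root_unique k e y : 0 < k < 1 -> mid k < e -> rcubic k e = 0 ->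
  mid k < y -> rcubic k y = 0 -> y = e.
Proof.
  intros Hk He E Hy E'. destruct (Rtotal_order y e) as [L|[L|L]]; trivial.
  - pose proof (rcubic_above k y e Hk Hy E' L). lra.
  - pose proof (rcubic_above k e y Hk He E L). lra.
Qed.

(** Near [z] one has [d = 1 - (k^2/2) / (P + 1/3)], and the denominator is [k^2/2] at [z]. The
    derivative of [d] there is a nonzero multiple of [P'], whose square is
    [rcubic k (mid k) < 0]. *)
Lemma simple_zero_of_mid k d P z : 0 < k < 1 -> meromorphic d ->
  is_weierstrass P (4 / 3 - k ^ 2) (8 / 27 - k ^ 2 / 3) ->
  punctured_zero (fun w => (P w + RtoC (1 / 3)) * (RtoC 1 - d w) - RtoC (k ^ 2 / 2))%C z ->
  holo_near P z -> P z = RtoC (mid k) -> simple_zero d z.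
Proof.
  intros Hk Hd HP [r [Hr Hw]] Hz Ez.
  assert (Hk2 : 0 < k ^ 2) by (apply pow_lt; lra).
  set (Q := fun w => (P w + RtoC (1 / 3))%C).
  assert (EQ : Q z = RtoC (k ^ 2 / 2)).
  { unfold Q. rewrite Ez, <- RtoC_plus. f_equal. unfold mid. field. }
  assert (Nc : RtoC (k ^ 2 / 2) <> RtoC 0) by (intros E; apply RtoC_inj in E; lra).
  destruct Hz as [r1 [Hr1 HD]].
  assert (DQ : forall w, Cmod (w - z) < r1 -> Diff Q w).
  { intros w Hwr. exact (Diff_plus P _ w (HD w Hwr) (Diff_const (RtoC (1 / 3)) w)). }
  assert (Hzz : Cmod (z - z) < r1) by (rewrite Cmod_self; exact Hr1).
  destruct (Ccont_neq Q z (Diff_cont Q z (DQ z Hzz))) as [r2 [Hr2 NQ]]; [rewrite EQ; exact Nc|].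
  assert (NQ' : forall w, Cmod (w - z) < r2 -> Q w <> RtoC 0).
  { intros w Hwr. apply Cmod_gt_0. specialize (NQ w Hwr). pose proof (Cmod_ge_0 (Q z)). lra. }
  set (g := fun w => (RtoC 1 - RtoC (k ^ 2 / 2) * / Q w)%C).
  assert (Eg : forall w, 0 < Cmod (w - z) < Rmin r r2 -> d w = g w).
  { intros w Hwr. pose proof (Rmin_l r r2). pose proof (Rmin_r r r2).
    specialize (Hw w ltac:(lra)). specialize (NQ' w ltac:(lra)). fold (Q w) in Hw.
    cbv beta in Hw. apply C_eq_sub in Hw. unfold g. rewrite <- Hw. field. exact NQ'. }
  assert (Hg : holo_near g z).
  { exists (Rmin r1 r2). split; [apply Rmin_glb_lt; assumption|]. intros w Hwr.
    assert (X : Cmod (w - z) < r1 /\ Cmod (w - z) < r2)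
      by (unfold Rmin in Hwr; destruct Rle_dec; lra).
    exact (Diff_minus _ _ w (Diff_const (RtoC 1) w) (Diff_mult _ _ w (Diff_const (RtoC (k ^ 2 / 2)) w)
      (Diff_inv Q w (NQ' w (proj2 X)) (DQ w (proj1 X))))). }
  destruct (meromorphic_removable d g z (Rmin r r2) Hd Hg) as [K1 K2]; trivial.
  { apply Rmin_glb_lt; assumption. }
  assert (Hzn : holo_near P z) by (exists r1; split; assumption).
  destruct (weierstrass_ode P _ _ z HP Hzn) as [DP O].
  rewrite Ez, wcubic_real in O.
  assert (NP : C_derive P z <> RtoC 0).
  { intros E. rewrite E in O. replace (RtoC 0 * RtoC 0)%C with (RtoC 0) in O by ring.
    apply RtoC_inj in O. pose proof (rcubic_mid k Hk). lra. }
  split; [exact K1|]. split.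
  - rewrite K2. unfold g. rewrite EQ. rewrite Cinv_r by exact Nc. apply C_sub_self.
  - pose proof (Cis_derive_plus _ _ z _ _ DP (Cis_derive_const (RtoC (1 / 3)) z)) as D1.
    fold Q in D1.
    pose proof (Cis_derive_inv Q z _ (NQ' z ltac:(rewrite Cmod_self; exact Hr2)) D1) as D2.
    pose proof (Cis_derive_minus _ _ z _ _ (Cis_derive_const (RtoC 1) z)
      (Cis_derive_mult _ _ z _ _ (Cis_derive_const (RtoC (k ^ 2 / 2)) z) D2)) as D3.
    cbv beta in D3. fold g in D3.
    eexists. split.
    + apply (Cis_derive_ext_near g d z _ (Rmin r r2)); [apply Rmin_glb_lt; assumption| |exact D3].
      intros w Hwr. destruct (Req_dec (Cmod (w - z)) 0) as [E|E].
      * apply Cmod_eq_0, C_eq_sub in E. subst w. symmetry. exact K2.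
      * symmetry. apply Eg. pose proof (Cmod_ge_0 (w - z)). lra.
    + rewrite EQ. intros E. apply NP.
      transitivity (RtoC (k ^ 2 / 2) * (RtoC 0 - (RtoC 0 * / RtoC (k ^ 2 / 2) + RtoC (k ^ 2 / 2) *
        (- (C_derive P z + RtoC 0) / (RtoC (k ^ 2 / 2) * RtoC (k ^ 2 / 2))))))%C.
      * field. exact Nc.
      * rewrite E. ring.
Qed.

(** * The period rectangle *)

Section Rectangle.
Variables (k : R) (P : C -> C) (om om' : R).
Hypothesis Hk : 0 < k < 1.
Hypothesis HP : is_weierstrass P (4 / 3 - k ^ 2) (8 / 27 - k ^ 2 / 3).
Hypothesis Hom : 0 < om.
Hypothesis Hom' : 0 < om'.
Hypothesis Hlat : forall p : C, is_period P p <->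
  exists m n : Z, p = (2 * IZR m * om, 2 * IZR n * om').

(** A pole would be a period, hence a lattice point, and those have real part in [2 omega Z]. *)
Lemma strip_holo x y : 0 < Rabs x < 2 * om -> holo_near P (x, y).
Proof.
  intros Hx. destruct HP as (HM & _).
  destruct (HM (x, y)) as [H|[n H]]; [exact H|exfalso].
  apply (pole_is_period P _ _ HP) in H. apply Hlat in H. destruct H as (m & n' & E).
  injection E; intros _ E1. subst x.
  destruct (Z.eq_dec m 0) as [->|Nm].
  - rewrite Rmult_0_r, Rmult_0_l, Rabs_R0 in Hx. lra.
  - assert (1 <= Rabs (IZR m)).
    { rewrite <- abs_IZR. apply IZR_le. lia. }
    rewrite !Rabs_mult, (Rabs_pos_eq 2), (Rabs_pos_eq om) in Hx by lra. nra.
Qed.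

Lemma strip_even x y : 0 < Rabs x < 2 * om -> P (x, y) = P (- x, - y).
Proof.
  intros Hx. destruct (weierstrass_even P _ _ HP (x, y)) as [r [Hr E]].
  apply (agree_at_regular P (fun w => P (- w)%C) (x, y) r Hr (strip_holo x y Hx)).
  - apply Diff_cont. apply (Diff_comp P (fun w => (- w)%C)).
    + apply holo_near_Diff. apply (strip_holo (- x) (- y)). rewrite Rabs_Ropp. exact Hx.
    + apply (Diff_ext_near (fun w => (RtoC 0 - w)%C) _ _ 1 Rlt_0_1); [intros; ring|diff_tac].
  - intros w Hw. apply C_eq_sub, E, Hw.
Qed.

Lemma strip_conj x y : 0 < Rabs x < 2 * om -> P (x, y) = Cconj (P (x, - y)).
Proof.
  intros Hx. destruct (weierstrass_conj P _ _ HP (x, y)) as [r [Hr E]].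
  apply (agree_at_regular P (fun w => Cconj (P (Cconj w))) (x, y) r Hr (strip_holo x y Hx)).
  - apply Diff_cont. destruct (holo_near_Diff P _ (strip_holo x (- y) Hx)) as [l Hl].
    exists (Cconj l). apply Cis_derive_conj. exact Hl.
  - intros w Hw. apply C_eq_sub, E, Hw.
Qed.

Lemma strip_period m n x y : 0 < Rabs x < 2 * om ->
  P (x + 2 * IZR m * om, y + 2 * IZR n * om') = P (x, y).
Proof.
  intros Hx.
  assert (Hp : is_period P (2 * IZR m * om, 2 * IZR n * om')) by (apply Hlat; eauto).
  exact (proj2 (Hp (x, y) (strip_holo x y Hx))).
Qed.

Lemma real_axis_real x : 0 < x < 2 * om -> snd (P (x, 0)) = 0.
Proof.
  intros Hx. assert (Hx' : 0 < Rabs x < 2 * om) by (rewrite Rabs_pos_eq; lra).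
  pose proof (strip_conj x 0 Hx') as E. rewrite Ropp_0 in E.
  apply (f_equal snd) in E. simpl in E. lra.
Qed.

Lemma om_strip : 0 < Rabs om < 2 * om.
Proof. rewrite Rabs_pos_eq; lra. Qed.

Lemma vertical_symmetry t y : Rabs t < om -> P (om + t, y) = P (om - t, - y).
Proof.
  intros Ht. apply Rabs_lt_between in Ht.
  rewrite strip_even by (rewrite Rabs_pos_eq; lra).
  rewrite <- (strip_period 1 0) by (rewrite Rabs_Ropp, Rabs_pos_eq; lra).
  f_equal. f_equal; ring.
Qed.

(** Evenness and the period [2 omega] make the values at [omega + i y] and [omega - i y] equal; by
    conjugation they are also conjugate. *)
Lemma vertical_real y : snd (P (om, y)) = 0.
Proof.
  pose proof (strip_conj om y om_strip) as E.
  pose proof (vertical_symmetry 0 y ltac:(rewrite Rabs_R0; exact Hom)) as E2.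
  rewrite Rplus_0_r, Rminus_0_r in E2. rewrite <- E2 in E.
  apply (f_equal snd) in E. simpl in E. lra.
Qed.

(** Twice the point is a period, so [P] is symmetric about it. The cases 0 and 1 give the two ends
    of the segment. *)
Lemma half_period_critical n : C_derive P (om, IZR n * om') = RtoC 0.
Proof.
  apply (symmetric_derivative P _ _ HP (om, IZR n * om') om Hom).
  - apply strip_holo, om_strip.
  - intros [x y] Hw.
    assert (Hx : Rabs (x - om) < om).
    { eapply Rle_lt_trans; [|exact Hw]. exact (fst_le_Cmod ((x, y) - (om, (IZR n * om')%R))%C). }
    pose proof (vertical_symmetry (x - om) y Hx) as E.
    replace (om + (x - om)) with x in E by ring. rewrite E.
    apply Rabs_lt_between in Hx.
    rewrite <- (strip_period 0 n) by (rewrite Rabs_pos_eq; lra).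
    f_equal. unfold Cminus, Cplus, Copp; simpl. f_equal; ring.
Qed.

Lemma strip_ode x y : 0 < Rabs x < 2 * om -> snd (P (x, y)) = 0 ->
  exists c, Cis_derive P (x, y) c /\ (c * c)%C = RtoC (rcubic k (fst (P (x, y)))).
Proof.
  intros Hx Hr. destruct (weierstrass_ode P _ _ (x, y) HP (strip_holo x y Hx)) as [D O].
  eexists. split; [exact D|]. rewrite O, <- wcubic_real. f_equal.
  destruct (P (x, y)) as [p q]. simpl in *. subst q. reflexivity.
Qed.

Lemma half_period_root n : rcubic k (fst (P (om, IZR n * om'))) = 0.
Proof.
  destruct (strip_ode om (IZR n * om') om_strip (vertical_real _)) as (c & D & O).
  rewrite <- (is_C_derive_unique _ _ _ D), half_period_critical in O. replace (RtoC 0 * RtoC 0)%C with (RtoC 0) in O by ring.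
  apply RtoC_inj in O. lra.
Qed.

Lemma derive_zero_near f l x r : 0 < r -> (forall y, Rabs (y - x) < r -> f y = 0) ->
  is_derive f x l -> l = 0.
Proof.
  intros Hr E H.
  assert (H0 : is_derive f x 0).
  { apply (is_derive_ext_loc (fun _ => 0)).
    - exists (mkposreal r Hr). intros y Hy. symmetry. apply E, Hy.
    - apply (is_derive_const (K := R_AbsRing) (V := R_NormedModule) 0). }
  rewrite <- (is_derive_unique _ _ _ H). apply is_derive_unique, H0.
Qed.

Lemma real_axis_derive x : 0 < x < 2 * om ->
  exists l, is_derive (fun x => fst (P (x, 0))) x l /\ l * l = rcubic k (fst (P (x, 0))).
Proof.
  intros Hx. assert (Hx' : 0 < Rabs x < 2 * om) by (rewrite Rabs_pos_eq; lra).
  destruct (strip_ode x 0 Hx' (real_axis_real x Hx)) as (c & D & O).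
  destruct (Rder_path P (fun x => (x, 0)) (RtoC 1) x c) as [R1 R2]; trivial.
  { intros y. unfold Cplus, Cmult, RtoC; simpl. f_equal; ring. }
  rewrite Cmult_1_r in R1, R2.
  assert (Z : snd c = 0).
  { apply (derive_zero_near (fun x => snd (P (x, 0))) _ x (Rmin x (2 * om - x))); trivial.
    - apply Rmin_glb_lt; lra.
    - intros y Hy. apply real_axis_real.
      assert (Y : Rabs (y - x) < x /\ Rabs (y - x) < 2 * om - x)
        by (unfold Rmin in Hy; destruct Rle_dec; lra).
      destruct Y as [Y1 Y2]. apply Rabs_lt_between in Y1. apply Rabs_lt_between in Y2. lra. }
  exists (fst c). split; [exact R1|].
  apply (f_equal fst) in O. simpl in O. rewrite Z in O. lra.
Qed.

(** Moving along the imaginary direction multiplies [P'] by [i], which changes the sign of the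
    equation: on this line [P] takes only values where the cubic is nonpositive, on the real axis
    only values where it is nonnegative. *)
Lemma vertical_derive y :
  exists l, is_derive (fun y => fst (P (om, y))) y l /\ l * l = - rcubic k (fst (P (om, y))).
Proof.
  destruct (strip_ode om y om_strip (vertical_real y)) as (c & D & O).
  destruct (Rder_path P (fun y => (om, y)) Ci y c) as [R1 R2]; trivial.
  { intros z. unfold Cplus, Cmult, RtoC, Ci; simpl. f_equal; ring. }
  assert (Z : snd (c * Ci)%C = 0).
  { apply (derive_zero_near (fun x => snd (P (om, x))) _ y 1 Rlt_0_1); trivial.
    intros z _. apply vertical_real. }
  exists (fst (c * Ci)%C). split; [exact R1|].
  destruct c as [c1 c2]. apply (f_equal fst) in O. simpl in O, Z. simpl.
  assert (Z1 : c1 = 0) by lra. subst c1. lra.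
Qed.

Lemma real_axis_near_pole M rho : 0 < rho -> exists x, 0 < x < rho /\ M < fst (P (x, 0)).
Proof.
  intros Hrho. destruct HP as (_ & H0 & _).
  destruct (pole_asymptotics P _ _ _ _ HP H0) as (r & _ & _ & HA).
  destruct (HA (/ 2)) as [d [Hd K]]; [lra|].
  (* The last bound gives [x^2 |M| <= x / 2 < 1 / 2], while [x^2] times the real part of [P] exceeds
     [1 / 2]. *)
  set (x := Rmin (Rmin (d / 2) (rho / 2)) (/ (2 * (Rabs M + 1)))).
  pose proof (Rabs_pos M) as HM.
  assert (Hi : 0 < / (2 * (Rabs M + 1))) by (apply Rinv_0_lt_compat; lra).
  assert (Hi1 : / (2 * (Rabs M + 1)) < 1).
  { rewrite <- Rinv_1. apply Rinv_lt_contravar; lra. }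
  assert (Hx : 0 < x /\ x < d /\ x < rho /\ x <= / (2 * (Rabs M + 1))).
  { unfold x, Rmin. repeat destruct Rle_dec; lra. }
  exists x. split; [lra|].
  assert (Hxp : x * (2 * (Rabs M + 1)) <= 1).
  { apply Rle_trans with (/ (2 * (Rabs M + 1)) * (2 * (Rabs M + 1))).
    - apply Rmult_le_compat_r; lra.
    - rewrite Rinv_l; lra. }
  destruct (K (x, 0)) as [K1 _].
  { replace ((x, 0) - RtoC 0)%C with (RtoC x).
    - rewrite Cmod_R, Rabs_pos_eq; lra.
    - unfold Cminus, Cplus, Copp, RtoC; simpl. f_equal; ring. }
  pose proof (Rle_lt_trans _ _ _ (fst_le_Cmod _) K1) as K2.
  replace ((x, 0) - RtoC 0)%C with (RtoC x) in K2
    by (unfold Cminus, Cplus, Copp, RtoC; simpl; f_equal; ring).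
  simpl in K2. set (p := fst (P (x, 0))) in *.
  replace ((x * x - 0 * 0) * p - (x * 0 + 0 * x) * snd (P (x, 0)) + - (1)) with (x * x * p - 1)
    in K2 by ring.
  apply Rabs_lt_between in K2.
  apply Rnot_le_lt. intros L. pose proof (Rle_abs M).
  assert (x * x * p <= x * x * Rabs M) by (apply Rmult_le_compat_l; nra).
  assert (x * x * Rabs M <= x * (x * (2 * (Rabs M + 1))) / 2) by nra.
  assert (x < 1) by lra. nra.
Qed.

Lemma continuous_avoids f a b c : a <= b -> (forall x, a <= x <= b -> continuity_pt f x) ->
  (forall x, a <= x <= b -> f x <> c) -> c < f a -> c < f b.
Proof.
  intros Hab Hf Hc Ha. apply Rnot_le_lt. intros Hb.
  assert (Hab' : a < b) by (destruct Hab as [L|L]; [exact L|subst; lra]).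
  destruct (Ranalysis5.f_interv_is_interv (fun x => - f x) a b (- c) Hab') as [x [Hx E]].
  - lra.
  - intros x Hx. apply continuity_pt_opp, Hf, Hx.
  - apply (Hc x Hx). lra.
Qed.

(** On the real axis the cubic is a square along [P], so the value [mid k], where it is negative, is
    never taken. [P] starts above it near the pole and hence is still above it at [omega]. *)
Lemma half_period_above : mid k < fst (P (om, 0)).
Proof.
  destruct (real_axis_near_pole (mid k) om Hom) as [x [Hx Mx]].
  apply (continuous_avoids (fun x => fst (P (x, 0))) x om); try lra.
  - intros y Hy. destruct (real_axis_derive y) as [l [D _]]; [lra|].
    exact (continuity_of_derive _ _ _ D).
  - intros y Hy E. destruct (real_axis_derive y) as [l [_ O]]; [lra|].
    rewrite E in O. pose proof (rcubic_mid k Hk). nra.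
Qed.

Lemma vertical_continuous y : continuity_pt (fun y => fst (P (om, y))) y.
Proof. destruct (vertical_derive y) as [l [D _]]. exact (continuity_of_derive _ _ _ D). Qed.

Lemma vertical_not_constant e : ~ (forall t, 0 < t < om' -> P (om, t) = RtoC e).
Proof.
  intros Hc. pose proof HP as (HM & H0 & _).
  (* The rotation turns the vertical segment into a horizontal one, as [right_zero] demands, and
     sends the point [i omega] to the pole 0, near which [P] is unbounded. *)
  assert (Z : punctured_zero (fun w => P (Ci * w + RtoC om) - RtoC e)%C (0, om)).
  { apply (identity_polar _ (RtoC 0)).
    - intros z. apply polar_minus; [|apply polar_const].
      apply polar_affine; [apply Cmod_Ci|apply (weierstrass_polar P _ _ HP)].
    - exists om'. split; [exact Hom'|]. intros x Hx.
      replace (Ci * (RtoC 0 + RtoC x) + RtoC om)%C with ((om, x) : C).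
      + rewrite Hc by exact Hx. apply C_sub_self.
      + unfold Cplus, Cmult, RtoC, Ci; simpl. f_equal; ring. }
  destruct Z as [r [Hr E]].
  destruct (real_axis_near_pole e r Hr) as [x [Hx Mx]].
  assert (Ex : P (x, 0) = RtoC e).
  { apply C_eq_sub. specialize (E (0, (om - x)%R)). cbv beta in E.
    replace (Ci * (0, (om - x)%R) + RtoC om)%C with ((x, 0) : C) in E.
    - apply E. replace ((0, (om - x)%R) - (0, om))%C with (- (Ci * RtoC x))%C.
      + rewrite Cmod_opp, Cmod_mult, Cmod_Ci, Cmod_R, Rabs_pos_eq; lra.
      + unfold Cminus, Cplus, Copp, Cmult, RtoC, Ci; simpl. f_equal; ring.
    - unfold Cplus, Cmult, RtoC, Ci; simpl. f_equal; ring. }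
  rewrite Ex in Mx. simpl in Mx. lra.
Qed.

Lemma mid_attained : exists t, 0 < t < om' /\ P (om, t) = RtoC (mid k).
Proof.
  set (y := fun t => fst (P (om, t))).
  set (e := y 0).
  pose proof half_period_above as He. fold (y 0) in He. fold e in He.
  assert (Re : rcubic k e = 0).
  { pose proof (half_period_root 0) as R0. rewrite Rmult_0_l in R0. exact R0. }
  assert (Re' : rcubic k (y om') = 0).
  { pose proof (half_period_root 1) as R0. rewrite Rmult_1_l in R0. exact R0. }
  pose proof (rcubic_mid k Hk) as Hm.
  apply NNPP. intros N.
  assert (Ny : forall t, 0 <= t <= om' -> y t <> mid k).
  { intros t Ht E. destruct (Req_dec t 0) as [->|N0].
    { change (e = mid k) in E. lra. }
    destruct (Req_dec t om') as [->|N1].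
    { rewrite E in Re'. lra. }
    apply N. exists t. split; [lra|].
    apply injective_projections; [exact E|apply vertical_real]. }
  assert (Yc : forall t, 0 <= t <= om' -> mid k < y t).
  { intros t Ht. apply (continuous_avoids y 0 t); try lra.
    - intros; apply vertical_continuous.
    - intros; apply Ny; lra.
    - exact He. }
  (* Above [e] the cubic is positive, but along the vertical line it is minus a square. *)
  assert (Yle : forall t, 0 <= t <= om' -> y t <= e).
  { intros t Ht. apply Rnot_lt_le. intros L.
    pose proof (rcubic_above k e (y t) Hk He Re L) as Q.
    destruct (vertical_derive t) as [l [_ O]]. change (l * l = - rcubic k (y t)) in O.
    pose proof (Rle_0_sqr l) as Q2. unfold Rsqr in Q2. lra. }
  (* At an endpoint the minimum is a root by the half-period lemma, inside by the vanishing
     derivative. The only root above [mid k] is [e], so [y] lies between [e] and [e]. *)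
  destruct (continuity_ab_min y 0 om') as [x [Hx Hx01]]; [lra|intros; apply vertical_continuous|].
  assert (Yx : y x = e).
  { apply (rcubic_root_unique k e (y x) Hk He Re (Yc x Hx01)).
    destruct (Req_dec x 0) as [->|N0]; [exact Re|].
    destruct (Req_dec x om') as [->|N1]; [exact Re'|].
    destruct (vertical_derive x) as [l [D O]]. change (l * l = - rcubic k (y x)) in O.
    assert (l = 0).
    { apply is_derive_Reals in D.
      pose (pr := exist _ l D : derivable_pt y x).
      change (derive_pt y x pr = 0).
      apply (deriv_minimum y 0 om'); try lra. intros z Hz1 Hz2. apply Hx; lra. }
    subst l. lra. }
  apply (vertical_not_constant e). intros t Ht.
  apply injective_projections; [|apply vertical_real].
  apply Rle_antisym; [apply Yle; lra|]. rewrite <- Yx. apply Hx; lra.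
Qed.
End Rectangle.

Theorem theorem7 (kappa : R) (d P : C -> C) (omega omega' : R) :
  0 < kappa < 1 ->
  (* d is the elliptic function extending cos psi, where sin psi = kappa sin phi,
     psi(0) = 0, and u = u_of kappa phi *)
  elliptic d ->
  (exists delta, 0 < delta /\ forall phi, Rabs phi < delta ->
       d (RtoC (u_of kappa phi)) = RtoC (cos (asin (kappa * sin phi)))) ->
  (* P = wp(.; 4/3 - kappa^2, 8/27 - kappa^2/3), with period lattice
     2 omega Z + 2 i omega' Z *)
  is_weierstrass P (4/3 - kappa ^ 2) (8/27 - kappa ^ 2 / 3) ->
  0 < omega -> 0 < omega' ->
  (forall p : C, is_period P p <->
     exists m n : Z, p = (2 * IZR m * omega, 2 * IZR n * omega')) ->
  exists t, 0 < t < omega' /\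
    simple_zero d (omega, t) /\ simple_zero d (omega, - t).
Proof.
  intros Hk [Hd _] Hcos HP Hom Hom' Hlat.
  destruct (mid_attained kappa P omega omega' Hk HP Hom Hom' Hlat) as [t [Ht Et]].
  pose proof (om_strip omega Hom) as Hs.
  exists t. split; [exact Ht|].
  split; apply (simple_zero_of_mid kappa d P); trivial;
    try apply amplitude_relation; trivial; try apply (strip_holo kappa P omega omega'); trivial.
  (* The value at the conjugate point is the conjugate of the real number [mid kappa], hence the
     same. *)
  rewrite (strip_conj kappa P omega omega') by assumption.
  rewrite Ropp_involutive, Et. unfold Cconj, RtoC; simpl. f_equal; ring.
Qed.
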